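(* Let $\mathbf{d}=\{d_n\}_{n=1}^\infty\in\mathcal{D}$ and $T\in\mathbb{N}$. Suppose that there exist constants $0<c_1\le c_2<\infty$, $c_3>0$, $\gamma\ge1$ and $N\in\mathbb{N}$ such that for all $n\ge N$, $c_1n^\gamma\le d_n\le c_2n^\gamma$ and $d_{n+1}-d_n\ge c_3n^{\gamma-1}$ hold. Assume also that $c_1N^\gamma>1$. Then the following (1) and (2) hold. (1) Suppose that $\mathcal{F}=\mathcal{F}(\mathbf{d},T)$ is a CIFS, and let $h_{\mathcal{F}}=\dim_H(J_{\mathcal{F}})$. Then: (a) if $h_{\mathcal{F}}<1/\gamma$, then $H_{h_{\mathcal{F}}}(J_{\mathcal{F}})=0$; (b) if $h_{\mathcal{F}}>1/\gamma$, then $\dim_P(J_{\mathcal{F}})=\dim_H(J_{\mathcal{F}})$ and $\Pi_{h_{\mathcal{F}}}(J_{\mathcal{F}})=\infty$; (c) if $T\ge c_2^{2/\gamma}(N+1)$, then $\dim_H(J_{\mathcal{F}})>1/\gamma$. (2) Suppose that $\mathcal{G}=\mathcal{G}(\mathbf{d},T)$ is a CIFS, and let $h_{\mathcal{G}}=\dim_H(J_{\mathcal{G}})$. Then: (a) if $h_{\mathcal{G}}<1/\gamma$, then $H_{h_{\mathcal{G}}}(J_{\mathcal{G}})=0$; (b) if $h_{\mathcal{G}}>1/\gamma$, then $\dim_P(J_{\mathcal{G}})=\dim_H(J_{\mathcal{G}})$ and $\Pi_{h_{\mathcal{G}}}(J_{\mathcal{G}})=\infty$; (c) if $T\ge c_2^{2/\gamma}(N+1)$,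 then $\dim_H(J_{\mathcal{G}})>1/\gamma$.
   Context: Notation. $\mathbb{N}$ is the set of positive integers, $\mathbb{D}=\{z\in\mathbb{C}:|z|<1\}$, $\mathbb{C}$ is identified with $\mathbb{R}^2$, $e(\theta)=e^{2\pi\sqrt{-1}\,\theta}$. $\dim_H,\dim_P$ are Hausdorff and packing dimension; $H_t$ and $\Pi_t$ are the $t$-dimensional Hausdorff and packing measures. CIFS. Let $X\subset\mathbb{R}^d$ be compact and connected and $I$ a countable (possibly finite) set with at least two elements. A family $\mathcal{S}=\{s_i:X\to X\}_{i\in I}$ of injective contractions is an IFS if $\sup_{i}\mathrm{Lip}(s_i)<1$. For $\omega=(\omega_1,\dots,\omega_N)\in I^N$ put $s_\omega=s_{\omega_1}\circ\dots\circ s_{\omega_N}$. The limit set is $J_{\mathcal{S}}=\bigcup_{\omega\in I^{\mathbb{N}}}\bigcap_{N\ge1}s_{\omega|_N}(X)$, where $\omega|_N=(\omega_1,\dots,\omega_N)$. An IFS $\mathcal{S}$ is a conformal IFS (CIFS) if: (Open Set Condition) $s_i(\mathrm{Int}\,X)\cap s_j(\mathrm{Int}\,X)=\emptyset$ for $i\ne j$; (Cone Condition) there are $0<\alpha<\pi/2$, $l>0$ such that for every $x\in\partial X$ there is $u_x\neq0$ with $\{y:0<|y-x|<l,\ \langle y-x,u_x\rangle>|y-x||u_x|\cos\alpha\}\subset\mathrm{Int}(X)$; (Conformality) there is an open connected $V\supset X$ such that all $s_i$ extend to $C^{1+\varepsilon}$ diffeomorphisms on $V$ that are conformal on $V$;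 (Bounded Distortion) there is $K\ge1$ with $|s_\omega'(y)|\le K|s_\omega'(x)|$ for all $\omega\in\bigcup_N I^N$, $x,y\in V$, where $|s'_\omega(x)|$ is the operator norm of the derivative. The systems. $\mathcal{D}$ is the set of real sequences $\{d_n\}_{n\ge1}$ with $d_1\ge2$ and $d_{n+1}-d_n\ge2$ for all $n$. For $\alpha\in\mathbb{C}$, $|\alpha|\ge2$, define $f_\alpha,g_\alpha:\overline{\mathbb{D}}\to\overline{\mathbb{D}}$ by $f_\alpha(z)=\frac{z+\overline{\alpha}}{|\alpha|^2-1}$, $g_\alpha(z)=\frac1{z+\alpha}$. For $\mathbf{d}=\{d_n\}\in\mathcal{D}$, $T\in\mathbb{N}$: $\mathcal{F}(\mathbf{d},T)=\{f_{e(j/T)d_n}:n\in\mathbb{N},\,j=0,\dots,T-1\}$ and $\mathcal{G}(\mathbf{d},T)=\{g_{e(j/T)d_n}:n\in\mathbb{N},\,j=0,\dots,T-1\}$, families of maps on $X=\overline{\mathbb{D}}$. *)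

(* Defs.v *)
From HB Require Import structures.
From mathcomp Require Import all_boot all_order all_algebra.
From mathcomp Require Import complex.
From mathcomp Require Import all_classical all_reals all_analysis.

Set Implicit Arguments.
Unset Strict Implicit.
Unset Printing Implicit Defensive.

Import Order.TTheory GRing.Theory Num.Theory.
Import numFieldNormedType.Exports.

Local Open Scope classical_set_scope.
Local Open Scope ring_scope.

(* The norm carried by ['rV[R]_n] in the library is the sup norm.  It is used
   only through the topology and the notion of differential, which agree with
   the Euclidean ones; every metric quantity below is Euclidean. *)

Section Euclidean.
Variables (R : realType) (n : nat).
Local Notation E := 'rV[R]_n.
Implicit Types (x y v : E) (A U : set E) (t delta : R).

Definition dot x y : R := \sum_(i < n) x 0 i * y 0 i.

Definition enorm x : R := Num.sqrt (dot x x).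

Definition closed_eball x (r : R) : set E := [set y | enorm (y - x) <= r].

(* The value on [set0] is [-oo]; it is never used. *)
Definition ediam U : \bar R :=
  ereal_sup [set (enorm (x - y))%:E | x in U & y in U].

(* Covers are sequences of possibly empty sets, the empty ones contributing
   nothing, so finite covers are included.  As [poweR x 0 = 1], the case [t = 0]
   gives the counting measure. *)
Definition hausdorff_pre t delta A : \bar R :=
  ereal_inf [set (\esum_(i in [set i | U i !=set0]) poweR (ediam (U i)) t)%E
            | U in [set U : nat -> set E |
                     A `<=` \bigcup_i U i /\
                     forall i, (ediam (U i) <= delta%:E)%E]].

Definition hausdorff_measure t A : \bar R :=
  ereal_sup [set hausdorff_pre t delta A | delta in [set delta | 0 < delta]].

Definition hausdorff_dim A : \bar R :=
  ereal_inf [set t%:E | t in [set t | 0 <= t /\ hausdorff_measure t A = 0%E]].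

(* [is_packing delta A D x r]: the closed balls of centres [x i] and radii [r i],
   for [i] in the (finite or infinite) index set [D], form a
   [delta]-packing of [A]. *)
Definition is_packing delta A (D : set nat) (x : nat -> E) (r : nat -> R) :=
  (forall i, D i -> [/\ A (x i), 0 < r i & 2 * r i <= delta]) /\
  trivIset D (fun i => closed_eball (x i) (r i)).

Definition packing_delta t delta A : \bar R :=
  ereal_sup [set s | exists (D : set nat) (x : nat -> E) (r : nat -> R),
                     is_packing delta A D x r /\
                     s = (\esum_(i in D) ((2 * r i) `^ t)%:E)%E].

Definition packing_pre t A : \bar R :=
  ereal_inf [set packing_delta t delta A | delta in [set delta | 0 < delta]].

(* [packing_pre t] is not countably subadditive; the packing measure is the
   outer measure it generates. *)
Definition packing_measure t A : \bar R :=
  ereal_inf [set (\esum_(k in [set: nat]) packing_pre t (B k))%E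
            | B in [set B : nat -> set E | A `<=` \bigcup_k B k]].

Definition packing_dim A : \bar R :=
  ereal_inf [set t%:E | t in [set t | 0 <= t /\ packing_measure t A = 0%E]].

End Euclidean.

Section IteratedFunctionSystems.
Variables (R : realType) (n : nat) (I : Type).
Local Notation E := 'rV[R]_n.
Implicit Types (X V : set E) (s : I -> E -> E).

(* For [x = y] the quotient is [0 / 0 = 0] by convention, which does not affect
   the supremum of the other, nonnegative, quotients. *)
Definition lip_const X (f : E -> E) : \bar R :=
  ereal_sup [set (enorm (f x - f y) / enorm (x - y))%:E | x in X & y in X].

(* The maps [s i] are total; only their values on [X] matter. *)
Definition is_IFS X s : Prop :=
  [/\ compact X /\ connected X,
      countable [set: I] /\ (exists i j : I, i <> j),
      forall i, s i @` X `<=` X,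
      forall i, set_inj X (s i) &
      (ereal_sup [set lip_const X (s i) | i in [set: I]] < 1)%E].

Definition word_map s (w : seq I) : E -> E :=
  foldr (fun i f => s i \o f) id w.

Definition limit_set X s : set E :=
  \bigcup_(w in [set: nat -> I])
    \bigcap_(N in [set N | (0 < N)%N]) (word_map s (mkseq w N) @` X).

Definition open_set_condition X s : Prop :=
  forall i j, i <> j -> s i @` interior X `&` s j @` interior X = set0.

Definition cone_condition X : Prop :=
  exists a l : R, [/\ 0 < a, a < pi / 2, 0 < l &
    forall x, (closure X `\` interior X) x ->
      exists2 u : E, u != 0 &
        [set y | [/\ 0 < enorm (y - x), enorm (y - x) < l &
                  dot (y - x) u > enorm (y - x) * enorm u * cos a]]
          `<=` interior X].

Definition opnorm (L : E -> E) : R :=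
  sup [set enorm (L v) | v in [set v | enorm v <= 1]].

Definition C1_holder (eps : R) V (f : E -> E) : Prop :=
  (forall x, V x -> differentiable f x) /\
  (forall x, V x -> exists C : R, \forall y \near x & z \near x,
      opnorm (fun v => 'd f y v - 'd f z v) <= C * enorm (y - z) `^ eps).

(* A C^{1+eps} diffeomorphism of the open set [V] onto an open subset of R^n. *)
Definition C1_holder_diffeo (eps : R) V (f : E -> E) : Prop :=
  [/\ C1_holder eps V f, open (f @` V) &
      exists2 g : E -> E, C1_holder eps (f @` V) g &
                          forall x, V x -> g (f x) = x].

Definition conformal_on V (f : E -> E) : Prop :=
  forall x, V x ->
    exists2 c : R, 0 < c & forall v, enorm ('d f x v) = c * enorm v.

(* The extensions map [V] into itself, so that the compositions occurring in
   [bounded_distortion] are defined on [V]. *)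
Definition conformal_extension X s V (sV : I -> E -> E) : Prop :=
  [/\ open V, connected V, X `<=` V,
      forall i, {in X, sV i =1 s i} /\ sV i @` V `<=` V &
      exists2 eps : R, 0 < eps &
        forall i, C1_holder_diffeo eps V (sV i) /\ conformal_on V (sV i)].

Definition bounded_distortion V (sV : I -> E -> E) : Prop :=
  exists2 K : R, 1 <= K & forall w : seq I, (0 < size w)%N ->
    forall x y, V x -> V y ->
      opnorm ('d (word_map sV w) y) <= K * opnorm ('d (word_map sV w) x).

Definition is_CIFS X s : Prop :=
  [/\ is_IFS X s, open_set_condition X s, cone_condition X &
      exists V sV, conformal_extension X s V sV /\ bounded_distortion V sV].

End IteratedFunctionSystems.

Section Systems.
Variable R : realType.
Implicit Types (alpha z : R[i]) (d : nat -> R) (T : nat).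

(* The identification of C with R^2. *)
Definition C_of_vec (v : 'rV[R]_2) : R[i] := Complex (v 0 0) (v 0 1).

Definition vec_of_C z : 'rV[R]_2 :=
  \row_(j < 2) (if j == 0 then complex.Re z else complex.Im z).

Definition plane_map (f : R[i] -> R[i]) (v : 'rV[R]_2) : 'rV[R]_2 :=
  vec_of_C (f (C_of_vec v)).

Definition closed_disk : set 'rV[R]_2 := closed_eball 0 1.

(* Sequences are indexed from 1: the value [d 0] is irrelevant. *)
Definition calD : set (nat -> R) :=
  [set d | 2 <= d 1%N /\ forall n, (1 <= n)%N -> 2 <= d n.+1 - d n].

Definition expi (theta : R) : R[i] :=
  Complex (cos (2 * pi * theta)) (sin (2 * pi * theta)).

Definition f_map alpha z : R[i] := (z + conjc alpha) / (`|alpha| ^+ 2 - 1).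

Definition g_map alpha z : R[i] := (z + alpha)^-1.

(* The index [(n, j)] stands for the pair (n + 1, j): the indices of [d] run
   over the positive integers. *)
Definition sys_param d T (p : nat * 'I_T) : R[i] :=
  expi (p.2%:R / T%:R) * real_complex R (d p.1.+1).

Definition sys_F d T (p : nat * 'I_T) : 'rV[R]_2 -> 'rV[R]_2 :=
  plane_map (f_map (sys_param d p)).

Definition sys_G d T (p : nat * 'I_T) : 'rV[R]_2 -> 'rV[R]_2 :=
  plane_map (g_map (sys_param d p)).

End Systems.

Arguments sys_F {R} d T p.
Arguments sys_G {R} d T p.
Arguments closed_disk {R}.
Arguments calD {R}.

(* Main.v *)
(* Both systems consist of maps of the disk whose compositions [s w] are
   bi-Lipschitz up to a uniform constant with ratios [r w]: similarities for F,
   Moebius maps for G, where the distortion is controlled by the continued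
   fraction denominators.  Let [h] be the dimension of the limit set J.

   Mass distribution over a finite antichain W of words shows that
   [sum_W (r w / K)^t > 1] forces [dim J > t]; hence [sum_W r w ^ h <= K ^ h] for
   every antichain W.  This gives (c) with W a finite set of letters.

   The maps with letters beyond M send the disk into a ball of radius ~ M^-gamma
   around 0, while the h-th powers of their ratios add up to ~ M^(1 - 2 gamma h).
   So the words over the letters below M have [sum r w ^ h] of order
   M^(2 gamma h - 1): an upper bound by the antichain inequality, a lower bound
   (if h > 1/gamma) because otherwise J could be covered cheaply at an exponent
   t < h.  Covering all letters beyond M by that one ball costs, after iteration,
   M^(2 gamma h - 1) M^(- gamma h) = M^(gamma h - 1), which tends to 0 if
   h < 1/gamma: this is (a).  If h > 1/gamma, placing balls of radius ~ M^-gamma at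
   the same places packs J with sums of order M^(gamma h - 1), which tends to
   infinity; a Baire argument on cylinders extends this from the packing
   premeasure to the packing measure.  For t > h, a packing of J is compared
   with the convergent sum [sum_w r w ^ t], each word [w] accounting for the balls
   centred in its cylinder at scale [r w]; this uses that
   [sum_n (n ^ - gamma) ^ t] converges. *)

Require Import Defs.
From HB Require Import structures.
From mathcomp Require Import all_boot all_order all_algebra.
From mathcomp Require Import complex ring lra zify.
From mathcomp Require Import all_classical all_reals all_analysis.

Import Order.TTheory GRing.Theory Num.Theory.
Import numFieldNormedType.Exports.

Local Open Scope classical_set_scope.
Local Open Scope ring_scope.

Import ComplexField.Normc.

Set Implicit Arguments.
Unset Strict Implicit.

(** * Euclidean plane *)

(** The threshold [1 / gamma] comes from a mismatch of scales at 0: the image of letter n has size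
    about n^(-2 gamma) but lies at distance about n^(-gamma) from 0. An h-conformal measure would
    give the ball of radius M^(-gamma) about 0 a mass of order M^(1 - 2 gamma h), hence an h-density
    of order M^(1 - gamma h), unbounded below the threshold and vanishing above it. In an infinite
    system such a measure may fail to exist, so none is used. Its upper bound is replaced by the
    antichain inequality, valid at h itself because a finite sum is continuous in the exponent, so
    that mass distribution concludes strictly. Its lower bound is replaced by a recursion for the
    Hausdorff content of J. Mass distribution builds no measure either: a recursion of finite depth
    assigns a mass to each covering set. For G the distortion constant blows up as d 1 tends to 2;
    the supremum of the Lipschitz constants being below 1 excludes d 1 = 2. *)

Section Plane.
Context {R : realType}.
Local Notation E := 'rV[R]_2.
Implicit Types (x y z v : E) (t u : R).

Lemma enormE v : enorm v = Num.sqrt (v 0 0 ^+ 2 + v 0 1 ^+ 2).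
Proof.
rewrite /enorm /dot !big_ord_recl big_ord0 addr0 !expr2.
by have -> : lift ord0 ord0 = 1 :> 'I_2 by exact: val_inj.
Qed.

Lemma enorm_normc v : enorm v = normc (C_of_vec v).
Proof. by rewrite enormE. Qed.

Lemma C_of_vecD x y : C_of_vec (x + y) = C_of_vec x + C_of_vec y.
Proof. by rewrite /C_of_vec !mxE. Qed.

Lemma C_of_vecN x : C_of_vec (- x) = - C_of_vec x.
Proof. by rewrite /C_of_vec !mxE. Qed.

Lemma enorm_ge0 v : 0 <= enorm v.
Proof. exact: sqrtr_ge0. Qed.

Lemma enorm0 : enorm (0 : E) = 0.
Proof. by rewrite enormE !mxE expr0n /= addr0 sqrtr0. Qed.

Lemma enormN v : enorm (- v) = enorm v.
Proof. by rewrite !enormE !mxE !sqrrN. Qed.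

Lemma edistC x y : enorm (x - y) = enorm (y - x).
Proof. by rewrite -enormN opprB. Qed.

Lemma enormD x y : enorm (x + y) <= enorm x + enorm y.
Proof. by rewrite !enorm_normc C_of_vecD le_normcD. Qed.

Lemma edist_triangle y x z : enorm (x - z) <= enorm (x - y) + enorm (y - z).
Proof. by rewrite (le_trans _ (enormD _ _)) // addrA subrK. Qed.

Lemma enorm_eq0 v : enorm v = 0 -> v = 0.
Proof.
rewrite enorm_normc => /eq0_normc /eqP; rewrite eq_complex /= => /andP[/eqP v0 /eqP v1].
by apply/rowP => i; rewrite mxE; have [->|->] : i = 0 \/ i = 1;
  [case: i => -[|[|//]] ? /=; [left|right]; exact: val_inj| |].
Qed.

Lemma norm_coord_le v i : `|v 0 i| <= enorm v.
Proof.
rewrite -sqrtr_sqr enormE ler_wsqrtr //.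
have [->|->] : i = 0 \/ i = 1;
  [case: i => -[|[|//]] ? /=; [left|right]; exact: val_inj| |].
- by rewrite lerDl sqr_ge0.
- by rewrite lerDr sqr_ge0.
Qed.

Lemma enorm_le_sum v : enorm v <= `|v 0 0| + `|v 0 1|.
Proof.
rewrite enormE -[leRHS]ger0_norm ?addr_ge0 // -sqrtr_sqr.
apply: ler_wsqrtr; rewrite sqrrD !real_normK ?num_real //.
by rewrite -addrA [_ *+ 2 + _]addrC addrA lerDl mulrn_wge0 // mulr_ge0.
Qed.

(** Pigeonhole on a grid of mesh [sigma / 2]: two points of one cell are at distance at most sigma /
    sqrt 2, and each axis of the square of side 2 B sigma carries 4 B + 1 cells, the last one for
    its right end. *)
Lemma separated_count (T : eqType) (s : seq T) (x : T -> E) z (sigma : R) (B : nat) :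
  0 < sigma -> uniq s ->
  (forall i, i \in s -> enorm (x i - z) <= B%:R * sigma) ->
  (forall i j, i \in s -> j \in s -> i != j -> sigma <= enorm (x i - x j)) ->
  (size s <= (4 * B + 1) ^ 2)%N.
Proof.
move=> s0 us sB sep.
pose cell (k : 'I_2) i := Num.truncn (((x i - z) 0 k / sigma + B%:R) *+ 2).
have cellb k i : i \in s -> 0 <= ((x i - z) 0 k / sigma + B%:R) *+ 2 <= (4 * B)%:R.
  move=> /sB /(le_trans (norm_coord_le _ k)).
  rewrite ler_norml => /andP[h1 h2]; apply/andP; split.
    by rewrite mulrn_wge0 // -lerBlDr sub0r ler_pdivlMr // mulNr.
  have -> : (4 * B)%:R = (B%:R + B%:R : R) *+ 2 by rewrite natrM; ring.
  by rewrite lerMn2r /= lerD2r ler_pdivrMr.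
have cellP k i : i \in s -> (cell k i < (4 * B).+1)%N.
  move=> /(cellb k) /andP[c0 c1]; rewrite ltnS.
  by rewrite -(ler_nat R) (le_trans _ c1) // truncn_le.
pose f i : 'I_(4 * B).+1 * 'I_(4 * B).+1 := (inord (cell 0 i), inord (cell 1 i)).
have finj : {in s &, injective f}.
  move=> i j si sj [e0 e1].
  move: (congr1 val e0) (congr1 val e1).
  rewrite /= (inordK (cellP 0 i si)) (inordK (cellP 0 j sj)) (inordK (cellP 1 i si)) (inordK (cellP 1 j sj)).
  move=> {}e0 {}e1.
  apply/eqP/negPn/negP => ij.
  have := sep _ _ si sj ij; apply/negP; rewrite -ltNge.
  have dk k : cell k i = cell k j -> `|(x i - x j) 0 k| <= sigma / 2.
    move=> e; have /andP[ci _] := cellb k i si; have /andP[cj _] := cellb k j sj.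
    have := truncn_itv ci; have := truncn_itv cj; rewrite -/(cell k i) -/(cell k j) e.
    move=> /andP[a1 a2] /andP[b1 b2].
    have E1 : (x i - x j) 0 k = (((x i - z) 0 k / sigma + B%:R) *+ 2
       - ((x j - z) 0 k / sigma + B%:R) *+ 2) * (sigma / 2).
      by rewrite !mxE; field; rewrite gt_eqF.
    rewrite E1 normrM (ger0_norm (ltW (divr_gt0 s0 _))) //.
    rewrite -[leRHS]mul1r ler_pM2r ?divr_gt0 // ler_norml.
    by move: a1 a2 b1 b2; rewrite -natr1 => a1 a2 b1 b2; apply/andP; split; lra.
  have h0 := dk _ e0; have h1 := dk _ e1.
  rewrite enormE.
  have -> : sigma = Num.sqrt (sigma ^+ 2) by rewrite sqrtr_sqr ger0_norm // ltW.
  rewrite ltr_sqrt ?exprn_gt0 //.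
  rewrite -[X in X + _]real_normK ?num_real // -[X in _ + X]real_normK ?num_real //.
  have q k : `|(x i - x j) 0 k| <= sigma / 2 -> `|(x i - x j) 0 k| ^+ 2 <= sigma ^+ 2 / 4.
    move=> hk; have -> : sigma ^+ 2 / 4 = (sigma / 2) ^+ 2 by field.
    by rewrite ler_pXn2r // nnegrE // divr_ge0 // ltW.
  have := q _ h0; have := q _ h1; have : 0 < sigma ^+ 2 by rewrite exprn_gt0.
  lra.
rewrite -(size_map f) -(@card_uniqP _ [seq f i | i <- s] _); last by rewrite map_inj_in_uniq.
by rewrite (leq_trans (max_card _)) // card_prod !card_ord addn1 expnS expn1.
Qed.

End Plane.

(** * Covers and the Hausdorff measure *)

Section Covers.
Context {R : realType} {n : nat}.
Local Notation E := 'rV[R]_n.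
Implicit Types (A B : set E) (t s delta : R).

(** A real-valued stand-in for [hausdorff_pre]: [u] bounds the diameters from above and the sums are
    partial, so neither extended reals nor diameters of empty sets occur. A spare index takes an
    empty set and [u i = 0]; this is free only for [t != 0], as 0 to the power 0 is 1. *)
Definition coverable t delta A s := exists (U : nat -> set E) (u : nat -> R),
  [/\ A `<=` \bigcup_i U i,
      forall i x y, U i x -> U i y -> enorm (x - y) <= u i,
      forall i, 0 <= u i <= delta &
      forall k, \sum_(i < k) u i `^ t <= s].

Lemma coverable_ge0 t delta A s : coverable t delta A s -> 0 <= s.
Proof. by move=> [U [u [_ _ _ /(_ 0%N)]]]; rewrite big_ord0. Qed.

Lemma coverable_subset t delta A B s s' : A `<=` B -> s <= s' ->
  coverable t delta B s -> coverable t delta A s'.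
Proof.
move=> AB ss' [U [u [h1 h2 h3 h4]]]; exists U, u; split=> //.
  exact: subset_trans AB h1.
by move=> k; exact: le_trans (h4 k) ss'.
Qed.

Lemma coverable_diam t delta A (v : R) : t != 0 -> 0 <= v <= delta ->
  (forall x y, A x -> A y -> enorm (x - y) <= v) -> coverable t delta A (v `^ t).
Proof.
move=> t0 /andP[v0 vd] Av.
exists (fun i => match i return set E with 0%N => A | _ => set0 end),
  (fun i => if i is 0%N then v else 0).
split=> //.
- by move=> x Ax; exists 0%N.
- by move=> [|i] x y //; exact: Av.
- by move=> [|i]; rewrite ?v0 ?lexx ?(le_trans v0 vd).
- case=> [|k]; first by rewrite big_ord0 powR_ge0.
  by rewrite big_ord_recl big1 ?addr0 // => i _; rewrite powR0.
Qed.

(** The covers are interleaved by parity; the first k terms are among the first 2k, which are k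
    terms of each cover. *)
Lemma coverableU t delta A B s s' : coverable t delta A s ->
  coverable t delta B s' -> coverable t delta (A `|` B) (s + s').
Proof.
move=> [U [u [U1 U2 U3 U4]]] [V [v [V1 V2 V3 V4]]].
pose w i := if odd i then v i./2 else u i./2.
exists (fun i => if odd i then V i./2 else U i./2), w.
have od m : odd m.*2.+1 by rewrite /= odd_double.
have oe m : odd m.*2 = false by rewrite odd_double.
split.
- move=> x [/U1[i _ Ux]|/V1[i _ Vx]].
    by exists i.*2 => //=; rewrite oe doubleK.
  by exists i.*2.+1 => //; rewrite od /= uphalf_double.
- by move=> i x y; rewrite /w; case: ifP => _; [exact: V2|exact: U2].
- by move=> i; rewrite /w; case: ifP.
- move=> k.
  have double_sum m : \sum_(i < m.*2) w i `^ t =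
      \sum_(i < m) u i `^ t + \sum_(i < m) v i `^ t.
    elim: m => [|m IH]; first by rewrite !big_ord0 addr0.
    rewrite doubleS !big_ord_recr /= IH /w oe doubleK od /= uphalf_double.
    by ring.
  apply: (@le_trans _ _ (\sum_(i < k.*2) w i `^ t)).
    rewrite -addnn big_split_ord /= lerDl.
    by apply: sumr_ge0 => i _; exact: powR_ge0.
  by rewrite double_sum lerD.
Qed.

Lemma coverable_bigcup (T : eqType) (r : seq T) t delta (F : T -> set E)
    (f : T -> R) : t != 0 -> 0 <= delta ->
  (forall i, i \in r -> coverable t delta (F i) (f i)) ->
  coverable t delta [set x | exists2 i, i \in r & F i x] (\sum_(i <- r) f i).
Proof.
move=> t0 d0; elim: r => [|a r IH] Fr.
  rewrite big_nil -(powR0 t0); apply: coverable_diam => //; first by rewrite lexx.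
  by move=> x y [].
rewrite big_cons.
apply: (@coverable_subset _ _ _ (F a `|` [set x | exists2 i, i \in r & F i x]) _ _ _ (lexx _)).
  move=> x [j]; rewrite inE => /predU1P[->|jr Fj]; [by left|by right; exists j].
apply: coverableU; first by apply: Fr; rewrite mem_head.
by apply: IH => i ir; apply: Fr; rewrite inE ir orbT.
Qed.

Lemma coverable_image t delta A s (f : E -> E) (L : R) : 0 <= L ->
  (forall x y, A x -> A y -> enorm (f x - f y) <= L * enorm (x - y)) ->
  coverable t delta A s -> coverable t (L * delta) (f @` A) (L `^ t * s).
Proof.
move=> L0 fL [U [u [U1 U2 U3 U4]]].
exists (fun i => f @` (U i `&` A)), (fun i => L * u i); split.
- by move=> _ [x Ax <-]; have [i _ Ux] := U1 _ Ax; exists i => //; exists x.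
- move=> i _ _ [x [Ux Ax] <-] [y [Uy Ay] <-].
  by rewrite (le_trans (fL _ _ Ax Ay)) // ler_wpM2l // U2.
- by move=> i; have /andP[u0 ud] := U3 i; rewrite mulr_ge0 //= ler_wpM2l.
- move=> k; under eq_bigr do rewrite powRM // ?(andP (U3 _)).1 //.
  by rewrite -mulr_sumr ler_wpM2l ?powR_ge0.
Qed.

(** Cutting a cover down to A lowers its scale to the diameter of A. This restores a fixed scale
    after a word map, so that covers of cylinders can be reassembled into covers of J. *)
Lemma coverable_cap t delta A s (v : R) : 0 <= t -> 0 <= v ->
  (forall x y, A x -> A y -> enorm (x - y) <= v) ->
  coverable t delta A s -> coverable t v A s.
Proof.
move=> t0 v0 Av [U [u [U1 U2 U3 U4]]].
exists (fun i => U i `&` A), (fun i => Num.min (u i) v); split.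
- by move=> x Ax; have [i _ Ux] := U1 _ Ax; exists i.
- by move=> i x y [Ux Ax] [Uy Ay]; rewrite le_min U2 // Av.
- by move=> i; have /andP[u0 _] := U3 i; rewrite le_min u0 v0 ge_min lexx orbT.
- move=> k; apply: le_trans (U4 k); apply: ler_sum => i _.
  have /andP[u0 _] := U3 i.
  by rewrite ge0_ler_powR ?nnegrE ?le_min ?u0 ?v0 ?ge_min ?lexx.
Qed.

(** A sum of at most delta'^t forces every [u i] below delta', so for null sets the scale of the
    covers is immaterial. *)
Lemma coverable_small t delta A : 0 < t ->
  (forall eps, 0 < eps -> coverable t delta A eps) ->
  forall delta' eps, 0 < delta' -> 0 < eps -> coverable t delta' A eps.
Proof.
move=> t0 Acov d' eps d'0 eps0.
have m0 : 0 < Num.min eps (d' `^ t) by rewrite lt_min eps0 powR_gt0.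
have [U [u [U1 U2 U3 U4]]] := Acov _ m0; exists U, u; split=> //.
- move=> i; have /andP[u0 _] := U3 i; rewrite u0 /=.
  rewrite leNgt; apply/negP => du.
  have : u i `^ t <= d' `^ t.
    rewrite (@le_trans _ _ (Num.min eps (d' `^ t))) //; last by rewrite ge_min lexx orbT.
    apply: le_trans (U4 i.+1); rewrite big_ord_recr /= lerDr.
    by apply: sumr_ge0 => j _; exact: powR_ge0.
  by apply/negP; rewrite -ltNge gt0_ltr_powR // nnegrE // ltW.
- by move=> k; rewrite (le_trans (U4 k)) // ge_min lexx.
Qed.

Lemma ediam_le (U : set E) (u : R) :
  (forall x y, U x -> U y -> enorm (x - y) <= u) -> (ediam U <= u%:E)%E.
Proof. by move=> Uu; apply: ge_ereal_sup => _ [x Ux [y Uy <-]]; rewrite lee_fin Uu. Qed.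

Lemma ediam_ge0 (U : set E) : U !=set0 -> (0 <= ediam U)%E.
Proof.
move=> [x Ux]; apply: le_ereal_sup_tmp; exists (enorm (x - x))%:E; last first.
  by rewrite lee_fin sqrtr_ge0.
by exists x => //; exists x.
Qed.

Lemma coverable_hausdorff0 t A : 0 <= t ->
  (forall delta eps, 0 < delta -> 0 < eps -> coverable t delta A eps) ->
  hausdorff_measure t A = 0%E.
Proof.
move=> t0 Acov; apply/eqP; rewrite eq_le; apply/andP; split; last first.
  apply: le_ereal_sup_tmp; exists (hausdorff_pre t 1 A); first by exists 1 => //=.
  apply: le_ereal_inf_tmp => _ [U _ <-]; apply: esum_ge0 => i _; exact: poweR_ge0.
apply: ge_ereal_sup => _ [delta /= d0 <-].
apply/lee_addgt0Pr => eps eps0; rewrite add0e.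
have [U [u [U1 U2 U3 U4]]] := Acov _ _ d0 eps0.
apply: ge_ereal_inf; eexists.
  exists U; last by reflexivity.
  split=> // i; apply: ediam_le => x y Ux Uy.
  by have /andP[_] := U3 i; apply: le_trans; exact: U2.
rewrite esum_mkcond.
apply: (@le_trans _ _ (\esum_(i in [set: nat]) (u i `^ t)%:E)%E).
  apply: le_esum => i _; case: ifP => [/set_mem Ui|_]; last by rewrite lee_fin powR_ge0.
  have := ediam_ge0 Ui; have := ediam_le (U2 i); case: (ediam (U i)) => // r.
  rewrite !lee_fin => ru r0; rewrite ge0_ler_powR ?nnegrE //.
  exact: le_trans r0 ru.
rewrite -nneseries_esumT; last by move=> i; rewrite lee_fin powR_ge0.
apply: lime_le; first by apply: is_cvg_nneseries => i _ _; rewrite lee_fin powR_ge0.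
by apply: nearW => k; rewrite sumEFin lee_fin big_mkord U4.
Qed.

Lemma hausdorff0_coverable t t' delta eps A : 0 <= t' -> t' <= t -> 0 < t ->
  0 < delta -> delta <= 1 -> 0 < eps ->
  hausdorff_measure t' A = 0%E -> coverable t delta A eps.
Proof.
move=> t'0 tt' t0 d0 d1 eps0 HA.
have : (hausdorff_pre t' delta A < eps%:E)%E.
  rewrite (@le_lt_trans _ _ 0%E) // -HA.
  by apply: ereal_sup_ubound; exists delta.
move=> /ereal_inf_lt[_ [U [U1 U2] <-]] Ueps.
pose u i := if `[< U i !=set0 >] then fine (ediam (U i)) else 0.
have ediamE i : U i !=set0 -> ediam (U i) = (u i)%:E.
  move=> Ui; rewrite /u asboolT // fineK //.
  by have := ediam_ge0 Ui; have := U2 i; case: (ediam (U i)).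
have u01 i : 0 <= u i <= delta.
  have [Ui|Ui] := pselect (U i !=set0).
    rewrite -!lee_fin -ediamE // U2 andbT; exact: ediam_ge0.
  by rewrite /u asboolF // lexx ltW.
exists U, u; split=> //.
  move=> i x y Ux Uy; rewrite -lee_fin -ediamE; last by exists x.
  by apply: ereal_sup_ubound; exists x => //; exists y.
move=> k; rewrite -lee_fin; apply: le_trans (ltW Ueps).
rewrite esum_mkcond -nneseries_esumT; last first.
  by move=> i; case: ifP => _; [exact: poweR_ge0|].
apply: le_trans (nneseries_lim_ge k _); last first.
  by move=> i _ _; case: ifP => _; [exact: poweR_ge0|].
rewrite big_mkord -sumEFin; apply: lee_sum => i _; case: ifPn => [/set_mem Ui|].
  rewrite ediamE // poweR_EFin lee_fin.
  have /andP[ui0 ui1] := u01 i.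
  (* A set of diameter 0 still counts 1 in the Hausdorff sum when t' = 0, but costs nothing at t >
     0. *)
  move: ui0; rewrite le_eqVlt => /predU1P[<-|ui0]; first by rewrite powR0 ?powR_ge0 // gt_eqF.
  by rewrite ger_powR // ui0 (le_trans ui1).
move=> /negP Ui; rewrite /u asboolF ?powR0 ?gt_eqF // => Ui'.
by apply: Ui; exact: mem_set.
Qed.

Lemma hausdorff_dim_ge (A : set E) t : 0 < t ->
  (exists2 c : R, 0 < c & forall s, coverable t 1 A s -> c <= s) ->
  (t%:E <= hausdorff_dim A)%E.
Proof.
move=> t0 [c c0 cA]; apply: le_ereal_inf_tmp => _ [t' [t'0 HA] <-].
rewrite lee_fin leNgt; apply/negP => tt'.
have := cA _ (hausdorff0_coverable t'0 (ltW tt') t0 ltr01 (lexx _) (divr_gt0 c0 (ltr0Sn R 1)) HA).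
by apply/negP; rewrite -ltNge; lra.
Qed.

Lemma hausdorff_dim_le (A : set E) t : 0 <= t -> hausdorff_measure t A = 0%E ->
  (hausdorff_dim A <= t%:E)%E.
Proof. by move=> t0 HA; apply: ereal_inf_lbound; exists t. Qed.

Lemma hausdorff_dim_ge0 (A : set E) : (0 <= hausdorff_dim A)%E.
Proof. by apply: le_ereal_inf_tmp => _ [t [t0 _] <-]. Qed.

End Covers.

(** * Bi-Lipschitz systems and their limit sets *)

Definition open_disk {R : realType} : set 'rV[R]_2 := [set x | enorm x < 1].

(* [r w] plays the role of the norm of the derivative of the word map of [w],
   and [K] that of the distortion constant. *)
Record bilip_system {R : realType} {I : Type} (s : I -> 'rV[R]_2 -> 'rV[R]_2)
    (r : seq I -> R) (K a theta : R) : Prop := BilipSystem {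
  sys_disk : forall i x, closed_disk x -> closed_disk (s i x);
  sys_odisk : forall i x, open_disk x -> open_disk (s i x);
  sys_osc : forall i j x y, i <> j -> open_disk x -> open_disk y -> s i x <> s j y;
  sys_K1 : 1 <= K;
  sys_a0 : 0 < a;
  sys_theta0 : 0 < theta;
  sys_theta1 : theta < 1;
  sys_r0 : forall w, 0 < r w;
  sys_r_nil : r [::] = 1;
  sys_r_theta : forall w, r w <= theta ^+ size w;
  sys_up : forall w x y, closed_disk x -> closed_disk y ->
    enorm (word_map s w x - word_map s w y) <= K * r w * enorm (x - y);
  sys_low : forall w x y, closed_disk x -> closed_disk y ->
    r w * enorm (x - y) <= K * enorm (word_map s w x - word_map s w y);
  sys_ball : forall w z, enorm (z - word_map s w 0) < a * r w ->
    exists2 x, open_disk x & word_map s w x = z }.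

Section Words.
Context {R : realType} {I : eqType}.
Context {s : I -> 'rV[R]_2 -> 'rV[R]_2}.
Local Notation E := 'rV[R]_2.
Local Notation wm := (word_map s).

Lemma closed_diskE (x : E) : closed_disk x <-> enorm x <= 1.
Proof. by rewrite /closed_disk /closed_eball /= subr0. Qed.

Lemma open_closed_disk (x : E) : open_disk x -> closed_disk x.
Proof. by move=> /ltW x1; apply/closed_diskE. Qed.

Lemma open_disk0 : open_disk (0 : E).
Proof. by rewrite /open_disk /= enorm0 ltr01. Qed.

Lemma closed_disk0 : closed_disk (0 : E).
Proof. exact: open_closed_disk open_disk0. Qed.

Lemma closed_disk_dist (x y : E) : closed_disk x -> closed_disk y -> enorm (x - y) <= 2.
Proof.
move=> /closed_diskE x1 /closed_diskE y1.
by rewrite (le_trans (enormD _ _)) // enormN -[2](natrD _ 1 1) lerD.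
Qed.

Lemma exists_unit_vector : exists x : E, closed_disk x /\ enorm x = 1.
Proof.
pose x : E := \row_(j < 2) (j == 0)%:R.
have x1 : enorm x = 1 by rewrite enormE !mxE /= expr0n /= addr0 expr1n sqrtr1.
by exists x; split=> //; apply/closed_diskE; rewrite x1.
Qed.

Lemma word_map_cat (u v : seq I) x : wm (u ++ v) x = wm u (wm v x).
Proof. by elim: u => //= i u <-. Qed.

Context {r : seq I -> R} {K a theta : R}.
Hypothesis S : bilip_system s r K a theta.

Lemma sys_K0 : 0 < K. Proof. exact: lt_le_trans ltr01 (sys_K1 S). Qed.

Lemma word_map_disk w x : closed_disk x -> closed_disk (wm w x).
Proof. by move=> Xx; elim: w => //= i w; exact: (sys_disk S). Qed.

Lemma word_map_odisk w x : open_disk x -> open_disk (wm w x).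
Proof. by move=> Dx; elim: w => //= i w; exact: (sys_odisk S). Qed.

Lemma word_map_inj w x y : closed_disk x -> closed_disk y -> wm w x = wm w y -> x = y.
Proof.
move=> Xx Xy e; apply/subr0_eq/enorm_eq0/eqP.
have := sys_low S w Xx Xy; rewrite e subrr enorm0 mulr0.
by rewrite pmulr_rle0 ?(sys_r0 S) // => le0; rewrite eq_le le0 enorm_ge0.
Qed.

(** [r] is only multiplicative up to constants: the two-sided bounds, tested on 0 and a unit vector,
    lose one factor K for each of the three words. *)
Lemma sys_r_cat_le u v : r (u ++ v) <= K ^+ 3 * r u * r v.
Proof.
have [e [Xe e1]] := exists_unit_vector.
have := sys_low S (u ++ v) Xe closed_disk0.
rewrite subr0 e1 mulr1 !word_map_cat.
have := sys_up S u (word_map_disk v Xe) (word_map_disk v closed_disk0).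
have := sys_up S v Xe closed_disk0; rewrite subr0 e1 mulr1.
set A := enorm _; set B := enorm _ => h1 h2 h3.
apply: le_trans h3 _; rewrite exprS -!mulrA ler_pM2l ?sys_K0 //.
apply: le_trans h2 _; rewrite -!mulrA ler_pM2l ?sys_K0 //.
by rewrite mulrCA ler_pM2l // (sys_r0 S).
Qed.

Lemma sys_r_cat_ge u v : r u * r v <= K ^+ 3 * r (u ++ v).
Proof.
have [e [Xe e1]] := exists_unit_vector.
have := sys_up S (u ++ v) Xe closed_disk0.
rewrite subr0 e1 mulr1 !word_map_cat.
have := sys_low S u (word_map_disk v Xe) (word_map_disk v closed_disk0).
have := sys_low S v Xe closed_disk0; rewrite subr0 e1 mulr1.
set A := enorm _; set B := enorm _ => h1 h2 h3.
apply: (@le_trans _ _ (r u * (K * A))); first by rewrite ler_pM2l ?(sys_r0 S).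
rewrite mulrCA exprS -!mulrA ler_pM2l ?sys_K0 //.
by apply: le_trans h2 _; rewrite ler_pM2l ?sys_K0.
Qed.

Lemma sys_r_le1 w : r w <= 1.
Proof.
by rewrite (le_trans (sys_r_theta S w)) // exprn_ile1 // ltW ?(sys_theta0 S) ?(sys_theta1 S).
Qed.

Lemma word_map_dist w x y : closed_disk x -> closed_disk y ->
  enorm (wm w x - wm w y) <= 2 * K * r w.
Proof.
move=> Xx Xy; apply: le_trans (sys_up S w Xx Xy) _.
rewrite -[leRHS]mulrA [leRHS]mulrC ler_pM2l ?mulr_gt0 ?sys_K0 ?(sys_r0 S) //.
exact: closed_disk_dist.
Qed.

(** Stated through images of the open disk, which is how it is used; the open set condition yields
    it for words neither of which is a prefix of the other. *)
Definition incomparable (u v : seq I) :=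
  forall x y, open_disk x -> open_disk y -> wm u x <> wm v y.

Lemma incomparable_sym u v : incomparable u v -> incomparable v u.
Proof. by move=> uv x y Dx Dy e; apply: (uv y x). Qed.

Lemma incomparable_cat u v u' v' : incomparable u v -> incomparable (u ++ u') (v ++ v').
Proof.
by move=> uv x y Dx Dy; rewrite !word_map_cat; apply: uv; exact: word_map_odisk.
Qed.

Lemma incomparable_catl w u v : incomparable u v -> incomparable (w ++ u) (w ++ v).
Proof.
move=> uv x y Dx Dy; rewrite !word_map_cat => /word_map_inj e.
by apply: (uv x y) => //; apply: e; apply: open_closed_disk; exact: word_map_odisk.
Qed.

Lemma incomparable_cons i j u v : i != j -> incomparable (i :: u) (j :: v).
Proof. by move=> /eqP ij x y Dx Dy /=; apply: (sys_osc S) => //; exact: word_map_odisk. Qed.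

Lemma incomparable_size u v : size u = size v -> u != v -> incomparable u v.
Proof.
elim: u v => [|i u IH] [|j v] //= [suv].
have [<-|ij] := eqVneq i j; last by move=> _; exact: incomparable_cons.
rewrite eqseq_cons eqxx /= => uv; rewrite -(cat1s i u) -(cat1s i v).
by apply: incomparable_catl; exact: IH.
Qed.

(** The ball of radius [a * r u] about [wm u 0] lies in the image of the open disk under u, which
    misses [wm v 0]. *)
Lemma incomparable_dist u v : incomparable u v -> a * r u <= enorm (wm u 0 - wm v 0).
Proof.
move=> uv; rewrite leNgt edistC; apply/negP => /(sys_ball S)[x Dx e].
by apply: (uv x 0); rewrite ?e //; exact: open_disk0.
Qed.

(** Any two of the intervals [y N - e N, y N + e N] meet, so the supremum of the left ends lies
    below every right end. *)
Lemma exists_limit_coord (y e : nat -> R) :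
  (forall N M, `|y N - y M| <= e N + e M) -> exists x, forall N, `|x - y N| <= e N.
Proof.
move=> ye; pose A := [set y N - e N | N in [set: nat]].
have Aub M : ubound A (y M + e M).
  by move=> _ [N _ <-]; have := ye N M; rewrite ler_norml => /andP[h1 h2]; lra.
have A0 : A !=set0 by exists (y 0%N - e 0%N), 0%N.
exists (sup A) => N; rewrite ler_norml; apply/andP; split.
  have : y N - e N <= sup A by apply: ub_le_sup; [exists (y 0%N + e 0%N)|exists N].
  lra.
have : sup A <= y N + e N by apply: ge_sup.
lra.
Qed.

Lemma geometric_eps (C eps : R) : 0 < eps -> exists k, C * theta ^+ k < eps.
Proof.
move=> eps0; have th0 := sys_theta0 S.
have [C0|C0] := leP C 0.
  by exists 0%N; rewrite expr0 mulr1 (le_lt_trans C0).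
have : (fun k => theta ^+ k) @ \oo --> (0 : R).
  by apply: cvg_expr; rewrite ger0_norm ?ltW ?(sys_theta1 S).
move=> /cvgrPdist_lt /(_ (eps / C) (divr_gt0 eps0 C0)) [k _ /(_ k (leqnn _))] /=.
rewrite sub0r normrN ger0_norm ?exprn_ge0 ?(ltW th0) // ltr_pdivlMr // mulrC => h.
by exists k.
Qed.

Lemma small_le0 (C x : R) : (forall k, x <= C * theta ^+ k) -> x <= 0.
Proof.
move=> h; rewrite leNgt; apply/negP => /(geometric_eps C)[k].
by apply/negP; rewrite -leNgt.
Qed.

Definition shift (om : nat -> I) N : nat -> I := fun k => om (N + k)%N.

Lemma mkseqD om N k : mkseq om (N + k) = mkseq om N ++ mkseq (shift om N) k.
Proof.
rewrite /mkseq iotaD map_cat; congr (_ ++ _).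
by rewrite add0n -[N in iota N]addn0 iotaDl -map_comp.
Qed.

Let coded om x := forall N, (wm (mkseq om N) @` closed_disk) x.

Lemma exists_coded_center om : exists x, forall N,
  enorm (x - wm (mkseq om N) 0) <= 4 * K * theta ^+ N.
Proof.
pose e N := 2 * K * theta ^+ N.
have e0 N : 0 <= e N.
  by rewrite !mulr_ge0 ?exprn_ge0 ?(ltW sys_K0) ?ltW ?(sys_theta0 S).
have near N k : enorm (wm (mkseq om N) 0 - wm (mkseq om (N + k)) 0) <= e N.
  rewrite mkseqD word_map_cat.
  apply: le_trans (word_map_dist _ closed_disk0 (word_map_disk _ closed_disk0)) _.
  rewrite ler_pM2l ?mulr_gt0 ?sys_K0 //.
  by rewrite (le_trans (sys_r_theta S _)) // size_mkseq.
have cauchy N M : enorm (wm (mkseq om N) 0 - wm (mkseq om M) 0) <= e N + e M.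
  have [/subnKC <-|/ltnW/subnKC <-] := leqP N M.
    by rewrite (le_trans (near _ _)) // lerDl e0.
  by rewrite edistC (le_trans (near _ _)) // lerDr e0.
have coord (k : 'I_2) : exists c, forall N, `|c - (wm (mkseq om N) 0) 0 k| <= e N.
  apply: exists_limit_coord => N M; apply: le_trans (cauchy N M).
  by rewrite (le_trans _ (norm_coord_le _ k)) // !mxE.
have [c0 h0] := coord 0; have [c1 h1] := coord 1.
exists (\row_(j < 2) (if j == 0 then c0 else c1)) => N.
apply: le_trans (enorm_le_sum _) _; rewrite !mxE /=.
have -> : 4 * K * theta ^+ N = e N + e N by rewrite /e; ring.
by rewrite lerD // ?h0 ?h1.
Qed.

(** The limit x of the centres lies in the cylinder of each prefix: the centres of the shifted
    address converge to some z in the disk, and the Lipschitz bound of the prefix shows that it maps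
    z to x. *)
Lemma exists_coded om : exists x, coded om x.
Proof.
have [x hx] := exists_coded_center om; exists x => N.
have [z hz] := exists_coded_center (shift om N).
have Xz : closed_disk z.
  apply/closed_diskE; rewrite -subr_le0; apply: (@small_le0 (4 * K)) => k.
  have /closed_diskE c1 := word_map_disk (mkseq (shift om N) k) closed_disk0.
  rewrite lerBlDr; apply: le_trans (lerD (hz k) c1).
  by rewrite -{1}(subrK (wm (mkseq (shift om N) k) 0) z) enormD.
exists z => //; apply/subr0_eq/enorm_eq0/eqP; rewrite eq_le enorm_ge0 andbT.
apply: (@small_le0 (4 * K * K + 4 * K)) => k; rewrite mulrDl.
apply: le_trans (edist_triangle (wm (mkseq om (N + k)) 0) _ _) _.
apply: lerD.
  rewrite mkseqD word_map_cat.
  apply: le_trans (sys_up S _ Xz (word_map_disk _ closed_disk0)) _.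
  have -> : 4 * K * K * theta ^+ k = K * (4 * K * theta ^+ k) by ring.
  rewrite -mulrA ler_pM2l ?sys_K0 //; apply: le_trans (hz k).
  by rewrite ler_piMl ?enorm_ge0 ?sys_r_le1.
rewrite edistC (le_trans (hx _)) // ler_pM2l ?mulr_gt0 ?sys_K0 //.
rewrite exprD ler_piMl ?exprn_ge0 ?exprn_ile1 // ltW ?(sys_theta0 S) ?(sys_theta1 S) //.
Qed.

Lemma limit_setP x : limit_set closed_disk s x <-> exists om, coded om x.
Proof.
split=> [[om _ h]|[om h]].
  exists om => -[|N]; last exact: h.
  have [y Xy <-] := h 1%N isT; exists (wm (mkseq om 1) y) => //.
  exact: word_map_disk.
by exists om => // N _; exact: h.
Qed.

Lemma limit_set_disk x : limit_set closed_disk s x -> closed_disk x.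
Proof. by move=> /limit_setP[om /(_ 0%N)[y Xy <-]]. Qed.

Lemma limit_set_shift om x N : coded om x ->
  exists2 y, limit_set closed_disk s y /\ coded (shift om N) y & x = wm (mkseq om N) y.
Proof.
move=> h; have [y Xy yx] := h N; exists y => //.
have cy : coded (shift om N) y.
  move=> k; have [z Xz zx] := h (N + k)%N; exists z => //.
  apply: (@word_map_inj (mkseq om N)) => //; first exact: word_map_disk.
  by rewrite yx -zx mkseqD word_map_cat.
by split=> //; apply/limit_setP; exists (shift om N).
Qed.

Lemma chain_point (v : nat -> seq I) : v 0%N = [::] ->
  (forall k, exists2 w, w != [::] & v k.+1 = v k ++ w) ->
  exists2 x, limit_set closed_disk s x & forall k, (wm (v k) @` closed_disk) x.
Proof.
move=> v0 vS.
have sz k : (k <= size (v k))%N.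
  elim: k => // k IH; have [w w0 ->] := vS k; rewrite size_cat.
  by case: w w0 => // i w _; rewrite addnS ltnS (leq_trans IH) // leq_addr.
have pre k m : exists w, v (k + m)%N = v k ++ w.
  elim: m => [|m [w IH]]; first by exists [::]; rewrite addn0 cats0.
  by have [w' _ e] := vS (k + m)%N; exists (w ++ w'); rewrite addnS e IH catA.
have [i0 _] : exists i0 : I, True by have [[|i w] // _ _] := vS 0%N; exists i.
(* [v n.+1] has at least n + 1 letters, so its letter n exists and is the same in all later
   words. *)
pose om n := nth i0 (v n.+1) n.
have omE k : v k = mkseq om (size (v k)).
  apply: (@eq_from_nth _ i0); first by rewrite size_mkseq.
  move=> j jk; rewrite nth_mkseq // /om.
  have [w1 e1] := pre k j.+1; have [w2 e2] := pre j.+1 k.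
  have : nth i0 (v (k + j.+1)%N) j = nth i0 (v (j.+1 + k)%N) j by rewrite addnC.
  by rewrite e1 e2 !nth_cat jk sz.
have [x hx] := exists_coded om; exists x; first by apply/limit_setP; exists om.
by move=> k; rewrite omE.
Qed.

End Words.

(** * Mass distribution *)

Lemma pairwise_in (T : eqType) (e : rel T) (l : seq T) x y : symmetric e ->
  pairwise e l -> x \in l -> y \in l -> x != y -> e x y.
Proof.
move=> es; elim: l => //= z l IH /andP[/allP zl pl]; rewrite !inE.
move=> /predU1P[->|xl] /predU1P[->|yl] xy; first by rewrite eqxx in xy.
- exact: zl.
- by rewrite es zl.
- exact: IH.
Qed.

Lemma powR_le1 {R : realType} (x t : R) : 0 <= x <= 1 -> 0 <= t -> x `^ t <= 1.
Proof.
move=> /andP[x0 x1] t0; have := ge0_ler_powR t0 _ _ x1.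
by rewrite powR1; apply; rewrite nnegrE.
Qed.

Section MassDistribution.
Context {R : realType} {I : eqType}.
Context {s : I -> 'rV[R]_2 -> 'rV[R]_2} {r : seq I -> R} {K a theta : R}.
Local Notation E := 'rV[R]_2.
Local Notation wm := (word_map s).
Local Notation incomp := (@incomparable R I s).
Hypothesis S : bilip_system s r K a theta.
Variables (W : seq (seq I)) (rho : seq I -> R) (t : R).
Hypotheses (t0 : 0 < t) (uW : uniq W) (W0 : forall w, w \in W -> w != [::]).
Hypothesis Winc : forall u v, u \in W -> v \in W -> u != v -> incomp u v.
Hypothesis rho0 : forall w, w \in W -> 0 < rho w.
Hypothesis rho_low : forall w, w \in W -> forall x y, closed_disk x -> closed_disk y ->
  rho w * enorm (x - y) <= enorm (wm w x - wm w y).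
Hypothesis sum_rho : 1 <= \sum_(w <- W) rho w `^ t.

(** [rho w] is a lower Lipschitz constant, and such constants multiply under composition without
    loss. Hence the weight of a concatenation of words of [W] stays below the t-th power of a lower
    Lipschitz constant of its word map, at every depth. *)
Let p w := rho w `^ t / \sum_(w <- W) rho w `^ t.

Let p_ge0 w : 0 <= p w.
Proof. by rewrite divr_ge0 ?powR_ge0 // sumr_ge0 // => i _; exact: powR_ge0. Qed.

Let p_le w : p w <= rho w `^ t.
Proof.
by rewrite ler_pdivrMr ?ler_peMr ?powR_ge0 // (lt_le_trans ltr01).
Qed.

Let p_sum : \sum_(w <- W) p w = 1.
Proof.
by rewrite -mulr_suml divff // gt_eqF // (lt_le_trans ltr01).
Qed.

Let deeper v L w : w \in W ->
  theta ^+ (size (v ++ w) + L) <= theta ^+ (size v + L.+1).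
Proof.
move=> /W0; rewrite -size_eq0 size_cat => w0.
by rewrite ler_wiXn2l ?(ltW (sys_theta0 S)) ?(ltW (sys_theta1 S)) //; lia.
Qed.

Section OneSet.
Variables (U : set E) (u : R).

Let hit v : bool := `[< exists2 x, closed_disk x & U (wm v x) >].

(* The mass of [U] seen at scale [u] from the cylinder of [v], for the
   Bernoulli measure of weights [p]; [L] bounds the depth of the recursion. *)
Fixpoint mass (L : nat) v : R :=
  if r v <= u then (hit v)%:R else
  if L is L'.+1 then \sum_(w <- W) p w * mass L' (v ++ w) else (hit v)%:R.

(** The leaves of the recursion of [mass] at which U is met; bounding the mass reduces to counting
    them. *)
Fixpoint stops (L : nat) v : seq (seq I) :=
  if r v <= u then nseq (hit v) v else
  if L is L'.+1 then flatten [seq stops L' (v ++ w) | w <- W] else nseq (hit v) v.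

Let hit_cat v w : hit (v ++ w) -> hit v.
Proof.
move=> /asboolP[x Xx Ux]; apply/asboolP; exists (wm w x); first exact: (word_map_disk S).
by rewrite -word_map_cat.
Qed.

Let hit_cat_le v w : (hit (v ++ w))%:R <= (hit v)%:R :> R.
Proof. by rewrite ler_nat; case: (hit (v ++ w)) (@hit_cat v w) => // ->. Qed.

Lemma mass_ge0 L v : 0 <= mass L v.
Proof.
elim: L v => [|L IH] v /=; case: ifP => // _.
by apply: sumr_ge0 => w _; rewrite mulr_ge0.
Qed.

Lemma mass_le_hit L v : mass L v <= (hit v)%:R.
Proof.
elim: L v => [|L IH] v /=; case: ifP => // _.
rewrite -[leRHS]mul1r -{1}p_sum mulr_suml; apply: ler_sum => w _.
by rewrite ler_wpM2l // (le_trans (IH _)).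
Qed.

Lemma mass_decr L v : mass L.+1 v <= mass L v.
Proof.
elim: L v => [|L IH] v.
  by rewrite [leRHS]/=; case: ifP => _; exact: mass_le_hit.
rewrite [leLHS]/= [leRHS]/=; case: ifP => // _.
by apply: ler_sum => w _; apply: ler_wpM2l => //; exact: IH.
Qed.

(** Refinement only loses mass, since a cylinder meeting U sits in a parent meeting U. This is what
    lets a total below 1 be passed on to some child. *)
Lemma mass_superharmonic L v : \sum_(w <- W) p w * mass L (v ++ w) <= mass L v.
Proof.
have [rv|rv] := boolP (r v <= u).
  have -> : mass L v = (hit v)%:R by case: L => [|L] /=; rewrite rv.
  rewrite -[leRHS]mul1r -{1}p_sum mulr_suml; apply: ler_sum => w _.
  by rewrite ler_wpM2l // (le_trans (mass_le_hit _ _)).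
by apply: le_trans (mass_decr L v); rewrite /= (negbTE rv).
Qed.

(** Here [q] is the weight of the path to v and [lam] a lower Lipschitz constant of its map. At a
    leaf, comparing lower and upper bounds on 0 and a unit vector gives lam <= K * r v <= K * u. The
    hypothesis on [theta] ensures r v <= u also when the depth runs out. *)
Lemma mass_le_stops L v (q lam : R) : theta ^+ (size v + L) <= u ->
  0 <= lam -> 0 <= q <= lam `^ t ->
  (forall x y, closed_disk x -> closed_disk y ->
    lam * enorm (x - y) <= enorm (wm v x - wm v y)) ->
  q * mass L v <= (K * u) `^ t * (size (stops L v))%:R.
Proof.
elim: L v q lam => [|L IH] v q lam Lu lam0 /andP[q0 qlam] low.
all: have stop : r v <= u ->
    q * (hit v)%:R <= (K * u) `^ t * (size (nseq (hit v) v))%:R.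
1,3: move=> rv; rewrite size_nseq ler_wpM2r ?ler0n // (le_trans qlam) //.
1,2: have [e [Xe e1]] := @exists_unit_vector R.
1,2: have h1 := low _ _ Xe closed_disk0; have h2 := sys_up S v Xe closed_disk0.
1,2: rewrite subr0 e1 !mulr1 in h1 h2.
1,2: have lamu : lam <= K * u by
  apply: le_trans h1 (le_trans h2 _); rewrite ler_pM2l ?(sys_K0 S).
1,2: by rewrite ge0_ler_powR ?nnegrE ?(ltW t0) // (le_trans lam0).
  have rv : r v <= u by rewrite (le_trans (sys_r_theta S v)) // -[size v]addn0.
  by rewrite /= rv; exact: stop.
rewrite /=; case: ifP => [/stop//|_].
rewrite mulr_sumr size_flatten /shape -map_comp sumnE big_map natr_sum mulr_sumr.
rewrite big_seq [leRHS]big_seq; apply: ler_sum => w wW.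
rewrite mulrA; apply: (IH _ _ (lam * rho w)).
- exact: le_trans (deeper _ _ wW) Lu.
- by rewrite mulr_ge0 // ltW ?rho0.
- rewrite mulr_ge0 //= powRM ?(ltW (rho0 _)) // ler_pM //.
- move=> x y Xx Xy; rewrite !word_map_cat -mulrA.
  apply: le_trans (low _ _ (word_map_disk S w Xx) (word_map_disk S w Xy)).
  by rewrite ler_wpM2l // rho_low.
Qed.

Lemma stops_prefix L v v' : v' \in stops L v -> exists w, v' = v ++ w.
Proof.
elim: L v => [|L IH] v /=; case: ifP => _.
1-3: by rewrite mem_nseq => /andP[_ /eqP->]; exists [::]; rewrite cats0.
by move=> /flatten_mapP[w _ /IH[w' ->]]; exists (w ++ w'); rewrite catA.
Qed.

Lemma stops_hit L v v' : theta ^+ (size v + L) <= u -> v' \in stops L v ->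
  r v' <= u /\ exists2 x, closed_disk x & U (wm v' x).
Proof.
elim: L v => [|L IH] v Lu /=; case: ifP => rv.
- by rewrite mem_nseq lt0b => /andP[/asboolP h /eqP->].
- move: rv; rewrite (le_trans (sys_r_theta S v)) //.
  by move: Lu; rewrite addn0.
- by rewrite mem_nseq lt0b => /andP[/asboolP h /eqP->].
move=> /flatten_mapP[w wW /IH]; apply.
exact: le_trans (deeper _ _ wW) Lu.
Qed.

(** The parent of a leaf still has ratio above u, and one more word of the finite list [W] loses at
    most the factor c. *)
Lemma stops_large c L v v' : (forall w, w \in W -> c * K ^+ 3 <= r w) ->
  0 < c -> c * u <= r v -> v' \in stops L v -> c * u <= r v'.
Proof.
move=> cW c0; elim: L v => [|L IH] v cv /=; case: ifP => rv.
1-3: by rewrite mem_nseq => /andP[_ /eqP->].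
move=> /flatten_mapP[w wW /IH]; apply.
have K3 : 0 < K ^+ 3 by rewrite exprn_gt0 ?(sys_K0 S).
rewrite -(ler_pM2l K3); apply: le_trans (sys_r_cat_ge S v w).
have /ltW uv : u < r v by rewrite ltNge rv.
have := cW _ wW; have := sys_r0 S v; have := sys_r0 S w; have := K3.
move=> k3 w0 v0 cw.
apply: (@le_trans _ _ (r v * (c * K ^+ 3))); last by rewrite ler_pM2l.
have -> : K ^+ 3 * (c * u) = u * (c * K ^+ 3) by ring.
by rewrite ler_wpM2r // mulr_ge0 ?ltW.
Qed.

Lemma stops_incomparable L v :
  pairwise (fun v1 v2 => `[< incomp v1 v2 >]) (stops L v).
Proof.
elim: L v => [|L IH] v /=; case: ifP => _.
1-3: by case: (hit v).
(* Only the outer list is generalised; the deeper calls of [stops] still range over all of [W]. *)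
suff H W' : uniq W' -> {subset W' <= W} -> pairwise (fun v1 v2 => `[< incomp v1 v2 >])
    (flatten [seq stops L (v ++ w) | w <- W']) by exact: H.
elim: W' => //= w W' IHW /andP[wW' uW'] sW.
rewrite pairwise_cat IH IHW // ?andbT; last by move=> x xW'; rewrite sW // inE xW' orbT.
apply/allrelP => _ _ /stops_prefix[w1 ->] /flatten_mapP[w' w'W /stops_prefix[w2 ->]].
apply/asboolP; apply: (incomparable_cat S); apply: (incomparable_catl S); apply: Winc.
- by rewrite sW // mem_head.
- by rewrite sW // inE w'W orbT.
- by apply: contra wW' => /eqP->.
Qed.

(** The leaves are pairwise incomparable with ratios between c u and u, so their centres are a c u
    apart, yet all lie within (2 K + 1) u of one point of U. The count is therefore independent of
    u. *)
Lemma stops_size c L (B : nat) : (forall w, w \in W -> c * K ^+ 3 <= r w) ->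
  0 < c <= 1 -> 0 < u <= 1 -> theta ^+ L <= u ->
  (forall x y, U x -> U y -> enorm (x - y) <= u) ->
  2 * K + 1 <= B%:R * (a * c) ->
  (size (stops L [::]) <= (4 * B + 1) ^ 2)%N.
Proof.
move=> cW /andP[c0 c1] /andP[u0 u1] Lu Uu BK.
have Lu' : theta ^+ (size ([::] : seq I) + L) <= u by [].
case E : (stops L [::]) => [//|v0 l].
have v0l : v0 \in stops L [::] by rewrite E mem_head.
have [_ [x0 Xx0 Ux0]] := stops_hit Lu' v0l.
have incompP : forall v1 v2, v1 \in stops L [::] -> v2 \in stops L [::] ->
    v1 != v2 -> incomp v1 v2.
  move=> v1 v2 h1 h2 v12; apply/asboolP.
  apply: (pairwise_in _ (stops_incomparable L [::])) => // w1 w2.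
  by apply/asboolP/asboolP; exact: incomparable_sym.
rewrite -E; apply: (@separated_count _ _ _ (fun v => wm v 0) (wm v0 x0) (a * c * u)).
- by rewrite !mulr_gt0 ?(sys_a0 S).
- apply: (pairwise_uniq _ (stops_incomparable L [::])) => v.
  by apply/asboolP => /(_ 0 0 open_disk0 open_disk0).
- move=> v vl; have [rv [x Xx Ux]] := stops_hit Lu' vl.
  apply: (@le_trans _ _ ((2 * K + 1) * u)); last by rewrite mulrA ler_pM2r.
  apply: le_trans (edist_triangle (wm v x) _ _) _; rewrite mulrDl mul1r lerD ?Uu //.
  apply: le_trans (word_map_dist S v closed_disk0 Xx) _.
  by rewrite ler_pM2l // mulr_gt0 ?(sys_K0 S).
- move=> v v' vl v'l vv'; apply: le_trans (incomparable_dist S (incompP _ _ vl v'l vv')).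
  rewrite -mulrA ler_pM2l ?(sys_a0 S) //; apply: (stops_large cW c0 _ vl).
  by rewrite (sys_r_nil S) mulr_ile1 // ltW.
Qed.

End OneSet.

Lemma exists_lower_ratio : exists2 c : R, 0 < c <= 1 &
  forall w, w \in W -> c * K ^+ 3 <= r w.
Proof.
have K3 : 0 < K ^+ 3 by rewrite exprn_gt0 ?(sys_K0 S).
have [c c01 cW] : exists2 c : R, 0 < c <= 1 & forall w, w \in W -> c <= r w.
  elim: (W) => [|w W' [c /andP[c0 c1] IH]]; first by exists 1; rewrite ?ltr01 ?lexx.
  exists (Num.min c (r w)); first by rewrite lt_min c0 (sys_r0 S) ge_min c1.
  by move=> w'; rewrite inE ge_min => /predU1P[->|/IH->//]; rewrite lexx orbT.
have /andP[c0 c1] := c01.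
exists (c / K ^+ 3); last by move=> w wW; rewrite divfK ?gt_eqF ?cW.
rewrite divr_gt0 //= ler_pdivrMr // mul1r (le_trans c1) // exprn_ege1 //.
exact: (sys_K1 S).
Qed.

Lemma mass_le_const : exists2 C : R, 0 < C & forall (U : set E) u L,
  0 < u <= 1 -> theta ^+ L <= u ->
  (forall x y, U x -> U y -> enorm (x - y) <= u) ->
  mass U u L [::] <= C * u `^ t.
Proof.
have [c c01 cW] := exists_lower_ratio; have /andP[c0 c1] := c01.
have ac : 0 < a * c by rewrite mulr_gt0 ?(sys_a0 S).
have [B BK] : exists B : nat, 2 * K + 1 <= B%:R * (a * c).
  exists (Num.bound ((2 * K + 1) / (a * c))).
  rewrite -ler_pdivrMr //; apply: ltW.
  apply: (archi_boundP (divr_ge0 _ (ltW ac))).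
  by rewrite addr_ge0 // mulr_ge0 // ltW ?(sys_K0 S).
pose Bn := ((4 * B + 1) ^ 2)%N.
exists (K `^ t * Bn%:R).
  by rewrite mulr_gt0 ?powR_gt0 ?(sys_K0 S) // ltr0n expn_gt0 addn1.
move=> U u L u01 Lu Uu; have /andP[u0 u1] := u01.
rewrite -[mass _ _ _ _]mul1r.
have := @mass_le_stops U u L [::] 1 1; rewrite add0n powR1 lexx ler01 => /(_ Lu isT isT).
move=> h; apply: le_trans (h _) _ => [x y _ _|]; first by rewrite mul1r.
rewrite powRM ?(ltW (sys_K0 S)) ?(ltW u0) // mulrAC ler_wpM2r ?powR_ge0 //.
rewrite ler_wpM2l ?powR_ge0 // ler_nat.
exact: (stops_size cW c01).
Qed.

Let Phi (U : nat -> set E) (u : nat -> R) (L : nat -> nat) v : \bar R :=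
  (\sum_(0 <= i <oo) (mass (U i) (u i) (L i) v)%:E)%E.

(** The average of the totals over the children, with weights [p] of sum 1, is at most the total of
    the parent, so not all children can reach 1. *)
Let Phi_child U u L v : (Phi U u L v < 1)%E ->
  exists2 w, w \in W & (Phi U u L (v ++ w) < 1)%E.
Proof.
move=> Pv; apply: contrapT => noW.
have big w : w \in W -> (1 <= Phi U u L (v ++ w))%E.
  by move=> wW; rewrite leNgt; apply/negP => h; apply: noW; exists w.
have m0 i v' : (0 <= (mass (U i) (u i) (L i) v')%:E)%E by rewrite lee_fin mass_ge0.
suff : (1 <= Phi U u L v)%E by rewrite leNgt Pv.
apply: (@le_trans _ _ (\sum_(w <- W) ((p w)%:E * Phi U u L (v ++ w)))%E).
  rewrite -[1%E]/(1%:E) -p_sum -sumEFin big_seq [leRHS]big_seq.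
  by apply: lee_sum => w wW; rewrite -[leLHS]mule1 lee_wpmul2l ?lee_fin // big.
under eq_bigr do rewrite -nneseriesZl //.
rewrite -nneseries_sum; last by move=> w i _; rewrite mule_ge0 // lee_fin.
apply: lee_nneseries => [i _ _|i _].
  by apply: sume_ge0 => w _; rewrite mule_ge0 // lee_fin.
by under eq_bigr do rewrite -EFinM; rewrite sumEFin lee_fin mass_superharmonic.
Qed.

(* The total mass of a cover which is too cheap is less than 1; following
   children along which it stays so leads to a point of the limit set missed by
   every set of the cover. *)
Lemma mass_distribution :
  exists2 c : R, 0 < c & forall sigma, coverable t 1 (limit_set closed_disk s) sigma ->
    c <= sigma.
Proof.
have [C C0 CU] := mass_le_const.
(* A cover of cost below c, together with enlargements of total at most c, has total mass at most C
   (c + c) <= 1/2. *)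
pose c := Num.min 1 (4 * C)^-1.
have c0 : 0 < c by rewrite lt_min ltr01 invr_gt0 mulr_gt0.
have c1 : c <= 1 by rewrite ge_min lexx.
exists c => // sigma [U [u [U1 U2 U3 U4]]]; rewrite leNgt; apply/negP => sc.
pose eps i : R := c / 2 ^+ i.+1.
have eps0 i : 0 < eps i by rewrite divr_gt0 // exprn_gt0.
have eps1 i : eps i <= 1.
  by rewrite ler_pdivrMr ?exprn_gt0 // mul1r (le_trans c1) // exprn_ege1 // ler1n.
(* At scale 0 the recursion would never stop, so every scale is made positive, at a cost of at most
   [eps i] in the t-th power. *)
pose u' i := Num.max (u i) (eps i `^ t^-1).
have u'01 i : 0 < u' i <= 1.
  have /andP[ui0 ui1] := U3 i.
  rewrite lt_max powR_gt0 // orbT ge_max ui1 /=.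
  by apply: powR_le1; rewrite ?invr_ge0 ?eps1 ?ltW.
have u'_le i : u' i `^ t <= u i `^ t + eps i.
  have [h|/ltW h] := leP (u i) (eps i `^ t^-1).
    rewrite /u' (max_r h) -powRrM mulVf ?gt_eqF // powRr1 ?(ltW (eps0 _)) //.
    by rewrite lerDr powR_ge0.
  by rewrite /u' (max_l h) lerDl ltW.
have sum_eps k : \sum_(i < k) eps i <= c.
  suff -> : \sum_(i < k) eps i = c - c / 2 ^+ k by rewrite gerBl divr_ge0 ?exprn_ge0 // ltW.
  elim: k => [|k IH]; first by rewrite big_ord0 expr0 divr1 subrr.
  rewrite big_ord_recr /= IH /eps exprS; field; by rewrite expf_neq0 // pnatr_eq0.
have /choice[L HL] : forall i, exists l, theta ^+ l <= u' i.
  move=> i; have /andP[ui0 _] := u'01 i.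
  by have [k] := geometric_eps S 1 ui0; rewrite mul1r => /ltW; exists k.
have diam' i x y : U i x -> U i y -> enorm (x - y) <= u' i.
  by move=> Ux Uy; rewrite le_max (U2 _ _ _ Ux Uy).
have Phi0 : (Phi U u' L [::] < 1)%E.
  apply: (@le_lt_trans _ _ (2^-1)%:E); last by rewrite lte_fin invf_lt1 // ltr1n.
  apply: lime_le.
    by apply: is_cvg_nneseries => i _ _; rewrite lee_fin mass_ge0.
  apply: nearW => k; rewrite sumEFin lee_fin big_mkord.
  apply: (@le_trans _ _ (\sum_(i < k) C * (u i `^ t + eps i))).
    apply: ler_sum => i _; apply: le_trans (CU _ _ _ (u'01 i) (HL i) (@diam' i)) _.
    by rewrite ler_pM2l.
  rewrite -mulr_sumr big_split /=.
  apply: (@le_trans _ _ (C * (c + c))).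
    rewrite ler_pM2l //; apply: lerD; [exact: le_trans (U4 k) (ltW sc)|exact: sum_eps].
  have : c <= (4 * C)^-1 by rewrite ge_min lexx orbT.
  rewrite -[_^-1]mul1r ler_pdivlMr ?mulr_gt0 // => h.
  by rewrite -[leRHS]mul1r ler_pdivlMr //; lra.
have /choice[f Hf] : forall v, exists w, w \in W /\
    ((Phi U u' L v < 1)%E -> (Phi U u' L (v ++ w) < 1)%E).
  move=> v.
  have [/Phi_child[w wW Hw]|nPv] := pselect (Phi U u' L v < 1)%E; first by exists w.
  case EW : W => [|w W']; last by exists w; rewrite mem_head.
  by move: p_sum; rewrite EW big_nil => /eqP; rewrite eq_sym oner_eq0.
pose v k := iter k (fun v => v ++ f v) [::].
have Pv k : (Phi U u' L (v k) < 1)%E.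
  by elim: k => [|k IH] //=; exact: (Hf _).2.
have [x Jx xv] : exists2 x, limit_set closed_disk s x &
    forall k, (wm (v k) @` closed_disk) x.
  apply: (chain_point S) => // k; exists (f (v k)) => //.
  by apply: W0; exact: (Hf _).1.
have [i _ Ux] := U1 _ Jx.
have sz k : (k <= size (v k))%N.
  elim: k => // k IH; rewrite /= size_cat -/(v k).
  have := W0 (Hf (v k)).1; rewrite -size_eq0; lia.
have := Pv (L i); apply/negP; rewrite -leNgt.
apply: (@le_trans _ _ (mass (U i) (u' i) (L i) (v (L i)))%:E); last first.
  rewrite /Phi (nneseriesD1 (n := i)) //; last by move=> k _; rewrite lee_fin mass_ge0.
  by rewrite leeDl // nneseries_ge0 // => k _ _; rewrite lee_fin mass_ge0.
(* After L i steps the recursion for [U i] has stopped, and x shows that the cylinder is met: this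
   single set already has mass 1. *)
have rv : r (v (L i)) <= u' i.
  apply: le_trans (sys_r_theta S _) (le_trans _ (HL i)).
  by rewrite ler_wiXn2l ?(ltW (sys_theta0 S)) ?(ltW (sys_theta1 S)).
have -> : mass (U i) (u' i) (L i) (v (L i)) = 1.
  have [y Xy yx] := xv (L i).
  suff h : `[< exists2 x, closed_disk x & U i (wm (v (L i)) x) >].
    by case: (L i) rv h => [|l] /= rv h; rewrite rv h.
  by apply/asboolP; exists y; rewrite ?yx.
by rewrite lexx.
Qed.

End MassDistribution.

(** * Continuity of finite power sums in the exponent *)

Section Exponents.
Context {R : realType}.

Lemma powR_sum_continuous (T : Type) (l : seq T) (c b : T -> R) :
  (forall i, 0 < b i) -> continuous (fun t => \sum_(i <- l) c i * b i `^ t).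
Proof.
move=> b0 h; elim: l => [|i l IH].
  by under eq_fun do rewrite big_nil; exact: cst_continuous.
rewrite (_ : (fun t => _) =
    (fun t => c i * b i `^ t) \+ (fun t => \sum_(j <- l) c j * b j `^ t)); last first.
  by apply/funext => t; rewrite big_cons.
apply: continuousD => //; apply: (@continuousM _ _ (cst (c i))).
  exact: cst_continuous.
rewrite (_ : powR (b i) = fun t => expR (t * ln (b i))); last first.
  by apply/funext => t; rewrite /powR gt_eqF.
apply: (@continuous_comp R R R (fun t => t * ln (b i)) expR); last exact: continuous_expR.
by apply: (@continuousM _ _ id (cst (ln (b i)))); [exact: id|exact: cst_continuous].
Qed.

Lemma powR_inv (x t : R) : 0 < x -> x^-1 `^ t = (x `^ t)^-1.
Proof.
move=> x0; have h : x `^ t * x^-1 `^ t = 1.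
  by rewrite -powRM ?invr_ge0 ?ltW // divff ?gt_eqF // powR1.
by rewrite -[LHS](mulKf (x := x `^ t)) ?h ?mulr1 // gt_eqF // powR_gt0.
Qed.

Lemma powR_sum_gt (T : Type) (l : seq T) (c b : T -> R) (h : R) :
  (forall i, 0 < b i) -> 1 < \sum_(i <- l) c i * b i `^ h ->
  exists2 t, h < t & 1 < \sum_(i <- l) c i * b i `^ t.
Proof.
move=> b0 h1.
have /(nbhs_ballP _ _).1[e /= e0 he] : nbhs h [set t | 1 < \sum_(i <- l) c i * b i `^ t].
  exact: cvgr_gt _ (@powR_sum_continuous _ l c b b0 h) _ h1.
exists (h + e / 2); first by rewrite ltrDl divr_gt0.
apply: he; rewrite /ball /= opprD addrA subrr sub0r normrN gtr0_norm ?divr_gt0 //.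
by rewrite ltr_pdivrMr // ltr_pMr // ltr1n.
Qed.

Lemma powR_sum_lt (T : Type) (l : seq T) (c b : T -> R) (h h' : R) :
  (forall i, 0 < b i) -> h' < h -> \sum_(i <- l) c i * b i `^ h < 1 ->
  exists2 t, h' < t < h & \sum_(i <- l) c i * b i `^ t < 1.
Proof.
move=> b0 hh' h1.
have /(nbhs_ballP _ _).1[e /= e0 he] : nbhs h [set t | \sum_(i <- l) c i * b i `^ t < 1].
  exact: cvgr_lt _ (@powR_sum_continuous _ l c b b0 h) _ h1.
pose e' := Num.min (e / 2) ((h - h') / 2).
have e'0 : 0 < e' by rewrite lt_min !divr_gt0 ?subr_gt0.
have e'e : e' <= e / 2 by rewrite ge_min lexx.
have e'h : e' <= (h - h') / 2 by rewrite ge_min lexx orbT.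
exists (h - e'); first by apply/andP; split; lra.
apply: he; rewrite /ball /= opprB addrC subrK gtr0_norm //.
by lra.
Qed.

End Exponents.

(** * Antichains and recursive covers *)

Section Covering.
Context {R : realType} {I : eqType}.
Context {s : I -> 'rV[R]_2 -> 'rV[R]_2} {r : seq I -> R} {K a theta : R}.
Local Notation E := 'rV[R]_2.
Local Notation wm := (word_map s).
Local Notation incomp := (@incomparable R I s).
Local Notation J := (limit_set closed_disk s).
Hypothesis S : bilip_system s r K a theta.

(** The finite sum is continuous in the exponent and still exceeds 1 at some t' > t, where mass
    distribution applies; moving to t' > 0 also admits t = 0. *)
Lemma hausdorff_dim_gt (W : seq (seq I)) (rho : seq I -> R) (t : R) :
  0 <= t -> uniq W -> (forall w, w \in W -> w != [::]) ->
  (forall u v, u \in W -> v \in W -> u != v -> incomp u v) ->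
  (forall w, 0 < rho w) ->
  (forall w, w \in W -> forall x y, closed_disk x -> closed_disk y ->
    rho w * enorm (x - y) <= enorm (wm w x - wm w y)) ->
  1 < \sum_(w <- W) rho w `^ t -> (t%:E < hausdorff_dim J)%E.
Proof.
move=> t0 uW W0 Winc rho0 low sum1.
have [|t' tt'] := @powR_sum_gt R _ W (fun=> 1) rho t rho0.
  by under eq_bigr do rewrite mul1r.
under eq_bigr do rewrite mul1r; move=> /ltW sum1'.
have t'0 : 0 < t' by exact: le_lt_trans tt'.
apply: (@lt_le_trans _ _ t'%:E); first by rewrite lte_fin.
apply: hausdorff_dim_ge => //.
exact: (mass_distribution S t'0 uW W0 Winc (fun w _ => rho0 w) low sum1').
Qed.

Lemma antichain_sum (W : seq (seq I)) (h : R) : hausdorff_dim J = h%:E ->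
  uniq W -> (forall w, w \in W -> w != [::]) ->
  (forall u v, u \in W -> v \in W -> u != v -> incomp u v) ->
  \sum_(w <- W) r w `^ h <= K `^ h.
Proof.
move=> dimJ uW W0 Winc.
have h0 : 0 <= h by rewrite -lee_fin -dimJ hausdorff_dim_ge0.
have K0 := sys_K0 S.
rewrite leNgt; apply/negP => sumK.
suff : (h%:E < hausdorff_dim J)%E by rewrite dimJ ltxx.
apply: (hausdorff_dim_gt (W := W) (rho := fun w => r w / K)) => //.
- by move=> w; rewrite divr_gt0 ?(sys_r0 S).
- move=> w _ x y Xx Xy; rewrite mulrAC ler_pdivrMr // mulrC.
  by rewrite [leRHS]mulrC mulrC; exact: (sys_low S).
- under eq_bigr do rewrite powRM ?ltW ?(sys_r0 S) ?invr_gt0 //.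
  by rewrite -mulr_suml powR_inv // ltr_pdivlMr ?powR_gt0 // mul1r.
Qed.

Fixpoint words (A : seq I) k : seq (seq I) :=
  if k is k'.+1 then [seq i :: w | i <- A, w <- words A k'] else [:: [::]].

Lemma mem_words A k w : (w \in words A k) = (size w == k) && all (mem A) w.
Proof.
elim: k w => [|k IH] [|i w] //=; rewrite ?inE //.
  by apply/allpairsP => -[[j v] []].
apply/allpairsP/idP => [[[j v] /= [jA vk [-> ->]]]|].
  by rewrite jA /= -IH.
by rewrite eqSS andbCA -IH => /andP[iA wk]; exists (i, w).
Qed.

Lemma words_uniq A k : uniq A -> uniq (words A k).
Proof.
move=> uA; elim: k => //= k IH; apply: allpairs_uniq => //.
by move=> [i w] [j v] _ _ [-> ->].
Qed.

Definition words_below (A : seq I) m := flatten [seq words A k | k <- iota 0 m].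

Lemma words_belowS A m : words_below A m.+1 = words_below A m ++ words A m.
Proof. by rewrite /words_below -addn1 iotaD map_cat flatten_cat /= cats0. Qed.

Lemma mem_words_below A m w : (w \in words_below A m) = (size w < m)%N && all (mem A) w.
Proof.
elim: m => // m IH; rewrite words_belowS mem_cat IH mem_words -andb_orl.
by rewrite ltnS [RHS](congr1 (andb^~ _) (leq_eqVlt _ _)) orbC.
Qed.

Lemma words_below_uniq A m : uniq A -> uniq (words_below A m).
Proof.
move=> uA; elim: m => // m IH; rewrite words_belowS cat_uniq IH words_uniq // andbT /=.
apply/hasPn => w; rewrite mem_words mem_words_below => /andP[/eqP-> _].
by rewrite ltnn.
Qed.

Lemma big_words_below A m (f : seq I -> R) :
  \sum_(w <- words_below A m) f w = \sum_(k < m) \sum_(w <- words A k) f w.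
Proof. by rewrite big_flatten big_map -{1}(subn0 m) big_mkord. Qed.

(** The first letter outside A ends the word, so no such word is a proper prefix of another. *)
Lemma incomparable_frontier (A : seq I) u v i j : all (mem A) u -> all (mem A) v ->
  i \notin A -> j \notin A -> u ++ [:: i] != v ++ [:: j] ->
  incomp (u ++ [:: i]) (v ++ [:: j]).
Proof.
move=> + + iA jA; elim: u v => [|i' u IH] [|j' v] /=.
- by move=> _ _; rewrite eqseq_cons andbT; exact: (incomparable_cons S).
- move=> _ /andP[j'A _] _; apply: (incomparable_cons S).
  by apply: contraNneq iA => ->.
- move=> /andP[i'A _] _ _; apply: (incomparable_cons S).
  by apply: contraNneq jA => <-.
move=> /andP[_ uA] /andP[_ vA]; have [<-|ij] := eqVneq i' j'; last first.
  by move=> _; exact: (incomparable_cons S).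
rewrite eqseq_cons eqxx /= => uv; rewrite -(cat1s i' (u ++ _)) -(cat1s i' (v ++ _)).
by apply: (incomparable_catl S); exact: IH.
Qed.

Definition cylinder_sum A t k : R := \sum_(w <- words A k) r w `^ t.

Lemma cylinder_sum_ge0 A t k : 0 <= cylinder_sum A t k.
Proof. by apply: sumr_ge0 => w _; exact: powR_ge0. Qed.

Lemma limit_set_split A m x : J x ->
  (exists w y, [/\ w \in words A m, J y & x = wm w y]) \/
  (exists k w i y, [/\ (k < m)%N, w \in words A k, i \notin A, J y & x = wm (w ++ [:: i]) y]).
Proof.
elim: m x => [|m IH] x Jx; first by left; exists [::], x.
have /(limit_setP S)[om hom] := Jx.
have [y [Jy _] xy] := limit_set_shift S 1 hom.
pose i := om 0%N; have {}xy : x = s i y by [].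
have [iA|iA] := boolP (i \in A); last first.
  by right; exists 0%N, [::], i, y.
have [[w [z [wm_ Jz yz]]]|[k [w [j [z [km wk jA Jz yz]]]]]] := IH y Jy.
  left; exists (i :: w), z; split=> //; last by rewrite xy yz.
  by rewrite mem_words /= eqSS iA /= -mem_words.
right; exists k.+1, (i :: w), j, z; split=> //; last by rewrite xy yz.
by rewrite mem_words /= eqSS iA /= -mem_words.
Qed.

Lemma coverable_word t sigma w : 0 < t -> coverable t 2 J sigma ->
  coverable t 2 (wm w @` J) ((K * r w) `^ t * sigma).
Proof.
move=> t0 cov.
apply: (@coverable_cap _ _ _ (K * r w * 2)) (ltW t0) (ler0n R 2) _ _.
  move=> _ _ [x Jx <-] [y Jy <-].
  by apply: closed_disk_dist; apply: (word_map_disk S); exact: (limit_set_disk S).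
apply: coverable_image => //; first by rewrite mulr_ge0 ?ltW ?(sys_K0 S) ?(sys_r0 S).
by move=> x y Jx Jy; apply: (sys_up S); exact: (limit_set_disk S).
Qed.

Lemma coverable_ball t (rad : R) w : 0 < t -> 0 <= rad ->
  coverable t 2 (wm w @` [set y | closed_disk y /\ enorm y <= rad])
    ((2 * K * rad) `^ t * r w `^ t).
Proof.
move=> t0 rad0; have K0 := sys_K0 S; have r0 := sys_r0 S w.
rewrite -powRM ?(ltW r0) ?mulr_ge0 ?(ltW K0) //.
apply: (@coverable_cap _ _ _ (2 * K * rad * r w)) (ltW t0) (ler0n R 2) _ _.
  move=> _ _ [x [Xx _] <-] [y [Xy _] <-].
  by apply: closed_disk_dist; apply: (word_map_disk S).
apply: coverable_diam; first by rewrite gt_eqF.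
  by rewrite lexx !mulr_ge0 ?(ltW K0) ?(ltW r0).
move=> _ _ [x [Xx x1] <-] [y [Xy y1] <-]; apply: le_trans (sys_up S w Xx Xy) _.
have -> : 2 * K * rad * r w = K * r w * (2 * rad) by ring.
rewrite ler_pM2l ?mulr_gt0 // (le_trans (enormD _ _)) // enormN.
by rewrite mulr_natl mulr2n lerD.
Qed.

(** Three kinds of pieces: cylinders of length m over A; cylinders where the address leaves A
    through a letter of B, covered one by one; and, for each word over A, one ball for all other
    letters. K^4 is the Lipschitz factor K times the K^3 of [sys_r_cat_le]. *)
Lemma coverable_recursion A B m t sigma (rad : R) : 0 < t -> 0 <= rad ->
  (forall i y, i \notin A -> i \notin B -> closed_disk y -> enorm (s i y) <= rad) ->
  coverable t 2 J sigma ->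
  coverable t 2 J
    ((K `^ t * cylinder_sum A t m +
      (K ^+ 4) `^ t * (\sum_(k < m) cylinder_sum A t k) * (\sum_(i <- B) r [:: i] `^ t))
        * sigma +
     (2 * K * rad) `^ t * \sum_(k < m) cylinder_sum A t k).
Proof.
move=> t0 rad0 small cov; have K0 := sys_K0 S.
have sg0 := coverable_ge0 cov.
pose V := words_below A m.
pose F1 w := wm w @` J.
have c1 : coverable t 2 [set x | exists2 w, w \in words A m & F1 w x]
    (\sum_(w <- words A m) (K * r w) `^ t * sigma).
  by apply: coverable_bigcup => [||w _]; [rewrite gt_eqF|exact: ler0n|exact: coverable_word].
have c2 : coverable t 2 [set x | exists2 w, w \in [seq u ++ [:: i] | u <- V, i <- B] & F1 w x]
    (\sum_(w <- [seq u ++ [:: i] | u <- V, i <- B]) (K * r w) `^ t * sigma).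
  by apply: coverable_bigcup => [||w _]; [rewrite gt_eqF|exact: ler0n|exact: coverable_word].
have c3 : coverable t 2 [set x | exists2 w, w \in V &
      (wm w @` [set y | closed_disk y /\ enorm y <= rad]) x]
    (\sum_(w <- V) (2 * K * rad) `^ t * r w `^ t).
  by apply: coverable_bigcup => [||w _]; [rewrite gt_eqF|exact: ler0n|exact: coverable_ball].
apply: coverable_subset (coverableU (coverableU c1 c2) c3).
- move=> x /(limit_set_split A m)[[w [y [wA Jy ->]]]|[k [w [i [y [km wA iA Jy ->]]]]]].
    by left; left; exists w => //; exists y.
  have wV : w \in V by apply/flatten_mapP; exists k; rewrite ?mem_iota.
  have [iB|iB] := boolP (i \in B).
    by left; right; exists (w ++ [:: i]); [exact: allpairs_f|exists y].
  right; exists w => //; exists (s i y); last by rewrite word_map_cat.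
  have Xy := limit_set_disk S Jy.
  by split; [exact: (sys_disk S)|exact: small].
- rewrite -mulr_sumr big_words_below lerD2r mulrDl; apply: lerD.
    rewrite -mulr_suml ler_wpM2r // /cylinder_sum mulr_sumr le_eqVlt; apply/orP; left.
    by apply/eqP/eq_bigr => w _; rewrite powRM // ltW ?(sys_r0 S).
  rewrite -mulr_suml ler_wpM2r // big_allpairs_dep big_words_below -mulrA mulr_suml mulr_sumr.
  apply: ler_sum => k _; rewrite mulr_suml mulr_sumr; apply: ler_sum => w _.
  rewrite !mulr_sumr; apply: ler_sum => i _.
  have p0 u : 0 <= r u by rewrite ltW ?(sys_r0 S).
  rewrite -!powRM ?mulr_ge0 ?exprn_ge0 ?(ltW K0) //.
  rewrite ge0_ler_powR ?nnegrE ?mulr_ge0 ?exprn_ge0 ?(ltW K0) ?(ltW t0) //.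
  have -> : K ^+ 4 * (r w * r [:: i]) = K * (K ^+ 3 * r w * r [:: i]) by ring.
  by rewrite ler_pM2l //; exact: (sys_r_cat_le S).
Qed.

(** The Hausdorff content of J, scale 2 being no restriction on a set of diameter at most 2. For t >
    0 it is finite, unlike the measure, so an inequality cost <= phi * cost with phi < 1 makes it
    vanish. *)
Definition cover_cost t : R := inf [set sigma | coverable t 2 J sigma].

Lemma has_cover t : 0 < t -> coverable t 2 J (2 `^ t).
Proof.
move=> t0; apply: coverable_diam; first by rewrite gt_eqF.
  by rewrite lexx ler0n.
by move=> x y Jx Jy; apply: closed_disk_dist; exact: (limit_set_disk S).
Qed.

Lemma cover_cost_ge0 t : 0 < t -> 0 <= cover_cost t.
Proof.
move=> t0; apply: lb_le_inf; first by exists (2 `^ t); exact: has_cover.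
by move=> x; exact: coverable_ge0.
Qed.

Lemma cover_cost_recursion t (phi e : R) : 0 < t -> 0 <= phi ->
  (forall sigma, coverable t 2 J sigma -> coverable t 2 J (phi * sigma + e)) ->
  cover_cost t <= phi * cover_cost t + e.
Proof.
move=> t0 phi0 rec.
have inf_has : has_inf [set sigma | coverable t 2 J sigma].
  by split; [exists (2 `^ t); exact: has_cover|exists 0 => x; exact: coverable_ge0].
have cost_le sg : coverable t 2 J sg -> cover_cost t <= phi * sg + e.
  by move=> csg; apply: ge_inf; [exists 0 => x; exact: coverable_ge0|exact: rec].
have [p0|p0] := leP phi 0.
  have pE : phi = 0 by apply/eqP; rewrite eq_le p0.
  by have := cost_le _ (has_cover t0); rewrite pE !mul0r.
apply/ler_addgt0Pr => eps eps0.
have [sg csg /ltW sgl] := inf_adherent (divr_gt0 eps0 p0) inf_has.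
apply: le_trans (cost_le _ csg) _; rewrite addrAC lerD2r.
have -> : eps = phi * (eps / phi) by rewrite mulrCA divff ?gt_eqF // mulr1.
by rewrite -mulrDr ler_pM2l.
Qed.

Lemma cover_cost0_hausdorff t : 0 < t -> cover_cost t = 0 -> hausdorff_measure t J = 0%E.
Proof.
move=> t0 cost0; apply: coverable_hausdorff0 (ltW t0) _.
apply: (coverable_small (delta := 2) t0) => eps eps0.
have inf_has : has_inf [set sigma | coverable t 2 J sigma].
  by split; [exists (2 `^ t); exact: has_cover|exists 0 => x; exact: coverable_ge0].
have [sg csg] := inf_adherent eps0 inf_has; rewrite -/(cover_cost t) cost0 add0r => /ltW.
by move=> h; exact: coverable_subset csg.
Qed.

End Covering.

(** * Elementary limits of sums and powers *)

Section RealSequences.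
Context {R : realType}.

Lemma bounded_sum_small (f : nat -> R) (C eps : R) :
  (forall m, \sum_(k < m) f k <= C) -> 0 < eps -> exists m, f m <= eps.
Proof.
move=> fC eps0; apply: contrapT => no.
have big m : eps *+ m <= \sum_(k < m) f k.
  elim: m => [|m IH]; first by rewrite big_ord0 mulr0n.
  rewrite big_ord_recr mulrSr /= lerD // ltW // ltNge; apply/negP => h.
  by apply: no; exists m.
have C0 : 0 <= C by have := fC 0%N; rewrite big_ord0.
have := archi_boundP (divr_ge0 C0 (ltW eps0)); set m := Num.bound _.
rewrite ltr_pdivrMr // mulr_natl; apply/negP; rewrite -leNgt.
exact: le_trans (big m) (fC m).
Qed.

Lemma powR_large (q C : R) : 0 < q -> exists M0 : nat, forall M : nat,
  (M0 <= M)%N -> C <= M%:R `^ q.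
Proof.
move=> q0; have [C0|C0] := leP C 0.
  by exists 0%N => M _; rewrite (le_trans C0) // powR_ge0.
have := archi_boundP (powR_ge0 C q^-1); set M0 := Num.bound _ => h.
exists M0 => M MM0.
have CM : C `^ q^-1 <= M%:R by rewrite (le_trans (ltW h)) // ler_nat.
have := ge0_ler_powR (ltW q0) _ _ CM.
rewrite -powRrM mulVf ?gt_eqF // powRr1 ?(ltW C0) //; apply; rewrite nnegrE ?ler0n //.
exact: powR_ge0.
Qed.

Lemma powR_vanish (q C eps : R) : q < 0 -> 0 <= C -> 0 < eps ->
  exists M0 : nat, forall M : nat, (M0 <= M)%N -> (0 < M)%N -> C * M%:R `^ q <= eps.
Proof.
move=> q0 C0 eps0; have nq0 : 0 < - q by rewrite oppr_gt0.
have [M0 HM0] := powR_large (C / eps) nq0.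
exists M0 => M /HM0 + M0'; rewrite ler_pdivrMr // => h.
have Mp : 0 < M%:R `^ (- q) :> R by rewrite powR_gt0 // ltr0n.
have -> : M%:R `^ q = (M%:R `^ (- q))^-1 :> R by rewrite -powRN opprK.
by rewrite ler_pdivrMr // mulrC.
Qed.

End RealSequences.

(** * Finite blocks of the alphabet *)

Section Letters.
Context {T : nat}.
Local Notation I := (nat * 'I_T)%type.

Definition letters M M' : seq I := [seq (n, j) | n <- iota M (M' - M), j <- enum 'I_T].

Lemma mem_letters M M' (p : I) : (p \in letters M M') = (M <= p.1 < M')%N.
Proof.
apply/allpairsP/idP => [[[n j] /= [+ _ ->]]|].
  by rewrite mem_iota /=; lia.
case: p => n j /= h; exists (n, j); split=> //=; last by rewrite mem_enum.
by rewrite mem_iota; lia.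
Qed.

Lemma letters_geq M M' : (M' <= M)%N -> letters M M' = [::].
Proof. by rewrite /letters -subn_eq0 => /eqP->. Qed.

Lemma letters_uniq M M' : uniq (letters M M').
Proof. by apply: allpairs_uniq; rewrite ?iota_uniq ?enum_uniq // => -[n j] [n' j'] _ _ [-> ->]. Qed.

Lemma sum_letters (R : realType) M M' (f : nat -> R) :
  \sum_(p <- letters M M') f p.1 = T%:R * \sum_(M <= n < M') f n.
Proof.
rewrite big_allpairs_dep /= mulr_sumr; apply: eq_bigr => n _.
by rewrite big_enum /= sumr_const card_ord mulr_natl.
Qed.

End Letters.

(** Termwise comparison with M^(2 - beta) (1/n - 1/(n+1)), which telescopes. In the application beta
    = 2 gamma t, so beta >= 2 means gamma t >= 1. *)
Lemma sum_powR_tail {R : realType} (M M' : nat) (beta : R) : (0 < M)%N -> 2 <= beta ->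
  \sum_(M <= n < M') n.+1%:R `^ (- beta) <= M%:R `^ (1 - beta).
Proof.
move=> M0 b2; have M0R : 0 < M%:R :> R by rewrite ltr0n.
have M1 : 1 <= M%:R :> R by rewrite ler1n.
have [MM'|/ltnW MM'] := leqP M' M; first by rewrite big_geq // powR_ge0.
have step n : (M <= n)%N ->
    n.+1%:R `^ (- beta) <= M%:R `^ (2 - beta) * (n%:R^-1 - n.+1%:R^-1).
  move=> Mn; have n0 : 0 < n%:R :> R by rewrite ltr0n (leq_trans M0).
  have n1 : 0 < n.+1%:R :> R by rewrite ltr0n.
  have -> : n.+1%:R `^ (- beta) = n.+1%:R `^ (2 - beta) * n.+1%:R `^ (- 2).
    rewrite -powRD; last by rewrite (gt_eqF n1) implybT.
    by congr powR; ring.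
  apply: ler_pM; rewrite ?powR_ge0 //.
    rewrite -(opprB beta 2) !powRN lef_pV2 ?posrE ?powR_gt0 //.
    by rewrite ge0_ler_powR ?nnegrE ?subr_ge0 ?ler0n // ler_nat (leq_trans Mn).
  rewrite powRN powR_mulrn ?ler0n //.
  have -> : n%:R^-1 - n.+1%:R^-1 = (n%:R * n.+1%:R)^-1 :> R.
    by rewrite -natr1; field; rewrite natr1 !gt_eqF.
  rewrite lef_pV2 ?posrE ?exprn_gt0 ?mulr_gt0 // expr2 ler_pM2r //.
  by rewrite ler_nat.
apply: (@le_trans _ _ (\sum_(M <= n < M') M%:R `^ (2 - beta) * (n%:R^-1 - n.+1%:R^-1))).
  by apply: ler_sum_nat => n /andP[Mn _]; exact: step.
rewrite -mulr_sumr.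
have -> : \sum_(M <= n < M') (n%:R^-1 - n.+1%:R^-1) = M%:R^-1 - M'%:R^-1 :> R.
  rewrite -opprB -(telescope_sumr (fun n => n%:R^-1) MM') -sumrN.
  by apply: eq_bigr => n _; rewrite opprB.
have -> : M%:R `^ (1 - beta) = M%:R `^ (2 - beta) * M%:R `^ (- 1).
  rewrite -powRD; last by rewrite (gt_eqF M0R) implybT.
  by congr powR; ring.
by rewrite ler_wpM2l ?powR_ge0 // powR_inv1 ?ler0n // gerBl invr_ge0 ler0n.
Qed.

(** * Hausdorff measure below the threshold *)

Section Growth.
Context {R : realType} {T : nat}.
Local Notation I := (nat * 'I_T)%type.
Local Notation E := 'rV[R]_2.
Context {s : I -> E -> E} {r : seq I -> R} {K a theta : R}.
Local Notation wm := (word_map s).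
Local Notation J := (limit_set closed_disk s).
Hypothesis S : bilip_system s r K a theta.
Variables (gamma k1 k2 : R) (j0 : 'I_T).
Hypotheses (gamma1 : 1 <= gamma) (k10 : 0 < k1) (k20 : 0 < k2).

Definition rate (n : nat) : R := n.+1%:R `^ (- gamma).

Lemma rate_def n : rate n = n.+1%:R `^ (- gamma). Proof. by []. Qed.

Hypothesis r_low : forall p, k1 * rate p.1 ^+ 2 <= r [:: p].
Hypothesis r_up : forall p, r [:: p] <= k2 * rate p.1 ^+ 2.
Hypothesis s_low : forall p x, closed_disk x -> k1 * rate p.1 <= enorm (s p x).
Hypothesis s_up : forall p x, closed_disk x -> enorm (s p x) <= k2 * rate p.1.

Local Notation head M := (letters 0 M : seq I).
Local Notation Sum M t m := (\sum_(k < m) cylinder_sum (r := r) (head M) t k).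

Let gamma0 : 0 < gamma. Proof. exact: lt_le_trans ltr01 gamma1. Qed.
Let K0 : 0 < K. Proof. exact: sys_K0 S. Qed.

Lemma rate_gt0 n : 0 < rate n. Proof. by rewrite powR_gt0. Qed.

Lemma rate_le n m : (n <= m)%N -> rate m <= rate n.
Proof.
move=> nm; rewrite /rate !powRN lef_pV2 ?posrE ?powR_gt0 //.
by rewrite ge0_ler_powR ?nnegrE ?ler0n ?(ltW gamma0) // ler_nat.
Qed.

Lemma rate_sqr_le n m : (n <= m)%N -> rate m ^+ 2 <= rate n ^+ 2.
Proof. by move=> nm; rewrite !expr2 ler_pM ?rate_le ?(ltW (rate_gt0 _)). Qed.

Lemma rate_powR n t : (rate n ^+ 2) `^ t = n.+1%:R `^ (- (2 * gamma * t)).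
Proof.
rewrite /rate -powR_mulrn ?powR_ge0 // -!powRrM; congr powR; ring.
Qed.

Lemma enorm_tail M p x : (M <= p.1)%N -> closed_disk x -> enorm (s p x) <= k2 * rate M.
Proof.
by move=> Mp Xx; rewrite (le_trans (s_up p Xx)) // ler_pM2l // rate_le.
Qed.

(** The antichain consists of words over the letters below M followed by one of the M letters
    [(n, j0)] with M <= n < 2M. The last letter multiplies ratios by at least a constant times M^(-2
    gamma), so [Sum] is at most of order M^(2 gamma h - 1). *)
Lemma prefix_sum_upper (h : R) M m : hausdorff_dim J = h%:E -> (0 < M)%N ->
  Sum M h m * (M%:R * (k1 * rate (2 * M).-1 ^+ 2 / K ^+ 3) `^ h) <= K `^ h.
Proof.
move=> dimJ M0; have h0 : 0 <= h by rewrite -lee_fin -dimJ hausdorff_dim_ge0.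
pose P : seq I := [seq (n, j0) | n <- iota M M].
have PM p : p \in P -> (M <= p.1 < 2 * M)%N.
  by move=> /mapP[n + ->]; rewrite mem_iota /=; lia.
pose W := [seq u ++ [:: p] | u <- words_below (head M) m, p <- P].
apply: le_trans (antichain_sum S (W := W) dimJ _ _ _).
- rewrite big_allpairs_dep /= -big_words_below mulr_suml.
  apply: ler_sum => u _.
  have -> : M%:R * (k1 * rate (2 * M).-1 ^+ 2 / K ^+ 3) `^ h =
      \sum_(p <- P) (k1 * rate (2 * M).-1 ^+ 2 / K ^+ 3) `^ h.
    by rewrite big_const_seq count_predT size_map size_iota iter_addr_0 mulr_natl.
  rewrite mulr_sumr big_seq [leRHS]big_seq; apply: ler_sum => p /PM /andP[Mp pM].
  have q0 : 0 <= k1 * rate (2 * M).-1 ^+ 2 / K ^+ 3.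
    by rewrite !mulr_ge0 ?invr_ge0 ?exprn_ge0 // ltW ?rate_gt0.
  rewrite -powRM ?(ltW (sys_r0 S _)) //.
  have uq0 := mulr_ge0 (ltW (sys_r0 S u)) q0.
  apply: ge0_ler_powR; rewrite ?nnegrE ?(ltW (sys_r0 S _)) //.
  rewrite mulrA ler_pdivrMr ?exprn_gt0 // [leRHS]mulrC.
  apply: le_trans (sys_r_cat_ge S u [:: p]).
  rewrite ler_pM2l ?(sys_r0 S) // (le_trans _ (r_low p)) // ler_pM2l //.
  by apply: rate_sqr_le; rewrite -ltnS prednK ?muln_gt0.
- apply: allpairs_uniq; first by rewrite words_below_uniq // letters_uniq.
    by rewrite map_inj_uniq ?iota_uniq // => n n' [].
  by move=> [u p] [v q] _ _ /=; rewrite !cats1 => /rcons_inj[-> ->].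
- by move=> _ /allpairsP[[u p] /= [_ _ ->]]; rewrite -size_eq0 size_cat addn1.
- move=> _ _ /allpairsP[[u p] /= [uA pP ->]] /allpairsP[[v q] /= [vA qP ->]].
  move: uA vA; rewrite !mem_words_below => /andP[_ uA] /andP[_ vA].
  apply: (incomparable_frontier S uA vA); rewrite mem_letters.
    by rewrite negb_and -!leqNgt; have /andP[-> _] := PM _ pP; rewrite orbT.
  by rewrite negb_and -!leqNgt; have /andP[-> _] := PM _ qP; rewrite orbT.
Qed.

(** At h = 0 two distinct letters would give an antichain sum of 2 against the bound K^0 = 1. *)
Lemma hausdorff_dim_gt0 (h : R) : hausdorff_dim J = h%:E -> 0 < h.
Proof.
move=> dimJ; have h0 : 0 <= h by rewrite -lee_fin -dimJ hausdorff_dim_ge0.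
rewrite lt_neqAle h0 andbT; apply/eqP => hE.
pose p0 : I := (0%N, j0); pose p1 : I := (1%N, j0).
suff : \sum_(w <- [:: [:: p0]; [:: p1]]) r w `^ h <= K `^ h.
  rewrite !big_cons big_nil -hE !powRr0; lra.
apply: (antichain_sum S dimJ) => //.
- by move=> w; rewrite !inE => /orP[] /eqP->.
- by move=> u v; rewrite !inE => /orP[] /eqP-> /orP[] /eqP-> uv;
    exact: (incomparable_size S).
Qed.

(** [maxn] serves both uses: M' = 0, where no letter is treated individually, and M' tending to
    infinity, where the balls shrink to nothing. *)
Lemma cover_cost_head t M M' m : 0 < t ->
  cover_cost (s := s) t <=
    (K `^ t * cylinder_sum (r := r) (head M) t m +
     (K ^+ 4) `^ t * Sum M t m * (\sum_(p <- letters M M') r [:: p] `^ t))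
       * cover_cost (s := s) t +
    (2 * K * (k2 * rate (maxn M M'))) `^ t * Sum M t m.
Proof.
move=> t0; apply: (cover_cost_recursion S) => //.
  apply: addr_ge0; rewrite ?mulr_ge0 ?powR_ge0 ?cylinder_sum_ge0 //.
    by apply: sumr_ge0 => k _; exact: cylinder_sum_ge0.
  by apply: sumr_ge0 => p _; exact: powR_ge0.
move=> sigma; apply: (coverable_recursion S) => //.
  by rewrite mulr_ge0 // ltW ?rate_gt0.
move=> p x pA pB Xx; apply: enorm_tail => //.
move: pA pB; rewrite !mem_letters !negb_and -!leqNgt /= => Mp.
by rewrite geq_max Mp.
Qed.

Lemma cover_cost_upper (h : R) M : hausdorff_dim J = h%:E -> (0 < M)%N ->
  cover_cost (s := s) h <=
    (2 * K ^+ 5 * k2 * (2 `^ gamma) ^+ 2 / k1) `^ h * M%:R `^ (gamma * h - 1).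
Proof.
move=> dimJ M0; have h0 := hausdorff_dim_gt0 dimJ.
have M0R : 0 < M%:R :> R by rewrite ltr0n.
set cost := cover_cost h.
pose q : R := M%:R * (k1 * rate (2 * M).-1 ^+ 2 / K ^+ 3) `^ h.
have z0 : 0 < k1 * rate (2 * M).-1 ^+ 2 / K ^+ 3.
  by rewrite !mulr_gt0 ?invr_gt0 ?exprn_gt0 ?rate_gt0.
have q0 : 0 < q by rewrite mulr_gt0 ?powR_gt0.
have SumC m : Sum M h m <= K `^ h / q by rewrite ler_pdivlMr // prefix_sum_upper.
have cost0 : 0 <= cost by exact: (cover_cost_ge0 S).
pose e : R := (2 * K * (k2 * rate M)) `^ h * (K `^ h / q).
have cost_e : cost <= e.
  apply/ler_addgt0Pr => eps eps0.
  (* The cylinder sums have bounded total over all lengths, so at some length m the first term of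
     the recursion is below eps; [cost + 1] stands in for [cost], which may be 0. *)
  have Kc0 : 0 < K `^ h * (cost + 1) by rewrite mulr_gt0 ?powR_gt0 // ltr_wpDl.
  have [m Am] := bounded_sum_small SumC (divr_gt0 eps0 Kc0).
  have := cover_cost_head M 0 m h0.
  rewrite [letters M 0]letters_geq // big_nil mulr0 addr0 maxn0 => /le_trans; apply.
  rewrite addrC; apply: lerD; first by rewrite ler_wpM2l ?powR_ge0.
  move: Am; rewrite ler_pdivlMr // => Am.
  apply: le_trans Am; rewrite mulrCA mulrA ler_wpM2l ?mulr_ge0 ?powR_ge0 ?cylinder_sum_ge0 //.
  by rewrite lerDl.
apply: le_trans cost_e _.
pose y : R := M%:R `^ gamma; have y0 : 0 < y by rewrite powR_gt0.
have rM : rate M <= y^-1.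
  rewrite /rate powRN lef_pV2 ?posrE ?powR_gt0 //.
  by rewrite ge0_ler_powR ?nnegrE ?ler0n ?(ltW gamma0) // ler_nat.
have r2M : rate (2 * M).-1 = (2 `^ gamma * y)^-1.
  by rewrite /rate prednK ?muln_gt0 // natrM powRN powRM ?ler0n.
have g2 : 0 < 2 `^ gamma :> R by rewrite powR_gt0.
have -> : e = (2 * K * (k2 * rate M) * K / (k1 * rate (2 * M).-1 ^+ 2 / K ^+ 3)) `^ h / M%:R.
  rewrite /e /q.
  have r0 := rate_gt0 M.
  rewrite [in RHS]powRM ?mulr_ge0 ?invr_ge0 ?(ltW K0) ?(ltW k20) ?(ltW r0) ?(ltW z0) //.
  rewrite [in RHS]powRM ?mulr_ge0 ?(ltW K0) ?(ltW k20) ?(ltW r0) //.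
  rewrite powR_inv // invfM; ring.
have -> : M%:R `^ (gamma * h - 1) = y `^ h / M%:R.
  by rewrite powRD ?(gt_eqF M0R) ?implybT // powRrM powR_inv1 ?ler0n.
rewrite [leRHS]mulrA ler_pM2r ?invr_gt0 //.
have D0 : 0 <= 2 * K ^+ 5 * k2 * (2 `^ gamma) ^+ 2 / k1.
  by rewrite !mulr_ge0 ?exprn_ge0 ?invr_ge0 ?(ltW K0) ?(ltW k20) ?(ltW k10) ?(ltW g2).
rewrite -powRM ?(ltW y0) //.
apply: ge0_ler_powR; rewrite ?nnegrE ?(ltW h0) ?mulr_ge0 ?invr_ge0 ?(ltW K0) ?(ltW k20)
  ?(ltW (rate_gt0 _)) ?(ltW z0) ?(ltW y0) ?(ltW k10) ?exprn_ge0 ?(ltW g2) ?(ltW K0) //.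
have -> : 2 * K ^+ 5 * k2 * (2 `^ gamma) ^+ 2 / k1 * y =
    2 * K * (k2 * y^-1) * K / (k1 * rate (2 * M).-1 ^+ 2 / K ^+ 3).
  by rewrite r2M; field; rewrite !gt_eqF.
rewrite ler_pM2r ?invr_gt0 // ler_pM2r // ler_pM2l ?mulr_gt0 //.
by rewrite ler_pM2l.
Qed.

Lemma hausdorff_measure_limit_set_eq0 (h : R) : hausdorff_dim J = h%:E -> h < 1 / gamma ->
  hausdorff_measure h J = 0%E.
Proof.
move=> dimJ hg; have h0 := hausdorff_dim_gt0 dimJ.
apply: (cover_cost0_hausdorff S h0).
apply/eqP; rewrite eq_le (cover_cost_ge0 S h0) andbT.
apply/ler_addgt0Pr => eps eps0; rewrite add0r.
have gh : gamma * h - 1 < 0.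
  by rewrite subr_lt0 mulrC -ltr_pdivlMr.
have [M0 HM0] := powR_vanish gh (powR_ge0 (2 * K ^+ 5 * k2 * (2 `^ gamma) ^+ 2 / k1) h) eps0.
apply: le_trans (cover_cost_upper (M := M0.+1) dimJ isT) _.
exact: HM0.
Qed.

End Growth.

(** * Cylinder sums above the threshold *)

Section LowerSum.
Context {R : realType} {T : nat}.
Local Notation I := (nat * 'I_T)%type.
Local Notation E := 'rV[R]_2.
Context {s : I -> E -> E} {r : seq I -> R} {K a theta : R}.
Local Notation wm := (word_map s).
Local Notation J := (limit_set closed_disk s).
Hypothesis S : bilip_system s r K a theta.
Variables (gamma k1 k2 : R) (j0 : 'I_T).
Hypotheses (gamma1 : 1 <= gamma) (k10 : 0 < k1) (k20 : 0 < k2).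
Local Notation rate := (rate gamma).
Hypothesis r_up : forall p, r [:: p] <= k2 * rate p.1 ^+ 2.
Hypothesis s_up : forall p x, closed_disk x -> enorm (s p x) <= k2 * rate p.1.

Local Notation head M := (letters 0 M : seq I).
Local Notation Sum M t m := (\sum_(k < m) cylinder_sum (r := r) (head M) t k).

Let gamma0 : 0 < gamma. Proof. exact: lt_le_trans ltr01 gamma1. Qed.
Let K0 : 0 < K. Proof. exact: sys_K0 S. Qed.

(** The factor in [cover_cost_head] with the sum over the letters from M to M' replaced by a bound
    independent of M'. *)
Let phi M m t := K `^ t * cylinder_sum (r := r) (head M) t m +
  (K ^+ 4) `^ t * Sum M t m * (T%:R * k2 `^ t * M%:R `^ (1 - 2 * gamma * t)).

(** M^(1 - 2 gamma t) = M (M^(-2 gamma))^t, so for fixed M and m this is a finite combination of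
    t-th powers and hence continuous in t; the tags of the sum type separate its two parts. *)
Let phi_powR_sum M m : (0 < M)%N -> exists (l : seq (seq I + seq I)) (c b : seq I + seq I -> R),
  (forall i, 0 < b i) /\ forall t, phi M m t = \sum_(i <- l) c i * b i `^ t.
Proof.
move=> M0; have M0R : 0 < M%:R :> R by rewrite ltr0n.
exists ([seq inl w | w <- words (head M) m] ++ [seq inr w | w <- words_below (head M) m]).
exists (fun i => if i is inl _ then 1 else T%:R * M%:R).
exists (fun i => match i with inl w => K * r w
  | inr w => K ^+ 4 * r w * (k2 * M%:R `^ (- (2 * gamma))) end); split.
  by case=> w; rewrite !mulr_gt0 ?powR_gt0 ?exprn_gt0 ?(sys_r0 S).
move=> t; rewrite big_cat !big_map /=; congr (_ + _).
  rewrite /cylinder_sum mulr_sumr; apply: eq_bigr => w _.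
  by rewrite mul1r powRM // ltW ?(sys_r0 S).
rewrite -big_words_below mulr_sumr mulr_suml; apply: eq_bigr => w _.
have r0 := ltW (sys_r0 S w).
have -> : M%:R `^ (1 - 2 * gamma * t) = M%:R * M%:R `^ (- (2 * gamma)) `^ t.
  rewrite powRD; last by rewrite (gt_eqF M0R) implybT.
  by rewrite powRr1 ?ler0n // -powRrM mulNr.
rewrite [in RHS]powRM ?mulr_ge0 ?powR_ge0 ?exprn_ge0 ?(ltW K0) ?(ltW k20) //.
rewrite [in RHS]powRM ?exprn_ge0 ?(ltW K0) //.
rewrite [in RHS]powRM ?powR_ge0 ?(ltW k20) //.
ring.
Qed.

Lemma sum_tail_letters M M' t : (0 < M)%N -> 1 <= gamma * t -> 0 < t ->
  \sum_(p <- letters M M') r [:: p] `^ t <=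
  T%:R * k2 `^ t * M%:R `^ (1 - 2 * gamma * t).
Proof.
move=> M0 gt1 t0.
apply: (@le_trans _ _ (\sum_(p <- (letters M M' : seq I))
    k2 `^ t * p.1.+1%:R `^ (- (2 * gamma * t)))).
  apply: ler_sum => p _; rewrite -rate_powR -powRM ?exprn_ge0 ?(ltW k20) ?powR_ge0 //.
  apply: ge0_ler_powR => //; rewrite ?nnegrE ?(ltW t0) ?(ltW (sys_r0 S _)) //.
  by rewrite mulr_ge0 ?exprn_ge0 ?(ltW k20) ?powR_ge0.
rewrite (sum_letters M M' (fun n => k2 `^ t * n.+1%:R `^ (- (2 * gamma * t)))).
rewrite -mulr_sumr mulrA ler_wpM2l ?mulr_ge0 ?powR_ge0 //.
apply: sum_powR_tail => //.
by rewrite -mulrA -[leLHS]mulr1 ler_pM2l.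
Qed.

(** Otherwise a suitable m gives phi <= 1/4 + 1/2 at h, hence phi < 1 at some t with 1/gamma < t <
    h. The recursion then makes the content at t vanish, so the dimension is at most t. Staying
    above 1/gamma keeps the tail bound on the letters available. *)
Lemma prefix_sum_lower (h : R) M : hausdorff_dim J = h%:E -> 1 / gamma < h -> (0 < M)%N ->
  exists m, 1 <= 2 * (Sum M h m *
    ((K ^+ 4) `^ h * T%:R * k2 `^ h * M%:R `^ (1 - 2 * gamma * h))).
Proof.
move=> dimJ gh M0; have M0R : 0 < M%:R :> R by rewrite ltr0n.
have T0 : 0 < T%:R :> R by rewrite ltr0n; case: (T) j0 => // -[].
set Q := _ * M%:R `^ _.
have Q0 : 0 < Q by rewrite !mulr_gt0 ?powR_gt0 ?exprn_gt0.
apply: contrapT => no.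
have SumC m : Sum M h m <= (2 * Q)^-1.
  have Q2 : 0 < 2 * Q by rewrite mulr_gt0.
  rewrite -(ler_pM2r Q2) mulVf ?gt_eqF // leNgt; apply/negP => /ltW H.
  by apply: no; exists m; rewrite mulrCA.
have Kh : 0 < K `^ h by rewrite powR_gt0.
have [m Am] := bounded_sum_small SumC (divr_gt0 ltr01 (mulr_gt0 (ltr0Sn R 3) Kh)).
have phih : phi M m h < 1.
  have e1 : K `^ h * cylinder_sum (r := r) (head M) h m <= 4^-1.
    rewrite -ler_pdivlMl //; apply: le_trans Am _.
    by rewrite mul1r invfM mulrC.
  have e2 : (K ^+ 4) `^ h * Sum M h m * (T%:R * k2 `^ h * M%:R `^ (1 - 2 * gamma * h)) <= 2^-1.
    have -> : (K ^+ 4) `^ h * Sum M h m * (T%:R * k2 `^ h * M%:R `^ (1 - 2 * gamma * h))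
      = Sum M h m * Q by rewrite /Q; ring.
    apply: (@le_trans _ _ ((2 * Q)^-1 * Q)); first by rewrite ler_pM2r.
    by rewrite invfM -mulrA mulVf ?gt_eqF // mulr1.
  rewrite /phi; lra.
have [l [c [b [b0 phiE]]]] := @phi_powR_sum M m M0.
have [t /andP[gt th] phit] : exists2 t, 1 / gamma < t < h & phi M m t < 1.
  rewrite phiE in phih; have [t tt Ht] := powR_sum_lt b0 gh phih.
  by exists t => //; rewrite phiE.
have t0 : 0 < t by apply: lt_trans gt; rewrite divr_gt0.
have gt1 : 1 <= gamma * t by rewrite mulrC -ler_pdivrMr // ltW.
pose cost := cover_cost (s := s) t.
have cost0 : 0 <= cost by exact: (cover_cost_ge0 S).
have cost_phi : cost <= phi M m t * cost.
  apply/ler_addgt0Pr => eps eps0.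
  have nq : - (gamma * t) < 0 by rewrite oppr_lt0 mulr_gt0.
  have C0 : 0 <= (2 * K * k2) `^ t * Sum M t m.
    by rewrite mulr_ge0 ?powR_ge0 // sumr_ge0 // => k _; exact: cylinder_sum_ge0.
  have [M1 HM1] := powR_vanish nq C0 eps0.
  (* Only the ball term depends on M' once the tail bound is used, and it decays like M'^(-gamma
     t). *)
  pose M' := maxn M M1.+1.
  have := cover_cost_head S gamma1 k20 s_up M M' m t0.
  move=> /le_trans; apply; apply: lerD.
    rewrite ler_wpM2r // lerD2l ler_wpM2l ?sum_tail_letters //.
    by rewrite mulr_ge0 ?powR_ge0 // sumr_ge0 // => k _; exact: cylinder_sum_ge0.
  have M'0 : (0 < M')%N by rewrite leq_max orbT.
  apply: le_trans (HM1 M' _ M'0); last by rewrite leq_max leqnSn orbT.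
  rewrite mulrA powRM ?mulr_ge0 ?powR_ge0 ?(ltW K0) ?(ltW k20) //.
  rewrite mulrAC ler_wpM2l //.
  have -> : maxn M M' = M' by apply/maxn_idPr; rewrite leq_maxl.
  rewrite -powRrM mulNr !powRN lef_pV2 ?posrE ?powR_gt0 ?ltr0n //.
  by rewrite ge0_ler_powR ?nnegrE ?ler0n ?mulr_ge0 ?(ltW gamma0) ?(ltW t0) // ler_nat.
have cost_eq0 : cost = 0.
  apply/eqP; rewrite eq_le cost0 andbT leNgt; apply/negP => cpos.
  by move: cost_phi; rewrite -{1}[cost]mul1r ler_pM2r // leNgt phit.
have := hausdorff_dim_le (ltW t0) (cover_cost0_hausdorff S t0 cost_eq0).
by rewrite dimJ lee_fin leNgt th.
Qed.

End LowerSum.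

(** * Finite sums and convergence of the p-series *)

Section FiniteSums.
Context {R : realType}.

Lemma sum_fibers (T U : eqType) (l : seq T) (f : T -> U) (V : seq U) (G : T -> R) :
  uniq V -> (forall i, i \in l -> f i \in V) ->
  \sum_(i <- l) G i = \sum_(v <- V) \sum_(i <- l | f i == v) G i.
Proof.
move=> uV lV; under [RHS]eq_bigr do rewrite big_mkcond.
rewrite [RHS]exchange_big /= big_seq [RHS]big_seq; apply: eq_bigr => i /lV fV.
rewrite (perm_big _ (perm_to_rem fV)) big_cons /= eqxx big1_seq ?addr0 // => v /andP[_].
by rewrite (mem_rem_uniq _ uV) inE eq_sym => /andP[/negbTE->].
Qed.

Lemma sum_geometric_le (n : nat) (x : R) : 0 < x < 1 -> \sum_(k < n) x ^+ k <= (1 - x)^-1.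
Proof.
move=> /andP[x0 x1]; rewrite -[leRHS]mul1r.
have := @geometric_le_lim R n 1 x ler01 x0.
rewrite (ger0_norm (ltW x0)) => /(_ x1); rewrite /series /= big_mkord.
by rewrite (eq_bigr (fun i : 'I_n => x ^+ i)) // => i _; rewrite /= mul1r.
Qed.

Lemma powR_lt1 (x t : R) : 0 <= x < 1 -> 0 < t -> x `^ t < 1.
Proof.
move=> /andP[x0 x1] t0; have := gt0_ltr_powR t0 _ _ x1.
by rewrite powR1; apply; rewrite nnegrE.
Qed.

(** Cauchy condensation: the block 2^k <= n + 1 < 2^(k+1) contributes at most x^k with x = 2^(1 -
    beta). *)
Lemma sum_powR_bounded (beta : R) : 1 < beta -> exists C : R, forall N : nat,
  \sum_(n < N) n.+1%:R `^ (- beta) <= C.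
Proof.
move=> b1; pose x : R := 2 `^ (1 - beta).
have x0 : 0 < x by rewrite powR_gt0.
have x1 : x < 1.
  have -> : x = 2^-1 `^ (beta - 1) by rewrite powR_inv // -powRN opprB.
  by apply: powR_lt1; rewrite ?subr_gt0 // invr_ge0 ler0n invf_lt1 ?ltr1n.
have dyadic k : \sum_(0 <= n < (2 ^ k).-1) n.+1%:R `^ (- beta) <= \sum_(j < k) x ^+ j.
  elim: k => [|k IH]; first by rewrite big_geq // big_ord0.
  have p2 : (0 < 2 ^ k)%N by rewrite expn_gt0.
  rewrite big_ord_recr /= (big_cat_nat (n := (2 ^ k).-1)) //=; last by rewrite expnS; lia.
  apply: lerD => //.
  apply: (@le_trans _ _ (\sum_((2 ^ k).-1 <= n < (2 ^ k.+1).-1) (2 ^ k)%:R `^ (- beta))).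
    apply: ler_sum_nat => n /andP[kn _].
    rewrite !powRN lef_pV2 ?posrE ?powR_gt0 ?ltr0n //.
    rewrite ge0_ler_powR ?nnegrE ?ler0n ?(ltW (lt_trans ltr01 b1)) // ler_nat; lia.
  rewrite big_const_nat iter_addr_0.
  have -> : ((2 ^ k.+1).-1 - (2 ^ k).-1 = 2 ^ k)%N by rewrite expnS; lia.
  have E2 : (2 ^ k)%:R = 2 `^ k%:R :> R by rewrite natrX powR_mulrn.
  rewrite -[leLHS]mulr_natl E2 -powRrM -powRD; last by rewrite pnatr_eq0 implybT.
  rewrite -powR_mulrn ?powR_ge0 // /x -powRrM.
  by rewrite le_eqVlt; apply/orP; left; apply/eqP; congr powR; ring.
exists (1 - x)^-1 => N.
apply: le_trans (sum_geometric_le N _); last by rewrite x0.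
apply: le_trans (dyadic N).
rewrite -(big_mkord xpredT (fun n => n.+1%:R `^ (- beta))).
have NN : (N <= (2 ^ N).-1)%N by have := ltn_expl N (isT : 1 < 2)%N; lia.
rewrite [leRHS](big_cat_nat (n := N)) //= lerDl.
by apply: sumr_ge0 => n _; exact: powR_ge0.
Qed.

End FiniteSums.

(** * Packing measure *)

Section PackingMeasure.
Context {R : realType} {n : nat}.
Local Notation E := 'rV[R]_n.
Implicit Types (A B : set E) (t delta : R).

Lemma packing_delta_ge0 t delta A : (0 <= packing_delta t delta A)%E.
Proof.
apply: le_ereal_sup_tmp; exists 0%E => //.
exists set0, (fun=> 0), (fun=> 0); split; last by rewrite esum_set0.
by split.
Qed.

Lemma packing_pre_ge0 t A : (0 <= packing_pre t A)%E.
Proof. by apply: le_ereal_inf_tmp => _ [delta _ <-]; exact: packing_delta_ge0. Qed.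

Lemma packing_delta_le t delta A (C : R) :
  (forall (D : set nat) (x : nat -> E) (rad : nat -> R) (F : seq nat),
    is_packing delta A D x rad -> uniq F -> (forall i, i \in F -> D i) ->
    \sum_(i <- F) (2 * rad i) `^ t <= C) ->
  (packing_delta t delta A <= C%:E)%E.
Proof.
move=> HC; apply: ge_ereal_sup => _ [D [x [rad [pack ->]]]].
apply: ge_ereal_sup => _ [X [finX XD] <-].
rewrite fsbig_finite // sumEFin lee_fin; apply: HC pack _ _; first exact: finmap.fset_uniq.
by move=> i; rewrite in_fset_set // => /set_mem /XD.
Qed.

Lemma packing_delta_ge t delta A (D : set nat) (x : nat -> E) (rad : nat -> R) (F : seq nat) :
  is_packing delta A D x rad -> uniq F -> (forall i, i \in F -> D i) ->
  ((\sum_(i <- F) (2 * rad i) `^ t)%:E <= packing_delta t delta A)%E.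
Proof.
move=> pack uF FD; apply: le_ereal_sup_tmp; eexists.
  by exists D, x, rad; split; [exact: pack|reflexivity].
apply: esum_ge; exists [set` F]; first by split; [exact: finite_seq|exact: FD].
rewrite -sumEFin (fsbig_seq _ _ uF) //.
Qed.

Lemma packing_pre_set0 t : packing_pre t (set0 : set E) = 0%E.
Proof.
apply/eqP; rewrite eq_le packing_pre_ge0 andbT.
apply: ge_ereal_inf; exists (packing_delta t 1 (set0 : set E)); first by exists 1 => //=.
apply: packing_delta_le => D x rad [|i F] [pack _] _ FD; first by rewrite big_nil.
by have [] := pack i (FD i (mem_head _ _)).
Qed.

Lemma packing_measure_ge0 t A : (0 <= packing_measure t A)%E.
Proof.
apply: le_ereal_inf_tmp => _ [B _ <-]; apply: esum_ge0 => k _; exact: packing_pre_ge0.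
Qed.

Lemma packing_measure_le_pre t A : (packing_measure t A <= packing_pre t A)%E.
Proof.
apply: ge_ereal_inf; eexists.
  exists (fun k => match k return set E with 0%N => A | _ => set0 end); last by reflexivity.
  by move=> x Ax; exists 0%N.
rewrite -nneseries_esumT => [|k]; last exact: packing_pre_ge0.
rewrite nneseries_recl => [||//]; last by move=> k _; exact: packing_pre_ge0.
rewrite eseries0 ?adde0 // => -[|k] // _ _; exact: packing_pre_set0.
Qed.

(** Already the premeasure vanishes: at scale delta each term gains the factor delta^(t - t') over
    its t'-th power, whose sums are bounded. *)
Lemma packing_measure_eq0 t t' (C : R) A : 0 < t - t' ->
  (forall (D : set nat) (x : nat -> E) (rad : nat -> R) (F : seq nat),
    is_packing 1 A D x rad -> uniq F -> (forall i, i \in F -> D i) ->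
    \sum_(i <- F) (2 * rad i) `^ t' <= C) ->
  packing_measure t A = 0%E.
Proof.
move=> tt HC; apply/eqP; rewrite eq_le packing_measure_ge0 andbT.
apply: le_trans (packing_measure_le_pre _ _) _.
apply/lee_addgt0Pr => eps eps0; rewrite add0e.
have C0 : 0 <= C.
  have := HC set0 (fun=> 0) (fun=> 0) [::]; rewrite big_nil; apply=> //.
  by split.
pose c := eps / (C + 1).
have C1 : 0 < C + 1 by rewrite ltr_wpDl.
have c0 : 0 < c by rewrite divr_gt0.
pose delta := Num.min 1 (c `^ (t - t')^-1).
have delta0 : 0 < delta by rewrite lt_min ltr01 powR_gt0.
have delta1 : delta <= 1 by rewrite ge_min lexx.
apply: ge_ereal_inf; exists (packing_delta t delta A); first by exists delta.
apply: packing_delta_le => D x rad F pack uF FD.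
have pack1 : is_packing 1 A D x rad.
  by split; [move=> i /pack.1[Ax r0 rd]; split=> //; exact: le_trans rd delta1|exact: pack.2].
apply: (@le_trans _ _ (\sum_(i <- F) c * (2 * rad i) `^ t')).
  rewrite big_seq [leRHS]big_seq; apply: ler_sum => i /FD /pack.1[_ r0 rd].
  have r20 : 0 < 2 * rad i by rewrite mulr_gt0.
  have -> : (2 * rad i) `^ t = (2 * rad i) `^ (t - t') * (2 * rad i) `^ t'.
    by rewrite -powRD ?subrK // (gt_eqF r20) implybT.
  rewrite ler_wpM2r ?powR_ge0 //.
  have rc : 2 * rad i <= c `^ (t - t')^-1 by rewrite (le_trans rd) // ge_min lexx orbT.
  have := ge0_ler_powR (ltW tt) _ _ rc.
  rewrite -powRrM mulVf ?gt_eqF // powRr1 ?(ltW c0) //; apply; rewrite nnegrE ?powR_ge0 //.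
  exact: ltW.
rewrite -mulr_sumr; apply: (@le_trans _ _ (c * C)).
  by rewrite ler_pM2l //; exact: HC pack1 uF FD.
by rewrite /c mulrAC ler_pdivrMr // ler_pM2l // lerDl.
Qed.

Lemma packing_measure_mono t t' A : t' <= t ->
  (packing_measure t A <= packing_measure t' A)%E.
Proof.
move=> tt; apply: le_ereal_inf_tmp => _ [B AB <-].
apply: ge_ereal_inf; exists (\esum_(k in [set: nat]) packing_pre t (B k))%E; first by exists B.
apply: le_esum => k _; apply: le_ereal_inf_tmp => _ [delta /= d0 <-].
apply: ge_ereal_inf; exists (packing_delta t (Num.min delta 1) (B k)).
  by exists (Num.min delta 1) => //=; rewrite lt_min d0 ltr01.
apply: ge_ereal_sup => _ [D [x [rad [pack ->]]]].
apply: le_ereal_sup_tmp; exists (\esum_(i in D) ((2 * rad i) `^ t')%:E)%E.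
  exists D, x, rad; split=> //; split; last exact: pack.2.
  by move=> i /pack.1[? ? rd]; split=> //; rewrite (le_trans rd) // ge_min lexx.
apply: le_esum => i /pack.1[_ r0 rd]; rewrite lee_fin ger_powR // mulr_gt0 //=.
by rewrite (le_trans rd) // ge_min lexx orbT.
Qed.

End PackingMeasure.

(** * Vanishing of the packing measure above the dimension *)

Section PackingUpper.
Context {R : realType} {T : nat}.
Local Notation I := (nat * 'I_T)%type.
Local Notation E := 'rV[R]_2.
Context {s : I -> E -> E} {r : seq I -> R} {K a theta : R}.
Local Notation wm := (word_map s).
Local Notation J := (limit_set closed_disk s).
Hypothesis S : bilip_system s r K a theta.
Variables (gamma k2 : R) (j0 : 'I_T).
Hypotheses (gamma1 : 1 <= gamma) (k20 : 0 < k2).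
Local Notation rate := (rate gamma).
Hypothesis s_up : forall p x, closed_disk x -> enorm (s p x) <= k2 * rate p.1.

Let K0 : 0 < K. Proof. exact: sys_K0 S. Qed.
Let r0 w : 0 <= r w. Proof. exact: ltW (sys_r0 S w). Qed.

(** The words of length k form an antichain, with h-sum at most K^h, and r w^(t - h) <= theta^((t -
    h) k) makes the sum over k geometric. *)
Lemma words_sum_bounded (h t : R) : hausdorff_dim J = h%:E -> h < t ->
  exists2 C : R, 0 <= C & forall U : seq (seq I), uniq U -> \sum_(u <- U) r u `^ t <= C.
Proof.
move=> dimJ ht; have h0 : 0 <= h by rewrite -lee_fin -dimJ hausdorff_dim_ge0.
pose x := theta `^ (t - h).
have x0 : 0 < x by rewrite powR_gt0 ?(sys_theta0 S).
have x1 : x < 1.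
  apply: powR_lt1; rewrite ?subr_gt0 //.
  by rewrite (ltW (sys_theta0 S)) (sys_theta1 S).
have Kh1 : 1 <= K `^ h.
  have := ge0_ler_powR h0 _ _ (sys_K1 S).
  by rewrite powR1; apply; rewrite nnegrE // ltW.
exists (K `^ h / (1 - x)).
  by rewrite divr_ge0 ?powR_ge0 // subr_ge0 ltW.
move=> U uU.
pose N := \max_(u <- U) size u.
have sizeN u : u \in U -> size u \in iota 0 N.+1.
  by move=> uU'; rewrite mem_iota /= add0n ltnS; exact: leq_bigmax_seq.
rewrite (sum_fibers _ (iota_uniq 0 N.+1) sizeN).
have level k : \sum_(u <- U | size u == k) r u `^ t <= K `^ h * x ^+ k.
  apply: (@le_trans _ _ (\sum_(u <- U | size u == k) r u `^ h * x ^+ k)).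
    apply: ler_sum => u /eqP uk.
    have -> : r u `^ t = r u `^ h * r u `^ (t - h).
      rewrite -powRD; last by rewrite (gt_eqF (sys_r0 S u)) implybT.
      by congr powR; ring.
    rewrite ler_wpM2l ?powR_ge0 // /x -powR_mulrn ?powR_ge0 //.
    rewrite -powRrM mulrC powRrM powR_mulrn ?(ltW (sys_theta0 S)) //.
    apply: ge0_ler_powR; rewrite ?nnegrE ?subr_ge0 ?(ltW ht) //.
      by rewrite exprn_ge0 // ltW // (sys_theta0 S).
    by rewrite -uk; exact: (sys_r_theta S).
  rewrite -mulr_suml ler_wpM2r ?exprn_ge0 ?(ltW x0) // -big_filter.
  case: k => [|k].
    have -> : \sum_(u <- [seq u <- U | size u == 0%N]) r u `^ h =
        \sum_(u <- [seq u <- U | size u == 0%N]) 1.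
      rewrite big_seq [RHS]big_seq; apply: eq_bigr => u.
      by rewrite mem_filter size_eq0 => /andP[/eqP-> _]; rewrite (sys_r_nil S) powR1.
    rewrite big_const_seq count_predT iter_addr_0; apply: le_trans Kh1.
    rewrite -[leRHS]/(1%:R) ler_nat.
    have sub : {subset [seq u <- U | size u == 0%N] <= [:: [::]]}.
      by move=> u; rewrite mem_filter size_eq0 inE => /andP[].
    by have := uniq_leq_size (filter_uniq _ uU) sub.
  apply: (antichain_sum S dimJ); first exact: filter_uniq.
    by move=> u; rewrite mem_filter -size_eq0 => /andP[/eqP->].
  move=> u v; rewrite !mem_filter => /andP[/eqP su _] /andP[/eqP sv _].
  by apply: (incomparable_size S); rewrite su sv.
apply: (@le_trans _ _ (\sum_(k <- iota 0 N.+1) K `^ h * x ^+ k)).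
  by apply: ler_sum => k _; exact: level.
rewrite -mulr_sumr ler_wpM2l ?powR_ge0 //.
rewrite -[N.+1]subn0 -/(index_iota 0 N.+1) big_mkord.
by apply: sum_geometric_le; rewrite x0.
Qed.

(** The address of x is cut at the first prefix whose ratio drops below [rad]; the last letter is
    kept apart because its cylinder may be far smaller than the ball. *)
Lemma ball_address x (rad : R) : J x -> 0 < rad -> rad < 1 ->
  exists up : seq I * I, [/\ rad <= r up.1, r (up.1 ++ [:: up.2]) < rad &
    (wm (up.1 ++ [:: up.2]) @` closed_disk) x].
Proof.
move=> /(limit_setP S)[om hom] rad0 rad1.
have ex : exists N, r (mkseq om N) < rad.
  have [N] := geometric_eps S 1 rad0; rewrite mul1r => h; exists N.
  by apply: le_lt_trans h; rewrite (le_trans (sys_r_theta S _)) // size_mkseq.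
case: (ex_minnP ex) => -[|N] rN minN.
  by move: rN; rewrite /= (sys_r_nil S) ltNge (ltW rad1).
have mkS : mkseq om N.+1 = mkseq om N ++ [:: om N].
  by rewrite cats1 -mkseqS.
exists (mkseq om N, om N); rewrite /= -mkS; split=> //; last exact: hom.
by rewrite leNgt; apply/negP => /minN; rewrite ltnn.
Qed.

(** The balls are grouped by the word v of their address. At most one of them contains the centre of
    the cylinder of v, whence the 1 in [C3]. The others are grouped by next letter q: boundedly many
    for each q, of radius at most K k2 r v * rate q, and the t-th powers of the rates are summable
    since gamma t > 1. *)
Lemma packing_sum_bounded (h t : R) : hausdorff_dim J = h%:E -> h < t -> 1 < gamma * t ->
  exists C : R, forall (D : set nat) (x : nat -> E) (rad : nat -> R) (F : seq nat),
    is_packing 1 J D x rad -> uniq F -> (forall i, i \in F -> D i) ->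
    \sum_(i <- F) (2 * rad i) `^ t <= C.
Proof.
move=> dimJ ht gt1.
have [C1 C10 HC1] := words_sum_bounded dimJ ht.
have [C2 HC2] := sum_powR_bounded gt1.
have t0 : 0 < t.
  by apply: le_lt_trans ht; rewrite -lee_fin -dimJ hausdorff_dim_ge0.
pose B := Num.bound (2 * K); pose CB : R := ((4 * B + 1) ^ 2)%:R.
have HB : 2 * K <= B%:R.
  by apply/ltW/archi_boundP; rewrite mulr_ge0 // ltW.
pose C3 := 1 + CB * (K * k2) `^ t * (T%:R * C2).
exists (2 `^ t * (C3 * C1)) => D x rad F [pack1 pack2] uF FD.
have radP i : i \in F -> [/\ J (x i), 0 < rad i & rad i < 1].
  by move=> /FD /pack1[Jx r1 r2]; split=> //; lra.
have disj i j y : i \in F -> j \in F -> enorm (y - x i) <= rad i ->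
    enorm (y - x j) <= rad j -> i = j.
  by move=> iF jF yi yj; apply: pack2; [exact: FD|exact: FD|exists y].
have /choice[adr Hadr] : forall i, exists up : seq I * I, i \in F ->
    [/\ rad i <= r up.1, r (up.1 ++ [:: up.2]) < rad i &
      (wm (up.1 ++ [:: up.2]) @` closed_disk) (x i)].
  move=> i; have [iF|iF] := boolP (i \in F).
    by have [Jx r1 r2] := radP i iF; have [up Hup] := ball_address Jx r1 r2; exists up.
  by exists ([::], (0%N, j0)).
pose u i := (adr i).1; pose p i := (adr i).2.
have radu i : i \in F -> rad i <= r (u i) by move=> /Hadr[].
rewrite (eq_big_seq (fun i => 2 `^ t * rad i `^ t)); last first.
  by move=> i /radP[_ /ltW ri _]; rewrite powRM.
pose V := undup [seq u i | i <- F].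
have FV i : i \in F -> u i \in V by move=> iF; rewrite mem_undup; apply/mapP; exists i.
rewrite -mulr_sumr ler_pM2l ?powR_gt0 // (sum_fibers _ (undup_uniq _) FV).
have C20 : 0 <= C2 by have := HC2 0%N; rewrite big_ord0.
have C30 : 0 <= C3 by rewrite addr_ge0 // !mulr_ge0 ?powR_ge0.
apply: (@le_trans _ _ (\sum_(v <- V) C3 * r v `^ t)); last first.
  by rewrite -mulr_sumr ler_wpM2l // HC1 // undup_uniq.
apply: ler_sum => v _.
(* A ball missing [wm v 0] has radius below the distance from its centre to that point, and s_q maps
   the disk to within k2 * rate q of 0. *)
pose near i := enorm (wm v 0 - x i) <= rad i.
rewrite -big_filter (bigID near) /= mulrDl mul1r; apply: lerD.
  rewrite -big_filter; set G := [seq _ <- _ | _].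
  have GP i : i \in G -> [/\ i \in F, u i = v & near i].
    by rewrite !mem_filter => /andP[ni /andP[/eqP uv iF]].
  have uG : uniq G by rewrite !filter_uniq.
  case EG : G => [|i [|j G']]; rewrite EG in GP uG.
  - by rewrite big_nil powR_ge0.
  - rewrite big_seq1; have [iF <- _] := GP i (mem_head _ _).
    have [_ /ltW ri _] := radP i iF.
    by apply: ge0_ler_powR; rewrite ?nnegrE ?(ltW t0) // radu.
  - have [iF _ ni] := GP i (mem_head _ _).
    have [jF _ nj] : [/\ j \in F, u j = v & near j] by apply: GP; rewrite !inE eqxx orbT.
    by move: uG; rewrite (disj _ _ _ iF jF ni nj) /= mem_head.
rewrite -big_filter; set G := [seq _ <- _ | _].
have GP i : i \in G -> [/\ i \in F, u i = v & ~~ near i].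
  by rewrite !mem_filter => /andP[ni /andP[/eqP uv iF]].
have uG : uniq G by rewrite !filter_uniq.
pose N := (\max_(i <- F) (p i).1).+1.
have GN i : i \in G -> p i \in letters 0 N.
  by move=> /GP[iF _ _]; rewrite mem_letters /= ltnS; exact: leq_bigmax_seq.
rewrite (sum_fibers _ (letters_uniq 0 N) GN).
have fiber (q : I) : \sum_(i <- G | p i == q) rad i `^ t <=
    CB * ((K * k2) `^ t * r v `^ t * rate q.1 `^ t).
  rewrite -big_filter; set H := [seq _ <- _ | _].
  have HP i : i \in H -> [/\ i \in F, u i = v, p i = q & ~~ near i].
    by rewrite mem_filter => /andP[/eqP pq /GP[iF uv ni]].
  have radH i : i \in H -> rad i `^ t <= (K * k2) `^ t * r v `^ t * rate q.1 `^ t.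
    move=> /HP[iF uv pq]; rewrite -ltNge => far.
    have [_ _ [y Xy xy]] := Hadr i iF; have [_ /ltW ri _] := radP i iF.
    rewrite -!powRM ?mulr_ge0 ?(ltW K0) ?(ltW k20) ?powR_ge0 //.
    apply: ge0_ler_powR; rewrite ?nnegrE ?(ltW t0) ?mulr_ge0 ?(ltW K0) ?(ltW k20) ?powR_ge0 //.
    apply: le_trans (ltW far) _.
    rewrite edistC -xy word_map_cat -/(u i) -/(p i) uv pq.
    apply: le_trans (sys_up S v (sys_disk S q Xy) closed_disk0) _.
    have -> : K * k2 * r v * rate q.1 = K * r v * (k2 * rate q.1) by ring.
    by rewrite ler_wpM2l ?mulr_ge0 ?(ltW K0) // subr0 s_up.
  apply: (@le_trans _ _ (\sum_(i <- H) (K * k2) `^ t * r v `^ t * rate q.1 `^ t)).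
    by rewrite big_seq [leRHS]big_seq; apply: ler_sum => i /radH.
  rewrite big_const_seq count_predT iter_addr_0 -mulr_natl.
  rewrite ler_wpM2r ?mulr_ge0 ?powR_ge0 // ler_nat.
  (* All these radii exceed r (v ++ [:: q]), so disjointness separates the centres by that amount,
     while they all lie in this one cylinder. *)
  apply: (@separated_count _ _ _ x (wm (v ++ [:: q]) 0) (r (v ++ [:: q]))).
  - exact: (sys_r0 S).
  - by rewrite !filter_uniq.
  - move=> i /HP[iF uv pq _]; have [_ _ [y Xy <-]] := Hadr i iF.
    rewrite -/(u i) -/(p i) uv pq; apply: le_trans (word_map_dist S _ Xy closed_disk0) _.
    by rewrite ler_wpM2r.
  - move=> i j /HP[iF uv pq _] /HP[jF _ _ _]; apply: contraNT; rewrite -ltNge => near_ij.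
    have [_ ri _] := Hadr i iF; rewrite -/(u i) -/(p i) uv pq in ri.
    have [_ /ltW rj _] := radP j jF.
    apply/eqP; apply: (disj _ _ (x j) iF jF); last by rewrite subrr enorm0.
    by rewrite edistC ltW // (lt_trans near_ij).
apply: le_trans (ler_sum _ (fun q _ => fiber q)) _.
rewrite -mulr_sumr -mulr_sumr.
have -> : CB * (K * k2) `^ t * (T%:R * C2) * r v `^ t =
    CB * ((K * k2) `^ t * r v `^ t * (T%:R * C2)) by ring.
rewrite ler_wpM2l // ler_wpM2l ?mulr_ge0 ?powR_ge0 //.
rewrite (sum_letters 0 N (fun n => rate n `^ t)) ler_wpM2l // big_mkord.
apply: le_trans (HC2 N); apply: ler_sum => n _.
by rewrite -powRrM mulNr.
Qed.

Lemma packing_measure_limit_set_eq0 (h t : R) : hausdorff_dim J = h%:E ->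
  1 / gamma < h -> h < t -> packing_measure t J = 0%E.
Proof.
move=> dimJ gh ht.
have gamma0 : 0 < gamma by exact: lt_le_trans ltr01 gamma1.
pose t' := (h + t) / 2.
have ht' : h < t' by rewrite /t'; lra.
have t't : 0 < t - t' by rewrite /t'; lra.
have gt'1 : 1 < gamma * t'.
  by rewrite mulrC -ltr_pdivrMr // (lt_trans gh).
have [C HC] := packing_sum_bounded dimJ ht' gt'1.
apply: (packing_measure_eq0 t't) => D x rad F pack uF FD.
exact: HC pack uF FD.
Qed.

End PackingUpper.

(** * Infinite packing measure *)

Section PackingInfinite.
Context {R : realType} {T : nat}.
Local Notation I := (nat * 'I_T)%type.
Local Notation E := 'rV[R]_2.
Context {s : I -> E -> E} {r : seq I -> R} {K a theta : R}.
Local Notation wm := (word_map s).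
Local Notation J := (limit_set closed_disk s).
Hypothesis S : bilip_system s r K a theta.
Variables (gamma k1 k2 : R) (j0 : 'I_T).
Hypotheses (gamma1 : 1 <= gamma) (k10 : 0 < k1) (k20 : 0 < k2).
Local Notation rate := (rate gamma).
Hypothesis r_up : forall p, r [:: p] <= k2 * rate p.1 ^+ 2.
Hypothesis s_low : forall p x, closed_disk x -> k1 * rate p.1 <= enorm (s p x).
Hypothesis s_up : forall p x, closed_disk x -> enorm (s p x) <= k2 * rate p.1.

Local Notation head M := (letters 0 M : seq I).
Local Notation Sum M t m := (\sum_(k < m) cylinder_sum (r := r) (head M) t k).

Let gamma0 : 0 < gamma. Proof. exact: lt_le_trans ltr01 gamma1. Qed.
Let K0 : 0 < K. Proof. exact: sys_K0 S. Qed.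

(* Otherwise nested cylinders avoiding the sets [B k] one after the other would
   lead to a point of J outside all of them. *)
Lemma limit_set_baire (B : nat -> set E) : J `<=` \bigcup_k B k ->
  exists k u, forall w, exists2 x, B k x & (wm (u ++ w) @` closed_disk) x.
Proof.
move=> JB; apply: contrapT => no.
have /choice[f Hf] : forall ku : nat * seq I, exists w,
    forall x, B ku.1 x -> ~ (wm (ku.2 ++ w) @` closed_disk) x.
  move=> [k u]; apply: contrapT => now; apply: no; exists k, u => w.
  apply: contrapT => nox; apply: now; exists w => x Bx xw.
  by apply: nox; exists x.
pose i0 : I := (0%N, j0).
pose v := fix v k := if k is k'.+1 then v k' ++ (f (k', v k') ++ [:: i0]) else [::].
have [x Jx xv] : exists2 x, J x & forall k, (wm (v k) @` closed_disk) x.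
  apply: (chain_point S) => // k; exists (f (k, v k) ++ [:: i0]) => //.
  by rewrite -size_eq0 size_cat addn1.
have [k _ Bx] := JB x Jx.
have [y Xy] := xv k.+1; rewrite /= catA word_map_cat => xy.
by apply: (Hf (k, v k) x Bx); exists (wm [:: i0] y) => //; exact: (word_map_disk S).
Qed.

Lemma comparable_words (u v : seq I) :
  [\/ exists w, v = u ++ w, exists w, u = v ++ w | incomparable (s := s) u v].
Proof.
elim: u v => [|i u IH] [|j v]; [constructor 1|constructor 1|constructor 2|].
- by exists [::].
- by exists (j :: v).
- by exists (i :: u).
have [<-|ij] := eqVneq i j; last by constructor 3; exact: (incomparable_cons S).
have [[w ->]|[w ->]|uv] := IH v.
- by constructor 1; exists w.
- by constructor 2; exists w.
- by constructor 3; rewrite -(cat1s i u) -(cat1s i v); exact: (incomparable_catl S).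
Qed.

(* The packing uses, for each word [w] over the letters below [M], a ball of
   radius comparable to the distance between its centre, in the cylinder of
   [u0 w p], and the accumulation point of the cylinder of [u0 w]; here [p] is one
   letter far beyond [M]. *)
Lemma packing_delta_dense (h delta C : R) (A : set E) u0 : hausdorff_dim J = h%:E ->
  1 / gamma < h -> 0 < delta ->
  (forall w, exists2 x, A x & (wm (u0 ++ w) @` closed_disk) x) ->
  (C%:E <= packing_delta h delta A)%E.
Proof.
move=> dimJ gh delta0 dense.
have h0 : 0 <= h by rewrite -lee_fin -dimJ hausdorff_dim_ge0.
have T0 : 0 < T%:R :> R by rewrite ltr0n; case: (T) j0 => // -[].
have ng0 : - gamma < 0 by rewrite oppr_lt0.
(* The ball of w stays within c * rate ns * r (u0 ++ w) of [wm (u0 ++ w) 0]: K * k2 accounts for its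
   centre, 1 for its radius. *)
pose c := K * k2 + 1.
have c0 : 0 < c by rewrite addr_gt0 // mulr_gt0.
(* The extra letter has index about Bn M. As gamma >= 1, its rate is at most M^(-gamma) / Bn, small
   enough to keep the ball of w off the cylinders of the letters below M. *)
pose Bn := (Num.bound (K * c / k1)).+1.
have BnR : 0 < Bn%:R :> R by rewrite ltr0n.
have HBn : c / Bn%:R < k1 / K.
  have z0 : 0 <= K * c / k1 by rewrite !mulr_ge0 ?invr_ge0 // ltW.
  have := archi_boundP z0; rewrite ltr_pdivrMr // => hb.
  rewrite ltr_pdivrMr // mulrAC ltr_pdivlMr // mulrC [ltRHS]mulrC.
  apply: lt_trans hb _; rewrite ltr_pM2r // ltr_nat //.
have KT0 : 0 < (K ^+ 4) `^ h * T%:R * k2 `^ h by rewrite !mulr_gt0 ?powR_gt0 ?exprn_gt0.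
pose Q := (K ^+ 4) `^ h * T%:R * k2 `^ h.
pose D := (r u0 / K ^+ 3 * Bn%:R `^ (- gamma)) `^ h.
have D0 : 0 < D by rewrite powR_gt0 // !mulr_gt0 ?powR_gt0 ?invr_gt0 ?exprn_gt0 ?(sys_r0 S).
have q0 : 0 < gamma * h - 1 by rewrite subr_gt0 mulrC -ltr_pdivrMr.
(* [M1] makes the final sum reach C; [M2] keeps each ball inside the cylinder of its word and its
   diameter below delta. *)
have [M1 HM1] := powR_large (C * (2 * Q) / D) q0.
have m0 : 0 < Num.min (a / 2) (delta / 2) by rewrite lt_min !divr_gt0 ?(sys_a0 S).
have [M2 HM2] := powR_vanish ng0 (ltW c0) m0.
pose M := (maxn M1 M2).+1.
have {}HM1 : C * (2 * Q) / D <= M%:R `^ (gamma * h - 1).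
  by apply: HM1; rewrite ltnW // ltnS leq_maxl.
have {}HM2 : c * M%:R `^ (- gamma) <= Num.min (a / 2) (delta / 2).
  by apply: HM2 => //; rewrite ltnW // ltnS leq_maxr.
have M0R : 0 < M%:R :> R by rewrite ltr0n.
pose ns := (Bn * M).-1; pose ps : I := (ns, j0).
have rateE : rate ns = Bn%:R `^ (- gamma) * M%:R `^ (- gamma).
  by rewrite rate_def /ns prednK ?muln_gt0 // natrM powRM ?ler0n.
have rateB : rate ns <= Bn%:R^-1 * M%:R `^ (- gamma).
  rewrite rateE ler_pM2r ?powR_gt0 // powRN lef_pV2 ?posrE ?powR_gt0 //.
  by rewrite -[leLHS]powRr1 ?ler0n // ler_powR // ler1n.
have rate0 : 0 < rate ns by rewrite powR_gt0.
have rateM : rate ns <= M%:R `^ (- gamma).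
  by apply: le_trans rateB _; rewrite ler_piMl ?powR_ge0 // invf_le1 // ler1n.
have [m Hm] := prefix_sum_lower S j0 gamma1 k20 r_up s_up dimJ gh (isT : 0 < M)%N.
pose V := words_below (head M) m.
have uV : uniq V by rewrite words_below_uniq // letters_uniq.
have /choice[pt Hpt] : forall w, exists x, A x /\ (wm (u0 ++ w ++ [:: ps]) @` closed_disk) x.
  by move=> w; have [x Ax xw] := dense (w ++ [:: ps]); exists x.
pose rad w := r (u0 ++ w) * rate ns.
have rad0 w : 0 < rad w by rewrite mulr_gt0 ?(sys_r0 S).
have near w z : enorm (z - pt w) <= rad w ->
    enorm (z - wm (u0 ++ w) 0) <= c * rate ns * r (u0 ++ w).
  move=> zw; have [_ [y Xy yx]] := Hpt w.
  apply: le_trans (edist_triangle (pt w) _ _) _.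
  have -> : c * rate ns * r (u0 ++ w) = rad w + K * r (u0 ++ w) * (k2 * rate ns).
    by rewrite /c /rad; ring.
  apply: lerD => //; rewrite -yx catA word_map_cat.
  apply: le_trans (sys_up S _ (sys_disk S ps Xy) closed_disk0) _.
  rewrite subr0 ler_pM2l ?mulr_gt0 ?(sys_r0 S) //.
  exact: (s_up ps Xy).
have inside w z : enorm (z - pt w) <= rad w ->
    exists2 y, open_disk y & wm (u0 ++ w) y = z.
  move=> /near zw; apply: (sys_ball S); apply: le_lt_trans zw _.
  rewrite ltr_pM2r ?(sys_r0 S) //.
  apply: (@le_lt_trans _ _ (a / 2)); last by rewrite ltr_pdivrMr // ltr_pMr ?(sys_a0 S) // ltr1n.
  apply: (@le_trans _ _ (c * M%:R `^ (- gamma))); first by rewrite ler_pM2l.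
  by rewrite (le_trans HM2) // ge_min lexx.
(* The ball of an extension lies in the cylinder of u0 w q, at distance at least r (u0 ++ w) * k1 *
   rate q / K from [wm (u0 ++ w) 0]; the ball of w does not reach that far. *)
have away w q w' z : q \in head M -> enorm (z - pt w) <= rad w ->
    ~ enorm (z - pt (w ++ q :: w')) <= rad (w ++ q :: w').
  rewrite mem_letters /= => qM /near zw /inside[y Dy].
  rewrite -cat_rcons -cats1 !catA word_map_cat word_map_cat => yz.
  have Dy' : closed_disk (wm w' y) by apply: (word_map_disk S); exact: open_closed_disk.
  have := sys_low S (u0 ++ w) (sys_disk S q Dy') closed_disk0.
  rewrite subr0 -[s q _]/(wm [:: q] _) yz => low.
  have sq := s_low q Dy'.
  have : r (u0 ++ w) * (k1 * rate q.1) <= K * (c * rate ns * r (u0 ++ w)).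
    apply: (@le_trans _ _ (r (u0 ++ w) * enorm (wm [:: q] (wm w' y)))).
      by rewrite ler_pM2l ?(sys_r0 S).
    by apply: le_trans low _; rewrite ler_pM2l.
  have -> : K * (c * rate ns * r (u0 ++ w)) = r (u0 ++ w) * (K * c * rate ns) by ring.
  rewrite ler_pM2l ?(sys_r0 S) //; apply/negP; rewrite -ltNge.
  apply: (@lt_le_trans _ _ (k1 * M%:R `^ (- gamma))); last first.
    rewrite ler_pM2l // !rate_def !powRN lef_pV2 ?posrE ?powR_gt0 //.
    by rewrite ge0_ler_powR ?nnegrE ?ler0n ?(ltW gamma0) // ler_nat.
  apply: (@le_lt_trans _ _ (K * c * (Bn%:R^-1 * M%:R `^ (- gamma)))).
    by rewrite ler_pM2l // mulr_gt0.
  rewrite mulrA ltr_pM2r ?powR_gt0 //.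
  by rewrite -mulrA mulrC -ltr_pdivlMr.
have disj w w' z : w \in V -> w' \in V -> enorm (z - pt w) <= rad w ->
    enorm (z - pt w') <= rad w' -> w = w'.
  rewrite !mem_words_below => /andP[_ wM] /andP[_ w'M] zw zw'.
  have [[[|q x] e]|[[|q x] e]|inc] := comparable_words w w'.
  - by rewrite e cats0.
  - move: w'M; rewrite e all_cat /= => /and3P[_ qM _].
    by rewrite e in zw'; case: (away w q x z qM zw zw').
  - by rewrite e cats0.
  - move: wM; rewrite e all_cat /= => /and3P[_ qM _].
    by rewrite e in zw; case: (away w' q x z qM zw' zw).
  - have [y Dy yz] := inside _ _ zw; have [y' Dy' yz'] := inside _ _ zw'.
    by case: (incomparable_catl S (w := u0) inc Dy Dy'); rewrite yz yz'.
have pack : is_packing delta A [set i | (i < size V)%N]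
    (fun i => pt (nth [::] V i)) (fun i => rad (nth [::] V i)).
  split=> [i _|i j iV jV [z [zi zj]]].
    split; [exact: (Hpt _).1|exact: rad0|].
    rewrite mulrC -ler_pdivlMr //; apply: (@le_trans _ _ (c * M%:R `^ (- gamma))); last first.
      by rewrite (le_trans HM2) // ge_min lexx orbT.
    apply: ler_pM; rewrite ?(ltW rate0) ?(ltW (sys_r0 S _)) //.
    rewrite (le_trans (sys_r_le1 S _)) // /c lerDr mulr_ge0 // ltW //.
  have e := disj _ _ z (mem_nth _ iV) (mem_nth _ jV) zi zj.
  by apply/eqP; rewrite -(nth_uniq [::] iV jV uV) e.
apply: le_trans (packing_delta_ge h pack (iota_uniq 0 (size V)) _); last first.
  by move=> i; rewrite mem_iota.
rewrite lee_fin.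
have -> : \sum_(i <- iota 0 (size V)) (2 * rad (nth [::] V i)) `^ h =
    \sum_(w <- V) (2 * rad w) `^ h.
  by rewrite [RHS](big_nth [::]) /index_iota subn0.
apply: (@le_trans _ _ (\sum_(w <- V) (D * M%:R `^ (- gamma) `^ h) * r w `^ h)); last first.
  apply: ler_sum => w _.
  have rw := ltW (sys_r0 S w); have ru := ltW (sys_r0 S u0).
  rewrite -powRM ?powR_ge0 ?mulr_ge0 ?invr_ge0 ?exprn_ge0 ?(ltW K0) //.
  rewrite -powRM ?mulr_ge0 ?powR_ge0 ?invr_ge0 ?exprn_ge0 ?(ltW K0) //.
  apply: ge0_ler_powR; rewrite ?nnegrE ?mulr_ge0 ?powR_ge0 ?invr_ge0 ?exprn_ge0 ?(ltW K0)
    ?(ltW (sys_r0 S _)) ?(ltW rate0) ?ler0n //.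
  apply: (@le_trans _ _ (rad w)); last by rewrite ler_peMl ?ler1n // ltW.
  have -> : r u0 / K ^+ 3 * Bn%:R `^ (- gamma) * M%:R `^ (- gamma) * r w =
      r u0 * r w / K ^+ 3 * rate ns by rewrite rateE; ring.
  rewrite ler_pM2r // ler_pdivrMr ?exprn_gt0 // mulrC [leRHS]mulrC.
  by rewrite [X in X <= _]mulrC; exact: (sys_r_cat_ge S).
rewrite -mulr_sumr big_words_below.
move: Hm; rewrite -/Q.
set Sg := \sum_(k < m) _ => Hm.
have Sg0 : 0 <= Sg by apply: sumr_ge0 => k _; exact: cylinder_sum_ge0.
have Mh : M%:R `^ (gamma * h - 1) * M%:R `^ (1 - 2 * gamma * h) = M%:R `^ (- gamma) `^ h.
  rewrite -powRrM -powRD; last by rewrite (gt_eqF M0R) implybT.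
  by congr powR; ring.
have QQ : Q != 0 by rewrite gt_eqF.
have DQ : 0 < D / (2 * Q) by rewrite divr_gt0 // mulr_gt0.
have C1 : C <= D / (2 * Q) * M%:R `^ (gamma * h - 1).
  have -> : C = D / (2 * Q) * (C * (2 * Q) / D) by field; rewrite QQ gt_eqF.
  by rewrite ler_pM2l.
apply: le_trans C1 _.
(* [prefix_sum_lower] says 2 Sg Q Y >= 1, so it remains to exhibit this factor in the packing
   sum. *)
set Y := M%:R `^ (1 - 2 * gamma * h) in Hm Mh.
have Y0 : 0 < Y by rewrite powR_gt0.
rewrite -Mh -/Y.
have -> : D * (M%:R `^ (gamma * h - 1) * Y) * Sg =
    D / (2 * Q) * M%:R `^ (gamma * h - 1) * (2 * (Sg * (Q * Y))) by field.
by rewrite ler_peMr // mulr_ge0 ?powR_ge0 // ltW.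
Qed.

Lemma packing_measure_limit_set_pinfty (h : R) : hausdorff_dim J = h%:E ->
  1 / gamma < h -> packing_measure h J = +oo%E.
Proof.
move=> dimJ gh; apply/eqP; rewrite -leye_eq.
apply: le_ereal_inf_tmp => _ [B JB <-].
have [k [u dense]] := limit_set_baire JB.
have prey : packing_pre h (B k) = +oo%E.
  apply/eqP; rewrite -leye_eq; apply: le_ereal_inf_tmp => _ [delta /= d0 <-].
  rewrite leye_eq; apply/eqP/eqyP => C _.
  exact: packing_delta_dense dimJ gh d0 dense.
rewrite -prey; apply: esum_ge; exists [set k]; first by split; [exact: finite_set1|].
by rewrite fsbig_set1.
Qed.

End PackingInfinite.

(** * Finiteness of the Hausdorff dimension in the disk *)

Section DiskDimension.
Context {R : realType}.
Local Notation E := 'rV[R]_2.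

(** A crude grid cover, only meant to make the dimension a real number: at exponent 3, (2k + 1)^2 <=
    9 k^2 cells of diameter at most 2/k cost at most 72/k. *)
Lemma coverable_disk (k : nat) (A : set E) : (0 < k)%N -> A `<=` closed_disk ->
  coverable 3 (2 / k%:R) A (72 / k%:R).
Proof.
move=> k0 AX; have kR : 0 < k%:R :> R by rewrite ltr0n.
have k1 : 1 <= k%:R :> R by rewrite ler1n.
have v0 : 0 <= 2 / k%:R :> R by rewrite divr_ge0.
pose cell (x : E) (j : 'I_2) := Num.truncn ((x 0 j + 1) * k%:R).
pose l := [seq (i, j) | i <- iota 0 (2 * k + 1), j <- iota 0 (2 * k + 1)].
pose F (ij : nat * nat) := [set x | closed_disk x /\ (cell x 0 = ij.1 /\ cell x 1 = ij.2)].
have bnd (x : E) j : closed_disk x -> 0 <= (x 0 j + 1) * k%:R <= (2 * k)%:R.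
  move=> /closed_diskE x1; have := le_trans (norm_coord_le x j) x1.
  rewrite ler_norml => /andP[h1 h2]; rewrite natrM ler_pM2r //.
  by rewrite mulr_ge0 ?ler0n //=; lra.
have cov : coverable 3 (2 / k%:R) [set x | exists2 ij, ij \in l & F ij x]
    (\sum_(ij <- l) (2 / k%:R) `^ 3).
  apply: coverable_bigcup => // ij _; apply: coverable_diam => //; first by rewrite v0 lexx.
  move=> x y [Xx [x0 x1]] [Xy [y0 y1]].
  have near j : cell x j = cell y j -> `|(x - y) 0 j| <= 1 / k%:R.
    move=> e; have /andP[bx _] := bnd x j Xx; have /andP[by_ _] := bnd y j Xy.
    have := truncn_itv bx; have := truncn_itv by_; rewrite -/(cell x j) -/(cell y j) e.
    rewrite -natr1 => /andP[a1 a2] /andP[b1 b2].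
    rewrite ler_pdivlMr // !mxE -{1}(ger0_norm (ler0n _ k)) -normrM ler_norml.
    by apply/andP; split; lra.
  apply: le_trans (enorm_le_sum _) _.
  have -> : 2 / k%:R = 1 / k%:R + 1 / k%:R :> R by ring.
  by apply: lerD; apply: near; rewrite ?x0 ?x1.
apply: coverable_subset cov.
  move=> x /AX Xx; exists (cell x 0, cell x 1) => //.
  have cellP j : (cell x j < 2 * k + 1)%N.
    have /andP[b0 b1] := bnd x j Xx.
    by rewrite addn1 ltnS -(ler_nat R) (le_trans _ b1) // truncn_le.
  by apply/allpairsP; exists (cell x 0, cell x 1); rewrite !mem_iota /= !add0n !cellP.
rewrite big_const_seq count_predT size_allpairs !size_iota iter_addr_0 -[leLHS]mulr_natl.
rewrite powR_mulrn // ler_pdivlMr // natrM natrD natrM.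
have -> : (2 * k%:R + 1) * (2 * k%:R + 1) * (2 / k%:R) ^+ 3 * k%:R =
    8 * ((2 * k%:R + 1) / k%:R) ^+ 2 :> R by field; rewrite gt_eqF.
have h3 : (2 * k%:R + 1) / k%:R <= 3 :> R by rewrite ler_pdivrMr //; lra.
have h0 : 0 <= (2 * k%:R + 1) / k%:R :> R by rewrite divr_ge0 // addr_ge0 // mulr_ge0.
have : ((2 * k%:R + 1) / k%:R) ^+ 2 <= 3 ^+ 2 :> R by rewrite !expr2 ler_pM.
by lra.
Qed.

Lemma hausdorff_dim_disk (A : set E) : A `<=` closed_disk -> (hausdorff_dim A <= 3%:E)%E.
Proof.
move=> AX; apply: hausdorff_dim_le => //; apply: coverable_hausdorff0 => // delta eps d0 e0.
apply: (coverable_small (delta := 2)) d0 e0 => // {}eps {}e0.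
have := archi_boundP (divr_ge0 (ler0n R 72) (ltW e0)); set k := Num.bound _ => hk.
have k0 : 0 < k%:R :> R by apply: le_lt_trans hk; rewrite divr_ge0 // ltW.
have {}hk : 72 / k%:R <= eps.
  by rewrite ler_pdivrMr // mulrC -ler_pdivrMr // ltW.
apply: (@coverable_subset _ _ _ _ _ A (72 / k%:R)) => //.
apply: (@coverable_cap _ _ _ (2 / k%:R)) => //.
  by move=> x y /AX Xx /AX Xy; exact: closed_disk_dist.
by apply: coverable_disk => //; rewrite -(ltr_nat R).
Qed.

Lemma hausdorff_dim_disk_fin (A : set E) : A `<=` closed_disk ->
  exists h : R, hausdorff_dim A = h%:E.
Proof.
move=> /hausdorff_dim_disk; have := hausdorff_dim_ge0 A.
by case: (hausdorff_dim A) => // h _ _; exists h.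
Qed.

End DiskDimension.

Lemma calD_ge {R : realType} (d : nat -> R) n : calD d -> (1 <= n)%N -> 2 * n%:R <= d n.
Proof.
move=> [d1 dS]; elim: n => // -[|n] IH _; first by rewrite mulr1.
have := IH isT; have := dS n.+1 isT; rewrite -[n.+2%:R]natr1; lra.
Qed.

(** With a = N + 1, keeping the first term and telescoping the others gives in the limit 1/a^2 +
    1/(a+1) = 1/a + 1/(a^2 (a+1)); L is so large that the remainder 1/(L+2) stays below this
    excess. *)
Lemma sum_inv_square_gt (R : realType) (N : nat) : (0 < N)%N -> exists L : nat,
  1 < (N%:R + 1) * \sum_(N.-1 <= n < L) ((n.+2%:R : R) ^+ 2)^-1.
Proof.
case: N => // N _ /=; pose a : R := N.+2%:R.
have a0 : 0 < a by rewrite ltr0n.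
exists (N.+2 ^ 2 * N.+3 + N.+1)%N; set L := (_ + N.+1)%N.
have NL : (N < L)%N by rewrite /L; lia.
rewrite big_ltn //.
have step n : n.+2%:R^-1 - n.+3%:R^-1 <= ((n.+2%:R : R) ^+ 2)^-1.
  have n2 : 0 < n.+2%:R :> R by rewrite ltr0n.
  have n3 : 0 < n.+3%:R :> R by rewrite ltr0n.
  have -> : n.+2%:R^-1 - n.+3%:R^-1 = (n.+2%:R * n.+3%:R)^-1 :> R.
    rewrite -[n.+3%:R]natr1 in n3 *; move: n2 n3; set x := n.+2%:R => x0 x1.
    by field; rewrite !gt_eqF.
  by rewrite lef_pV2 ?posrE ?exprn_gt0 ?mulr_gt0 // expr2 ler_pM2l // ler_nat.
have tele : N.+3%:R^-1 - L.+2%:R^-1 <= \sum_(N.+1 <= n < L) ((n.+2%:R : R) ^+ 2)^-1.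
  have -> : N.+3%:R^-1 - L.+2%:R^-1 = \sum_(N.+1 <= n < L) (n.+2%:R^-1 - n.+3%:R^-1) :> R.
    rewrite -opprB -(telescope_sumr (fun n => n.+2%:R^-1) NL) -sumrN.
    by apply: eq_bigr => n _; rewrite opprB.
  by apply: ler_sum_nat => n _; exact: step.
have aN : N.+1%:R + 1 = a by rewrite natr1.
have L0 : 0 < L.+2%:R :> R by rewrite ltr0n.
have a1 : 0 < a + 1 by rewrite addr_gt0.
have hL : L.+2%:R^-1 < (a ^+ 2 * (a + 1))^-1.
  rewrite ltf_pV2 ?posrE ?mulr_gt0 ?exprn_gt0 //.
  have -> : a ^+ 2 * (a + 1) = (N.+2 ^ 2 * N.+3)%:R by rewrite natrM natrX -(natr1 N.+2).
  by rewrite ltr_nat /L; lia.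
rewrite aN -/a; have aN3 : N.+3%:R = a + 1 by rewrite natr1.
rewrite aN3 in tele.
apply: (@lt_le_trans _ _ (a * ((a ^+ 2)^-1 + ((a + 1)^-1 - L.+2%:R^-1)))); last first.
  by rewrite ler_pM2l // lerD2l.
have e : a * ((a ^+ 2)^-1 + ((a + 1)^-1 - (a ^+ 2 * (a + 1))^-1)) = 1.
  by field; rewrite !gt_eqF.
by rewrite -{1}e ltr_pM2l // ltrD2l ltrD2l ltrN2.
Qed.

(** * Lower bound for the dimension *)

Section DimensionAboveThreshold.
Context {R : realType} {T : nat}.
Local Notation I := (nat * 'I_T)%type.
Local Notation E := 'rV[R]_2.
Context {s : I -> E -> E} {r : seq I -> R} {K a theta : R}.
Local Notation J := (limit_set closed_disk s).
Hypothesis S : bilip_system s r K a theta.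
Variable d : nat -> R.
Hypothesis d_calD : calD d.
Hypothesis low : forall p x y, closed_disk x -> closed_disk y ->
  ((d p.1.+1 + 1) ^+ 2)^-1 * enorm (x - y) <= enorm (s p x - s p y).

(** The bound on T leaves no room for a distortion constant, so the exact lower Lipschitz constants
    (d + 1)^(-2) serve as [rho]. At exponent 1/gamma they are at least c2^(-2/gamma) times inverse
    squares of integers from N + 1 on. *)
Lemma hausdorff_dim_gt_inv (c2 gamma : R) (N : nat) : 1 <= gamma -> 0 < c2 -> (0 < N)%N ->
  (forall n, (N <= n)%N -> d n <= c2 * n%:R `^ gamma) ->
  c2 `^ (2 / gamma) * (N%:R + 1) <= T%:R ->
  ((1 / gamma)%:E < hausdorff_dim J)%E.
Proof.
move=> g1 c20 N0 growth HT; have g0 : 0 < gamma by exact: lt_le_trans ltr01 g1.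
have dpos n : 0 < d n.+1 + 1.
  by have := calD_ge d_calD (isT : (1 <= n.+1)%N); have := ler0n R n.+1; lra.
(* The added 1 is absorbed by shifting the index: with k = n + 1, d k >= 2 k forces c2 k^(gamma - 1)
   >= 2, so c2 k^gamma grows by at least 2 from k to k + 1. *)
have dgrow n : (N <= n.+1)%N -> d n.+1 + 1 <= c2 * n.+2%:R `^ gamma.
  move=> Nn; have n0 : 0 < n.+1%:R :> R by rewrite ltr0n.
  have split_pow : forall m : nat, m.+1%:R `^ gamma = m.+1%:R * m.+1%:R `^ (gamma - 1) :> R.
    move=> m; have m0 : 0 < m.+1%:R :> R by rewrite ltr0n.
    rewrite -{2}(powRr1 (ltW m0)) -powRD; last by rewrite (gt_eqF m0) implybT.
    by congr powR; ring.
  have h1 := growth _ Nn; have h2 := calD_ge d_calD (isT : (1 <= n.+1)%N).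
  set y := n.+1%:R `^ (gamma - 1).
  have y2 : 2 <= c2 * y.
    rewrite -(ler_pM2r n0); apply: le_trans h2 (le_trans h1 _).
    by rewrite split_pow -/y; rewrite mulrCA mulrC.
  have yy : y <= n.+2%:R `^ (gamma - 1).
    by rewrite /y ge0_ler_powR ?nnegrE ?ler0n ?subr_ge0 // ler_nat.
  apply: (@le_trans _ _ (c2 * (n.+2%:R * y))); last first.
    by rewrite split_pow ler_pM2l // ler_pM2l // ltr0n.
  rewrite split_pow -/y in h1.
  rewrite -natr1 mulrDl mul1r mulrDr; lra.
have [L HL] := @sum_inv_square_gt R N N0.
pose rho (w : seq I) : R := if w is p :: _ then ((d p.1.+1 + 1) ^+ 2)^-1 else 1.
apply: (@hausdorff_dim_gt R _ s r K a theta S [seq [:: p] | p <- letters N.-1 L] rho).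
- by rewrite divr_ge0 // ltW.
- by rewrite map_inj_uniq ?letters_uniq // => p q [].
- by move=> _ /mapP[p _ ->].
- by move=> _ _ /mapP[p _ ->] /mapP[q _ ->] pq; exact: (incomparable_size S).
- by case=> [|p w] //=; rewrite invr_gt0 exprn_gt0.
- by move=> _ /mapP[p _ ->] x y Xx Xy; exact: low.
rewrite big_map (sum_letters N.-1 L (fun n => (((d n.+1 + 1) ^+ 2)^-1) `^ (1 / gamma))).
have C0 : 0 < c2 `^ (2 / gamma) by rewrite powR_gt0.
apply: lt_le_trans HL _.
rewrite -(ler_pM2l C0) mulrA.
have sum0 : 0 <= \sum_(N.-1 <= n < L) (((d n.+1 + 1) ^+ 2)^-1) `^ (1 / gamma).
  by apply: sumr_ge0 => n _; exact: powR_ge0.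
apply: (@le_trans _ _ (T%:R * \sum_(N.-1 <= n < L) ((n.+2%:R : R) ^+ 2)^-1)).
  by rewrite ler_wpM2r // sumr_ge0 // => n _; rewrite invr_ge0 exprn_ge0.
rewrite mulrCA ler_wpM2l ?ler0n // mulr_sumr.
apply: ler_sum_nat => n /andP[Nn _].
have Nn1 : (N <= n.+1)%N by rewrite -(prednK N0) ltnS.
have n2 : 0 < n.+2%:R :> R by rewrite ltr0n.
rewrite powR_inv ?exprn_gt0 // -[c2 `^ _ / _]/(c2 `^ (2 / gamma) / _).
rewrite ler_pdivlMr ?powR_gt0 ?exprn_gt0 // mulrC ler_pdivrMr ?exprn_gt0 //.
have -> : c2 `^ (2 / gamma) * n.+2%:R ^+ 2 = ((c2 * n.+2%:R `^ gamma) ^+ 2) `^ (1 / gamma).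
  rewrite -[(c2 * _) ^+ 2]powR_mulrn ?mulr_ge0 ?powR_ge0 ?(ltW c20) // -powRrM.
  rewrite powRM ?powR_ge0 ?(ltW c20) // -powRrM -[_ ^+ 2]powR_mulrn ?(ltW n2) //.
  by congr (_ * _); congr powR; field; rewrite gt_eqF.
apply: ge0_ler_powR; rewrite ?nnegrE ?divr_ge0 ?exprn_ge0 ?mulr_ge0 ?powR_ge0
  ?(ltW g0) ?(ltW c20) ?(ltW (dpos n)) //.
by rewrite !expr2 ler_pM ?(ltW (dpos n)) ?dgrow.
Qed.

End DimensionAboveThreshold.

(** * Hausdorff and packing measures on either side of the threshold *)

Section Dichotomy.
Context {R : realType} {T : nat}.
Local Notation I := (nat * 'I_T)%type.
Local Notation E := 'rV[R]_2.
Context {s : I -> E -> E} {r : seq I -> R} {K a theta : R}.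
Local Notation J := (limit_set closed_disk s).
Hypothesis S : bilip_system s r K a theta.
Variables (gamma k1 k2 : R) (j0 : 'I_T).
Hypotheses (gamma1 : 1 <= gamma) (k10 : 0 < k1) (k20 : 0 < k2).
Hypothesis r_low : forall p, k1 * rate gamma p.1 ^+ 2 <= r [:: p].
Hypothesis r_up : forall p, r [:: p] <= k2 * rate gamma p.1 ^+ 2.
Hypothesis s_low : forall p x, closed_disk x -> k1 * rate gamma p.1 <= enorm (s p x).
Hypothesis s_up : forall p x, closed_disk x -> enorm (s p x) <= k2 * rate gamma p.1.

Lemma dimension_dichotomy :
  ((hausdorff_dim J < (1 / gamma)%:E)%E ->
    hausdorff_measure (fine (hausdorff_dim J)) J = 0%E) /\
  (((1 / gamma)%:E < hausdorff_dim J)%E ->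
    packing_dim J = hausdorff_dim J /\
    packing_measure (fine (hausdorff_dim J)) J = +oo%E).
Proof.
have [h dimJ] := hausdorff_dim_disk_fin (fun x => @limit_set_disk R I s r K a theta S x).
rewrite dimJ /= !lte_fin; split=> hg.
  exact: (hausdorff_measure_limit_set_eq0 S j0 gamma1 k10 k20 r_low s_up dimJ hg).
have pinf := packing_measure_limit_set_pinfty S j0 gamma1 k10 k20 r_up s_low s_up dimJ hg.
split=> //; apply/eqP; rewrite eq_le; apply/andP; split.
  apply/lee_addgt0Pr => eps eps0; rewrite -EFinD; apply: ereal_inf_lbound.
  have h0 : 0 <= h by rewrite -lee_fin -dimJ hausdorff_dim_ge0.
  exists (h + eps) => //; split; first by rewrite addr_ge0 // ltW.
  apply: (packing_measure_limit_set_eq0 S j0 gamma1 k20 s_up dimJ hg).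
  by rewrite ltrDl.
(* A null exponent t < h would, by monotonicity in the exponent, contradict the infinite measure at
   h. *)
apply: le_ereal_inf_tmp => _ [t [t0 pt] <-]; rewrite lee_fin leNgt; apply/negP => /ltW th.
by have := packing_measure_mono J th; rewrite pinf pt leye_eq.
Qed.

End Dichotomy.

(** * Growth bounds for the whole sequence *)

Section GrowthConstants.
Context {R : realType}.
Variables (d : nat -> R) (c1 c2 gamma : R) (N : nat).
Hypotheses (d_calD : calD d) (c10 : 0 < c1) (c12 : c1 <= c2) (gamma1 : 1 <= gamma) (N0 : (0 < N)%N).
Hypothesis growth : forall n : nat, (N <= n)%N ->
  c1 * n%:R `^ gamma <= d n /\ d n <= c2 * n%:R `^ gamma.

Lemma calD_ge2 n : 2 <= d n.+1.
Proof.
have := calD_ge d_calD (isT : (1 <= n.+1)%N).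
have : 1 <= n.+1%:R :> R by rewrite ler1n.
lra.
Qed.

Lemma calD_mono n m : (1 <= n <= m)%N -> d n <= d m.
Proof.
move=> /andP[n1]; elim: m => [|m IH]; first by case: n n1.
rewrite leq_eqVlt => /predU1P[->//|nm]; have := IH nm.
have := d_calD.2 m (leq_trans n1 nm); lra.
Qed.

(** Below N the bounds 2 <= d n <= d N replace the growth hypothesis, at the price of a factor
    N^gamma. The factors 2 leave room for d + 1, d - 1 and d^2 - 1 in place of d and d^2. *)
Lemma exists_growth_constants : exists2 k : R * R, 0 < k.1 /\ 0 < k.2 &
  forall n, [/\ k.1 * rate gamma n <= (2 * d n.+1)^-1,
    k.1 * rate gamma n ^+ 2 <= (d n.+1 ^+ 2)^-1,
    2 / d n.+1 <= k.2 * rate gamma n & 2 / d n.+1 ^+ 2 <= k.2 * rate gamma n ^+ 2].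
Proof.
have g0 : 0 < gamma by exact: lt_le_trans ltr01 gamma1.
have c20 : 0 < c2 by exact: lt_le_trans c12.
pose y : R := N%:R `^ gamma.
have NR : 1 <= N%:R :> R by rewrite ler1n.
have pow1 : forall n : nat, (1 <= n)%N -> 1 <= n%:R `^ gamma :> R.
  by move=> n n1; rewrite -[leLHS](powRr0 n%:R) ler_powR ?ler1n // ltW.
have y1 : 1 <= y by exact: pow1.
have y0 : 0 < y by exact: lt_le_trans y1.
pose b1 := Num.min c1 (2 / y); pose b2 := c2 * y.
have b10 : 0 < b1 by rewrite lt_min c10 divr_gt0.
have b20 : 0 < b2 by rewrite mulr_gt0.
have up n : d n.+1 <= b2 * n.+1%:R `^ gamma.
  have p1 := pow1 n.+1 isT; have p0 : 0 < n.+1%:R `^ gamma :> R by exact: lt_le_trans p1.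
  have [Nn|nN] := leqP N n.+1.
    apply: le_trans (growth Nn).2 _; rewrite ler_pM2r // /b2 ler_peMr // ltW //.
  apply: (@le_trans _ _ (d N)); first by apply: calD_mono; rewrite /= ltnW.
  by apply: le_trans (growth (leqnn N)).2 _; rewrite -/y /b2 ler_peMr // ltW.
have lo n : b1 * n.+1%:R `^ gamma <= d n.+1.
  have p0 : 0 < n.+1%:R `^ gamma :> R by exact: lt_le_trans ltr01 (pow1 n.+1 isT).
  have [Nn|nN] := leqP N n.+1.
    apply: le_trans (growth Nn).1; by rewrite ler_pM2r // ge_min lexx.
  apply: le_trans (calD_ge2 n).
  apply: (@le_trans _ _ (2 / y * n.+1%:R `^ gamma)).
    by rewrite ler_pM2r // ge_min lexx orbT.
  rewrite mulrAC ler_pdivrMr // ler_pM2l // ge0_ler_powR ?nnegrE ?ler0n ?(ltW g0) //.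
  by rewrite ler_nat ltnW.
exists (Num.min (2 * b2)^-1 (b2 ^+ 2)^-1, Num.max (2 / b1) (2 / b1 ^+ 2)) => /=.
  rewrite lt_min lt_max !invr_gt0 exprn_gt0 // (mulr_gt0 _ b20) // (divr_gt0 _ b10) //.
move=> n; have d2 := calD_ge2 n; have d0 : 0 < d n.+1 by exact: lt_le_trans d2.
have p0 : 0 < n.+1%:R `^ gamma :> R by exact: lt_le_trans ltr01 (pow1 n.+1 isT).
have rE : rate gamma n = (n.+1%:R `^ gamma)^-1 by rewrite rate_def powRN.
have r0 := rate_gt0 gamma n.
have upV : b2^-1 * rate gamma n <= (d n.+1)^-1.
  by rewrite rE -invfM lef_pV2 ?posrE ?mulr_gt0.
have loV : (d n.+1)^-1 <= b1^-1 * rate gamma n.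
  by rewrite rE -invfM lef_pV2 ?posrE ?mulr_gt0.
have upV2 : (b2^-1 * rate gamma n) ^+ 2 <= (d n.+1)^-1 ^+ 2.
  by rewrite !expr2 ler_pM // mulr_ge0 ?invr_ge0 // ltW.
have loV2 : (d n.+1)^-1 ^+ 2 <= (b1^-1 * rate gamma n) ^+ 2.
  by rewrite !expr2 ler_pM // invr_ge0 ltW.
split.
- apply: (@le_trans _ _ ((2 * b2)^-1 * rate gamma n)).
    by rewrite ler_pM2r // ge_min lexx.
  by rewrite [(2 * b2)^-1]invfM [(2 * _)^-1]invfM -mulrA ler_pM2l ?invr_gt0.
- apply: (@le_trans _ _ ((b2 ^+ 2)^-1 * rate gamma n ^+ 2)).
    by rewrite ler_pM2r ?exprn_gt0 // ge_min lexx orbT.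
  by rewrite -!exprVn -exprMn.
- apply: (@le_trans _ _ (2 / b1 * rate gamma n)); last by rewrite ler_pM2r // le_max lexx.
  by rewrite -mulrA ler_pM2l.
- apply: (@le_trans _ _ (2 / b1 ^+ 2 * rate gamma n ^+ 2)); last first.
    by rewrite ler_pM2r ?exprn_gt0 // le_max lexx orbT.
  by rewrite -mulrA ler_pM2l // -!exprVn -exprMn.
Qed.

End GrowthConstants.

(** * Complex numbers as vectors of the plane *)

Section ComplexPlane.
Context {R : realType}.
Local Notation E := 'rV[R]_2.
Implicit Types (z w : R[i]) (v : E).

Lemma vec_of_CK : cancel (@vec_of_C R) (@C_of_vec R).
Proof. by case=> x y; rewrite /C_of_vec /vec_of_C !mxE. Qed.

Lemma C_of_vecK : cancel (@C_of_vec R) (@vec_of_C R).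
Proof.
move=> v; apply/rowP => j; rewrite !mxE.
by case: eqP => [->//|]; case: j => -[|[|//]] ? /eqP // _; congr (v 0 _); exact: val_inj.
Qed.

Lemma C_of_vec0 : C_of_vec (0 : E) = 0.
Proof. by rewrite /C_of_vec !mxE. Qed.

Lemma enorm_vec_of_C z : enorm (vec_of_C z) = normc z.
Proof. by rewrite enorm_normc vec_of_CK. Qed.

Lemma edist_vec_of_C z w : enorm (vec_of_C z - vec_of_C w) = normc (z - w).
Proof. by rewrite enorm_normc C_of_vecD C_of_vecN !vec_of_CK. Qed.

Lemma normc_ge0 z : 0 <= normc z.
Proof. by case: z => x y; exact: sqrtr_ge0. Qed.

Lemma normc_sub_ge z w : normc z - normc w <= normc (z + w).
Proof. by rewrite lerBlDr -{1}(addrK w z) (le_trans (le_normcD _ _)) // normcN. Qed.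

Lemma normc_gt0 z : (0 < normc z) = (z != 0).
Proof.
rewrite lt_neqAle normc_ge0 andbT eq_sym; congr (~~ _); apply/eqP/eqP => [/eq0_normc//|->].
exact: normc0.
Qed.

Lemma normc_real (x : R) : 0 <= x -> normc (real_complex R x) = x.
Proof. by move=> x0; rewrite /= expr0n /= addr0 sqrtr_sqr ger0_norm. Qed.

Lemma normc_sys_param (d : nat -> R) T (p : nat * 'I_T) : 0 <= d p.1.+1 ->
  normc (sys_param d p) = d p.1.+1.
Proof.
by move=> d0; rewrite /sys_param normcM normc_real // /expi /= cos2Dsin2 sqrtr1 mul1r.
Qed.

Lemma open_disk_interior : @open_disk R `<=` interior closed_disk.
Proof.
move=> x x1; apply/nbhs_ballP; exists ((1 - enorm x) / 2).
  by rewrite /= divr_gt0 // subr_gt0.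
move=> y xy; apply/closed_diskE.
have coord j : `|(y - x) 0 j| <= (1 - enorm x) / 2.
  by case: xy => _ /(_ 0 j); rewrite /ball /= => /ltW; rewrite distrC !mxE.
rewrite -(subrK x y); apply: le_trans (enormD _ _) _.
rewrite -lerBrDr; apply: le_trans (enorm_le_sum _) _.
by have := coord 0; have := coord 1; lra.
Qed.

Lemma open_set_condition_disk (I : Type) (s : I -> E -> E) i j x y :
  open_set_condition closed_disk s -> i <> j -> open_disk x -> open_disk y -> s i x <> s j y.
Proof.
move=> osc ij Dx Dy e.
have := osc i j ij; rewrite -subset0 => /(_ (s i x)); apply; split.
  by exists x => //; exact: open_disk_interior.
by exists y => //; exact: open_disk_interior.
Qed.

End ComplexPlane.

(** * The affine system *)

Section SystemF.
Context {R : realType} {T : nat}.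
Local Notation I := (nat * 'I_T)%type.
Local Notation E := 'rV[R]_2.
Variable d : nat -> R.
Hypothesis d_calD : calD d.
Local Notation sF := (@sys_F R d T).

Definition letter_ratio (p : I) : R := (d p.1.+1 ^+ 2 - 1)^-1.
Local Notation ratio := letter_ratio.

Definition ratio_F (w : seq I) : R := \prod_(p <- w) ratio p.

Let d2 n : 2 <= d n.+1. Proof. exact: (calD_ge2 d_calD). Qed.
Let d0 n : 0 < d n.+1. Proof. exact: lt_le_trans (d2 n). Qed.
Let d21 n : 3 <= d n.+1 ^+ 2 - 1.
Proof. have := d2 n; rewrite expr2 => h; nra. Qed.
Let ratio0 p : 0 < ratio p.
Proof. by rewrite invr_gt0 (lt_le_trans _ (d21 _)). Qed.
Let ratio_F0 w : 0 < ratio_F w.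
Proof. by apply: prodr_gt0 => p _. Qed.

Lemma vec_of_C_divr (z : R[i]) (c : R) : vec_of_C (z / real_complex R c) = c^-1 *: vec_of_C z.
Proof.
rewrite -fmorphV; case: z => x y; apply/rowP => j; rewrite !mxE /=.
by case: ifP => _; rewrite !mulr0 ?subr0 ?add0r ?addr0 mulrC.
Qed.

Lemma vec_of_CD (z w : R[i]) : vec_of_C (z + w) = vec_of_C z + vec_of_C w.
Proof. by case: z w => [x y] [x' y']; apply/rowP => j; rewrite !mxE /=; case: ifP. Qed.

Lemma enormZ (c : R) (v : E) : enorm (c *: v) = `|c| * enorm v.
Proof.
rewrite !enormE !mxE !exprMn -mulrDr sqrtrM ?sqr_ge0 // sqrtr_sqr //.
Qed.

Lemma sys_F_affine (p : I) v :
  sF p v = ratio p *: (v + vec_of_C (conjc (sys_param d p))).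
Proof.
rewrite /sys_F /plane_map /f_map.
have -> : `|sys_param d p| ^+ 2 - 1 = real_complex R (d p.1.+1 ^+ 2 - 1).
  rewrite -[`|_|]/(real_complex R (normc _)) normc_sys_param ?(ltW (d0 _)) //.
  by rewrite rmorphB rmorphXn.
by rewrite vec_of_C_divr vec_of_CD C_of_vecK.
Qed.

Lemma enorm_conj_param (p : I) : enorm (vec_of_C (conjc (sys_param d p))) = d p.1.+1.
Proof.
rewrite enorm_vec_of_C -[RHS](normc_sys_param (p := p)) ?(ltW (d0 _)) //.
by case: (sys_param d p) => x y; rewrite /= sqrrN.
Qed.

Lemma sys_F_dist p x y : sF p x - sF p y = ratio p *: (x - y).
Proof. by rewrite !sys_F_affine -scalerBr opprD addrACA subrr addr0. Qed.

Lemma word_map_F_dist w x y : word_map sF w x - word_map sF w y = ratio_F w *: (x - y).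
Proof.
elim: w => [|p w IH]; first by rewrite /ratio_F big_nil scale1r.
by rewrite /= sys_F_dist IH scalerA /ratio_F big_cons.
Qed.

Lemma enorm_sys_F p x : enorm (sF p x) <= (enorm x + d p.1.+1) / (d p.1.+1 ^+ 2 - 1) /\
  (d p.1.+1 - enorm x) / (d p.1.+1 ^+ 2 - 1) <= enorm (sF p x).
Proof.
have r0 := ratio0 p.
rewrite sys_F_affine enormZ gtr0_norm // -[(_ ^+ 2 - 1)^-1]/(ratio p) ![_ * ratio p]mulrC.
rewrite !ler_pM2l // -(enorm_conj_param p) enormD; split=> //.
by rewrite lerBlDl -{1}(addKr x (vec_of_C _)) (le_trans (enormD _ _)) // enormN addrC.
Qed.

(** Word maps are exact similarities, so there is no distortion; theta = 1/3 because d^2 - 1 >=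
    3. *)
Lemma sys_F_bilip : open_set_condition closed_disk sF ->
  bilip_system sF ratio_F 1 1 (3^-1).
Proof.
move=> osc; split=> //.
- move=> p x /closed_diskE x1; apply/closed_diskE; apply: le_trans (enorm_sys_F p x).1 _.
  have := d21 p.1; have := d2 p.1 => h h3.
  by rewrite ler_pdivrMr; nra.
- move=> p x; rewrite /open_disk /= => x1; apply: le_lt_trans (enorm_sys_F p x).1 _.
  have := d21 p.1; have := d2 p.1 => h h3.
  by rewrite ltr_pdivrMr; nra.
- by move=> p q x y; exact: open_set_condition_disk.
- by rewrite invf_lt1 // ltr1n.
- by rewrite /ratio_F big_nil.
- move=> w; rewrite /ratio_F; elim: w => [|p w IH]; first by rewrite big_nil.
  rewrite big_cons exprS ler_pM ?(ltW (ratio0 _)) ?(ltW (ratio_F0 _)) //.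
  by rewrite lef_pV2 ?posrE ?d21 // (lt_le_trans _ (d21 _)).
- by move=> w x y _ _; rewrite word_map_F_dist enormZ gtr0_norm // mul1r.
- by move=> w x y _ _; rewrite word_map_F_dist enormZ gtr0_norm // mul1r.
- move=> w z; rewrite mul1r => zw.
  exists ((ratio_F w)^-1 *: (z - word_map sF w 0)).
    rewrite /open_disk /= enormZ gtr0_norm ?invr_gt0 // mulrC ltr_pdivrMr //.
    by rewrite mul1r.
  apply/subr0_eq; rewrite -(subrK (word_map sF w 0) (word_map sF w _)).
  rewrite word_map_F_dist subr0 scalerA divff ?gt_eqF // scale1r.
  by rewrite subrK subrr.
Qed.

Lemma ratio_F_letter_bounds p :
  (d p.1.+1 ^+ 2)^-1 <= ratio_F [:: p] <= 2 / d p.1.+1 ^+ 2.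
Proof.
rewrite /ratio_F big_seq1 /ratio; have := d21 p.1; set y := d _ ^+ 2 => y3.
apply/andP; split; first by rewrite lef_pV2 ?posrE; lra.
have y0 : 0 < y by lra.
have y1 : 0 < y - 1 by lra.
by rewrite ler_pdivlMr // mulrC ler_pdivrMr //; lra.
Qed.

Lemma enorm_sys_F_bounds p x : closed_disk x ->
  (d p.1.+1 + 1)^-1 <= enorm (sF p x) <= (d p.1.+1 - 1)^-1.
Proof.
move=> /closed_diskE x1; have [up lo] := enorm_sys_F p x; have h := d2 p.1.
have p1 : 0 < d p.1.+1 + 1 by lra.
have m1 : 0 < d p.1.+1 - 1 by lra.
have sq : d p.1.+1 ^+ 2 - 1 = (d p.1.+1 - 1) * (d p.1.+1 + 1) by ring.
rewrite sq in up lo; apply/andP; split.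
  apply: le_trans lo; rewrite ler_pdivlMr ?mulr_gt0 // mulrCA mulVf ?gt_eqF // mulr1; lra.
apply: le_trans up _; rewrite ler_pdivrMr ?mulr_gt0 // mulKf ?gt_eqF //; lra.
Qed.

Lemma sys_F_lower p x y :
  ((d p.1.+1 + 1) ^+ 2)^-1 * enorm (x - y) <= enorm (sF p x - sF p y).
Proof.
rewrite sys_F_dist enormZ gtr0_norm // ler_wpM2r ?enorm_ge0 //.
have := d21 p.1; have := d2 p.1 => h h3.
have e : (d p.1.+1 + 1) ^+ 2 = d p.1.+1 ^+ 2 + 2 * d p.1.+1 + 1 by ring.
by rewrite e lef_pV2 ?posrE; lra.
Qed.

End SystemF.

(** * The continued fraction system *)

Section SystemG.
Context {R : realType} {T : nat}.
Local Notation I := (nat * 'I_T)%type.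
Local Notation E := 'rV[R]_2.
Variable d : nat -> R.
Hypothesis d_calD : calD d.
Local Notation sG := (@sys_G R d T).
Local Notation alpha p := (sys_param d p).

Let d2 n : 2 <= d n.+1. Proof. exact: (calD_ge2 d_calD). Qed.
Let d0 n : 0 < d n.+1. Proof. exact: lt_le_trans (d2 n). Qed.
Let norm_alpha (p : I) : normc (alpha p) = d p.1.+1.
Proof. by rewrite normc_sys_param // ltW. Qed.

Lemma shift_norm_ge (p : I) z : d p.1.+1 - normc z <= normc (z + alpha p).
Proof. by rewrite -norm_alpha [z + _]addrC; exact: normc_sub_ge. Qed.

Lemma shift_norm_le (p : I) z : normc (z + alpha p) <= d p.1.+1 + normc z.
Proof. by rewrite -norm_alpha [z + _]addrC; exact: le_normcD. Qed.

Lemma shift_neq0 (p : I) z : normc z <= 1 -> z + alpha p != 0.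
Proof.
by move=> z1; rewrite -normc_gt0 (lt_le_trans _ (shift_norm_ge p z)) //; have := d2 p.1; lra.
Qed.

Lemma enorm_sys_G p x : enorm (sG p x) = (normc (C_of_vec x + alpha p))^-1.
Proof. by rewrite /sys_G /plane_map enorm_vec_of_C normcV. Qed.

Lemma enorm_sys_G_bounds p x : closed_disk x ->
  (d p.1.+1 + 1)^-1 <= enorm (sG p x) <= (d p.1.+1 - 1)^-1.
Proof.
move=> /closed_diskE; rewrite enorm_normc => x1; rewrite enorm_sys_G.
have h1 := shift_norm_ge p (C_of_vec x); have h2 := shift_norm_le p (C_of_vec x).
have h := d2 p.1.
by rewrite !lef_pV2 ?posrE; [apply/andP; split| | | |]; lra.
Qed.

Lemma sys_G_dist p x y : closed_disk x -> closed_disk y ->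
  enorm (sG p x - sG p y) =
    enorm (x - y) / (normc (C_of_vec x + alpha p) * normc (C_of_vec y + alpha p)).
Proof.
move=> /closed_diskE; rewrite enorm_normc => x1 /closed_diskE; rewrite enorm_normc => y1.
have nx := shift_neq0 p x1; have ny := shift_neq0 p y1.
rewrite /sys_G /plane_map edist_vec_of_C /g_map.
have -> : (C_of_vec x + alpha p)^-1 - (C_of_vec y + alpha p)^-1 =
   (C_of_vec y - C_of_vec x) / ((C_of_vec x + alpha p) * (C_of_vec y + alpha p)).
  by field; rewrite nx ny.
by rewrite normcM normcV normcM edistC [in RHS]enorm_normc C_of_vecD C_of_vecN.
Qed.

(** The last two continued fraction denominators, that is the bottom row of the product of the
    matrices [0, 1; 1, alpha] of the letters. Appending a letter multiplies on the right, hence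
    [foldl]. *)
Definition denominators (w : seq I) : R[i] * R[i] :=
  foldl (fun c p => (c.2, c.1 + alpha p * c.2)) (0, 1) w.

(** The modulus of the derivative of the word map at 0, as its determinant has modulus 1. *)
Definition ratio_G (w : seq I) : R := (normc (denominators w).2 ^+ 2)^-1.

Lemma denominators_nil : denominators [::] = (0, 1). Proof. by []. Qed.

Lemma denominators_rcons w p : denominators (rcons w p) =
  ((denominators w).2, (denominators w).1 + alpha p * (denominators w).2).
Proof. by rewrite /denominators foldl_rcons. Qed.

Lemma word_map_rcons (s : I -> E -> E) w p x :
  word_map s (rcons w p) x = word_map s w (s p x).
Proof. by rewrite -cats1 word_map_cat. Qed.

Section Expanding.
Hypothesis d12 : 2 < d 1%N.
Let lam := d 1%N - 1.
Let lam1 : 1 < lam. Proof. by rewrite /lam ltrBrDr -(natrD _ 1 1). Qed.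
Let lam0 : 0 < lam. Proof. exact: lt_trans lam1. Qed.

Let d_lam n : lam + 1 <= d n.+1.
Proof. by rewrite /lam subrK; exact: (calD_mono d_calD). Qed.

(** For a row (u, v) with |u| <= |v| the next denominator is at least |alpha| |v| - |u| >= (lam + 1)
    |v| - |v|. *)
Lemma denominators_growth w :
  lam * normc (denominators w).1 <= normc (denominators w).2 /\
  lam ^+ size w <= normc (denominators w).2.
Proof.
elim/last_ind: w => [|w p [IH1 IH2]].
  by rewrite /denominators /= !expr0n /= !addr0 sqrtr0 mulr0 expr1n sqrtr1 expr0.
rewrite denominators_rcons size_rcons /=.
set u := (denominators w).1 in IH1 IH2 *; set v := (denominators w).2 in IH1 IH2 *.
have uv : normc u <= normc v.
  apply: le_trans IH1; rewrite ler_peMl ?normc_ge0 // ltW //.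
have step : lam * normc v <= normc (u + alpha p * v).
  rewrite addrC; apply: le_trans (normc_sub_ge _ _); rewrite normcM norm_alpha.
  have := d_lam p.1; have := normc_ge0 v; nra.
split=> //; apply: le_trans step; rewrite exprS ler_pM2l //.
Qed.

Let den_gt0 w : 0 < normc (denominators w).2.
Proof. by have [_] := denominators_growth w; apply: lt_le_trans; rewrite exprn_gt0. Qed.

Let ratio_G0 w : 0 < ratio_G w.
Proof. by rewrite invr_gt0 exprn_gt0. Qed.

Let mu := 1 - lam^-1.
Let mu0 : 0 < mu. Proof. by rewrite subr_gt0 invf_lt1. Qed.
Let mu1 : mu <= 1. Proof. by rewrite /mu gerBl invr_ge0 ltW. Qed.

(** Since |u| <= |v| / lam, the denominator u z + v is comparable to v on the whole disk; this is
    the bounded distortion, and it degenerates as lam tends to 1. *)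
Lemma den_bounds w (z : R[i]) : normc z <= 1 ->
  mu * normc (denominators w).2 <= normc ((denominators w).1 * z + (denominators w).2) /\
  normc ((denominators w).1 * z + (denominators w).2) <= 2 * normc (denominators w).2.
Proof.
move=> z1; have [h _] := denominators_growth w; move: h.
set u := (denominators w).1; set v := (denominators w).2 => h.
have {}h : normc u <= lam^-1 * normc v by rewrite ler_pdivlMl.
have uz : normc (u * z) <= lam^-1 * normc v.
  by rewrite normcM; apply: le_trans h; rewrite ler_piMr // normc_ge0.
have lv : lam^-1 * normc v <= normc v.
  by rewrite ler_piMl ?normc_ge0 // invf_le1 // ltW.
split.
  rewrite addrC; apply: le_trans (normc_sub_ge _ _).
  by rewrite /mu mulrBl mul1r lerB.
by apply: le_trans (le_normcD _ _) _; rewrite mulr_natl mulr2n lerD // (le_trans uz).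
Qed.

Lemma den_neq0 w (z : R[i]) : normc z <= 1 -> (denominators w).1 * z + (denominators w).2 != 0.
Proof.
move=> z1; rewrite -normc_gt0; apply: lt_le_trans (den_bounds w z1).1.
by rewrite mulr_gt0.
Qed.

Lemma sys_G_disk p x : closed_disk x -> closed_disk (sG p x).
Proof.
move=> Xx; apply/closed_diskE; have /andP[_ h] := enorm_sys_G_bounds p Xx.
by apply: le_trans h _; rewrite invf_le1; have := d2 p.1; lra.
Qed.

(** Each letter changes the sign of the determinant, so only its modulus is tracked. *)
Lemma word_map_G_moebius w : exists P Q : R[i],
  normc (P * (denominators w).2 - Q * (denominators w).1) = 1 /\
  forall x, closed_disk x -> C_of_vec (word_map sG w x) =
    (P * C_of_vec x + Q) / ((denominators w).1 * C_of_vec x + (denominators w).2).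
Proof.
elim/last_ind: w => [|w p [P [Q [IH1 IH2]]]].
  exists 1, 0; rewrite denominators_nil /fst /snd !mulr1 mul0r subr0 normc1; split=> // x _.
  by rewrite mul1r addr0 mul0r add0r divr1.
exists Q, (P + alpha p * Q); rewrite denominators_rcons ![(_, _).1]/= ![(_, _).2]/=; split.
  rewrite -IH1 -normcN; congr normc; ring.
move=> x Xx; rewrite word_map_rcons IH2; last exact: sys_G_disk.
have z1 : normc (C_of_vec x) <= 1 by rewrite -enorm_normc; apply/closed_diskE.
have := den_neq0 (rcons w p) z1; rewrite denominators_rcons ![(_, _).1]/= ![(_, _).2]/=.
have -> : C_of_vec (sG p x) = (C_of_vec x + alpha p)^-1 by rewrite /sys_G /plane_map vec_of_CK.
have := shift_neq0 p z1.
move: (C_of_vec x) (alpha p) (denominators w).1 (denominators w).2 => z al u v nz nd.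
by field; rewrite nd nz.
Qed.

Lemma word_map_G_dist w x y : closed_disk x -> closed_disk y ->
  enorm (word_map sG w x - word_map sG w y) = enorm (x - y) /
    (normc ((denominators w).1 * C_of_vec x + (denominators w).2) *
     normc ((denominators w).1 * C_of_vec y + (denominators w).2)).
Proof.
move=> Xx Xy; have [P [Q [det1 H]]] := word_map_G_moebius w.
have x1 : normc (C_of_vec x) <= 1 by rewrite -enorm_normc; apply/closed_diskE.
have y1 : normc (C_of_vec y) <= 1 by rewrite -enorm_normc; apply/closed_diskE.
have nx := den_neq0 w x1; have ny := den_neq0 w y1.
rewrite !enorm_normc !C_of_vecD !C_of_vecN !H //.
move: nx ny det1; move: (C_of_vec x) (C_of_vec y) (denominators w).1 (denominators w).2.
move=> z1 z2 u v nx ny det1.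
have -> : (P * z1 + Q) / (u * z1 + v) - (P * z2 + Q) / (u * z2 + v) =
    (P * v - Q * u) * (z1 - z2) / ((u * z1 + v) * (u * z2 + v)).
  by field; rewrite nx ny.
by rewrite !normcM normcV normcM det1 mul1r.
Qed.

(** The upper bound needs the factor 1 / mu^2 and the lower one the factor 4, whence their product
    as common constant. Perturbing the inverse Moebius map by a quarter keeps the preimage in the
    disk, whence 1/4. *)
Lemma sys_G_bilip : open_set_condition closed_disk sG ->
  bilip_system sG ratio_G (4 / mu ^+ 2) (4^-1) (lam^-1).
Proof.
move=> osc.
have mu2 : 0 < mu ^+ 2 by rewrite exprn_gt0.
have mu21 : mu ^+ 2 <= 1 by rewrite exprn_ile1 // ltW.
have C_disk (x : E) : closed_disk x -> normc (C_of_vec x) <= 1.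
  by move=> Xx; rewrite -enorm_normc; apply/closed_diskE.
split=> //.
- exact: sys_G_disk.
- move=> p x x1; rewrite /open_disk /= enorm_sys_G.
  rewrite invf_lt1; have := shift_norm_ge p (C_of_vec x); rewrite -enorm_normc;
    move: x1; rewrite /open_disk /=; have := d2 p.1; lra.
- by move=> p q x y; exact: open_set_condition_disk.
- by rewrite ler_pdivlMr // mul1r (le_trans mu21) // ler1n.
- by rewrite invr_gt0.
- by rewrite invf_lt1.
- by rewrite /ratio_G denominators_nil normc1 expr1n invr1.
- move=> w; rewrite exprVn lef_pV2 ?posrE ?exprn_gt0 //.
  have [_ h] := denominators_growth w.
  apply: le_trans h _; rewrite expr2 ler_peMl ?normc_ge0 //.
  have [_ h] := denominators_growth w; apply: le_trans h.
  by rewrite exprn_ege1 // ltW.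
- move=> w x y Xx Xy; rewrite word_map_G_dist // mulrC ler_wpM2r ?enorm_ge0 //.
  have [hx _] := den_bounds w (C_disk _ Xx); have [hy _] := den_bounds w (C_disk _ Xy).
  have pv := den_gt0 w; move: hx hy pv.
  rewrite /ratio_G; set v := normc (denominators w).2; set X := normc _; set Y := normc _.
  move=> hx hy pv; have mv : 0 < mu * v by rewrite mulr_gt0.
  rewrite -[(X * Y)^-1]mul1r ler_pdivrMr; last by rewrite mulr_gt0 // (lt_le_trans mv).
  have XY : (mu * v) * (mu * v) <= X * Y by rewrite ler_pM // ltW.
  apply: (@le_trans _ _ (4 / mu ^+ 2 / v ^+ 2 * (mu * v * (mu * v)))).
    have -> : 4 / mu ^+ 2 / v ^+ 2 * (mu * v * (mu * v)) = 4 by field; rewrite !gt_eqF.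
    by rewrite ler1n.
  by rewrite ler_pM2l // !mulr_gt0 ?invr_gt0 ?exprn_gt0.
- move=> w x y Xx Xy; rewrite word_map_G_dist // [enorm _ / _]mulrC mulrA ler_wpM2r ?enorm_ge0 //.
  have [lx hx] := den_bounds w (C_disk _ Xx); have [ly hy] := den_bounds w (C_disk _ Xy).
  have pv := den_gt0 w; move: lx hx ly hy pv.
  rewrite /ratio_G; set v := normc (denominators w).2; set X := normc _; set Y := normc _.
  move=> lx hx ly hy pv; have mv : 0 < mu * v by rewrite mulr_gt0.
  have X0 := lt_le_trans mv lx; have Y0 := lt_le_trans mv ly.
  have XY : X * Y <= (2 * v) * (2 * v) by rewrite ler_pM // ltW.
  rewrite ler_pdivlMr ?mulr_gt0 // mulrC ler_pdivrMr ?exprn_gt0 //.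
  apply: le_trans XY _.
  have -> : 2 * v * (2 * v) = 4 * v ^+ 2 by ring.
  by rewrite ler_pM2r ?exprn_gt0 // ler_peMr // invf_ge1.
- move=> w z zw.
  have [P [Q [det1 H]]] := word_map_G_moebius w.
  have C0 : C_of_vec (0 : E) = 0 by exact: C_of_vec0.
  have H0 := H 0 closed_disk0; rewrite C0 !mulr0 !add0r in H0.
  have v0 := den_gt0 w; have vn0 : (denominators w).2 != 0 by rewrite -normc_gt0.
  have [lamu _] := denominators_growth w.
  move: zw; rewrite enorm_normc C_of_vecD C_of_vecN H0 /ratio_G => zw.
  move: lamu v0 vn0 det1 H zw; set u := (denominators w).1; set v := (denominators w).2.
  set eta := C_of_vec z - _ => lamu v0 vn0 det1 H zw.
  set D := P * v - Q * u in det1.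
  have uv : normc u <= normc v by apply: le_trans lamu; rewrite ler_peMl ?normc_ge0 // ltW.
  have ve : normc (v ^+ 2 * eta) < 4^-1.
    by rewrite expr2 !normcM -expr2 mulrC -ltr_pdivlMr ?exprn_gt0.
  have ue : normc (u * v * eta) < 4^-1.
    apply: le_lt_trans ve; rewrite expr2 !normcM.
    by rewrite ler_wpM2r ?normc_ge0 // ler_wpM2r ?normc_ge0.
  have De : 3 / 4 <= normc (D - u * v * eta).
    apply: le_trans (normc_sub_ge _ _); rewrite det1 normcN; lra.
  have Dn0 : D - u * v * eta != 0 by rewrite -normc_gt0 (lt_le_trans _ De).
  (* Solution of D x / (v (u x + v)) = eta, the equation saying that the image of x differs from
     that of 0 by eta; its modulus is below (1/4) / (3/4). *)
  pose x := vec_of_C (v ^+ 2 * eta / (D - u * v * eta)).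
  have Dx : open_disk x.
    rewrite /open_disk /= /x enorm_vec_of_C normcM normcV ltr_pdivrMr ?mul1r; last first.
      by rewrite (lt_le_trans _ De).
    by apply: lt_trans ve (lt_le_trans _ De); lra.
  exists x => //; apply: (can_inj (@C_of_vecK R)).
  rewrite (H _ (open_closed_disk Dx)) /x vec_of_CK.
  have := den_neq0 w (C_disk _ (open_closed_disk Dx)); rewrite /x vec_of_CK -/u -/v => nd.
  have -> : C_of_vec z = eta + Q / v by rewrite /eta subrK.
  clearbody eta; clear H0 x Dx; move: nd Dn0; rewrite /D; clearbody u v => nd Dn0.
  have nz : u * (v ^+ 2 * eta) + v * (P * v - Q * u - u * v * eta) != 0.
    have -> : u * (v ^+ 2 * eta) + v * (P * v - Q * u - u * v * eta) =
        (u * (v ^+ 2 * eta / (P * v - Q * u - u * v * eta)) + v) *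
          (P * v - Q * u - u * v * eta) by field.
    by rewrite mulf_neq0.
  by field; rewrite vn0 Dn0 nz.
Qed.

End Expanding.

Lemma ratio_G_letter (p : I) : ratio_G [:: p] = (d p.1.+1 ^+ 2)^-1.
Proof. by rewrite /ratio_G -(norm_alpha p) -[[:: p]]/(rcons [::] p) denominators_rcons
  denominators_nil ![(_, _).1]/= ![(_, _).2]/= mulr1 add0r. Qed.

Lemma sys_G_lower p x y : closed_disk x -> closed_disk y ->
  ((d p.1.+1 + 1) ^+ 2)^-1 * enorm (x - y) <= enorm (sG p x - sG p y).
Proof.
move=> Xx Xy; rewrite sys_G_dist // mulrC ler_wpM2l ?enorm_ge0 //.
have bnd (z : E) : closed_disk z -> 0 < normc (C_of_vec z + alpha p) <= d p.1.+1 + 1.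
  move=> /closed_diskE; rewrite enorm_normc => z1.
  apply/andP; split; first by rewrite normc_gt0 shift_neq0.
  by apply: le_trans (shift_norm_le _ _) _; rewrite lerD2l.
have /andP[x0 x1] := bnd x Xx; have /andP[y0 y1] := bnd y Xy.
by rewrite lef_pV2 ?posrE ?mulr_gt0 ?exprn_gt0 ?addr_gt0 // expr2 ler_pM // ltW.
Qed.

(* For [d 1 = 2] the map of index (0, 0) has derivative of norm 1 at -1. *)
Lemma sys_G_IFS_gt2 : (0 < T)%N -> is_IFS closed_disk sG -> 2 < d 1%N.
Proof.
move=> T0 [_ _ _ _ lip1]; rewrite lt_neqAle (d2 0) andbT; apply/eqP => d1.
pose p : I := (0%N, Ordinal T0).
have ap : alpha p = real_complex R 2.
  by rewrite /sys_param /expi /= -d1 mul0r mulr0 cos0 sin0 mul1r.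
have lip : (lip_const closed_disk (sG p) < 1)%E.
  by apply: le_lt_trans lip1; apply: ereal_sup_ubound; exists p.
pose pt (e : R) : E := vec_of_C (real_complex R (e - 1)).
have ptX e : 0 <= e <= 1 -> closed_disk (pt e).
  move=> /andP[e0 e1]; apply/closed_diskE; rewrite enorm_vec_of_C -normcN -rmorphN.
  by rewrite normc_real ?opprB; lra.
have pt_shift e : 0 <= e -> normc (C_of_vec (pt e) + alpha p) = 1 + e.
  move=> e0; rewrite vec_of_CK ap -rmorphD normc_real; lra.
(* The difference quotient between -1 and -1 + e is 1 / (1 + e), as the shifted points have moduli 1
   and 1 + e. *)
have quot e : 0 < e <= 1 -> ((1 + e)^-1%:E <= lip_const closed_disk (sG p))%E.
  move=> /andP[e0 e1]; apply: ereal_sup_ubound.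
  have X0 : closed_disk (pt 0) by apply: ptX; rewrite lexx ler01.
  have Xe : closed_disk (pt e) by apply: ptX; rewrite (ltW e0).
  exists (pt 0) => //; exists (pt e) => //.
  rewrite sys_G_dist // !pt_shift ?(ltW e0) // addr0 mul1r mulrAC divff ?mul1r //.
  rewrite edist_vec_of_C -rmorphB -normcN -rmorphN normc_real; first by rewrite gt_eqF //; lra.
  by lra.
move: lip quot; case: (lip_const _ _) => [L| |] //=; rewrite ?lte_fin => L1 quot.
  have h1 := quot 1; rewrite ltr01 lexx lee_fin in h1.
  have L2 : 2^-1 <= L by exact: h1.
  (* For e = 1 - L the bound reads 1 <= L (2 - L), that is (1 - L)^2 <= 0. *)
  have e01 : 0 < 1 - L <= 1 by apply/andP; split; lra.
  have := quot _ e01; rewrite lee_fin; apply/negP; rewrite -ltNge.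
  rewrite -[ltRHS]mul1r ltr_pdivlMr; last by lra.
  by nra.
by have := quot 1; rewrite ltr01 lexx => /(_ isT).
Qed.

End SystemG.

(** * From one-letter estimates to the three claims *)

Section Conclusion.
Context {R : realType} {T : nat}.
Local Notation I := (nat * 'I_T)%type.
Local Notation E := 'rV[R]_2.
Variables (d : nat -> R) (c1 c2 gamma : R) (N : nat).
Hypotheses (d_calD : calD d) (T0 : (0 < T)%N).
Hypotheses (c10 : 0 < c1) (c12 : c1 <= c2) (gamma1 : 1 <= gamma) (N0 : (0 < N)%N).
Hypothesis growth : forall n : nat, (N <= n)%N ->
  c1 * n%:R `^ gamma <= d n /\ d n <= c2 * n%:R `^ gamma.

(** F and G satisfy the same estimates on single letters, so both halves of the theorem are
    instances of this statement. *)
Lemma limit_set_conclusion (s : I -> E -> E) (r : seq I -> R) (K a theta : R) :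
  bilip_system s r K a theta ->
  (forall p, (d p.1.+1 ^+ 2)^-1 <= r [:: p] <= 2 / d p.1.+1 ^+ 2) ->
  (forall p x, closed_disk x ->
    (d p.1.+1 + 1)^-1 <= enorm (s p x) <= (d p.1.+1 - 1)^-1) ->
  (forall p x y, closed_disk x -> closed_disk y ->
    ((d p.1.+1 + 1) ^+ 2)^-1 * enorm (x - y) <= enorm (s p x - s p y)) ->
  let J := limit_set closed_disk s in
  let h := hausdorff_dim J in
  [/\ (h < (1 / gamma)%:E)%E -> hausdorff_measure (fine h) J = 0%E,
      ((1 / gamma)%:E < h)%E ->
        packing_dim J = hausdorff_dim J /\ packing_measure (fine h) J = +oo%E &
      c2 `^ (2 / gamma) * (N%:R + 1) <= T%:R ->
        ((1 / gamma)%:E < hausdorff_dim J)%E].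
Proof.
move=> S rb sb low J h.
have [[k1 k2] /= [k10 k20] Hk] := exists_growth_constants d_calD c10 c12 gamma1 N0 growth.
have d2 n := calD_ge2 d_calD n.
have d0 n : 0 < d n.+1 by exact: lt_le_trans (d2 n).
have r_low p : k1 * rate gamma p.1 ^+ 2 <= r [:: p].
  by have [_ h2 _ _] := Hk p.1; have /andP[] := rb p => h3 _; exact: le_trans h3.
have r_up p : r [:: p] <= k2 * rate gamma p.1 ^+ 2.
  by have [_ _ _ h4] := Hk p.1; have /andP[_ h3] := rb p; exact: le_trans h4.
have s_low p x : closed_disk x -> k1 * rate gamma p.1 <= enorm (s p x).
  move=> /(sb p)/andP[h3 _]; have [h1 _ _ _] := Hk p.1.
  apply: le_trans h1 (le_trans _ h3); have := d2 p.1.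
  by move=> h4; rewrite lef_pV2 ?posrE; lra.
have s_up p x : closed_disk x -> enorm (s p x) <= k2 * rate gamma p.1.
  move=> /(sb p)/andP[_ h3]; have [_ _ h1 _] := Hk p.1.
  apply: le_trans h3 (le_trans _ h1); have h4 := d2 p.1.
  by rewrite ler_pdivlMr // mulrC ler_pdivrMr; lra.
have [ha hb] := dimension_dichotomy S (Ordinal T0) gamma1 k10 k20 r_low r_up s_low s_up.
split=> // HT; apply: (hausdorff_dim_gt_inv S d_calD low gamma1 _ N0 _ HT).
  exact: lt_le_trans c12.
by move=> n /growth[].
Qed.

End Conclusion.

Theorem theorem2 (R : realType) (d : nat -> R) (T : nat)
  (hd : calD d) (hT : (0 < T)%N)
  (c1 c2 c3 gamma : R) (N : nat)
  (hc1 : 0 < c1) (hc12 : c1 <= c2) (hc3 : 0 < c3) (hgamma : 1 <= gamma)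
  (hN : (0 < N)%N)
  (hgrowth : forall n : nat, (N <= n)%N ->
     c1 * n%:R `^ gamma <= d n /\ d n <= c2 * n%:R `^ gamma)
  (hgap : forall n : nat, (N <= n)%N ->
     c3 * n%:R `^ (gamma - 1) <= d n.+1 - d n)
  (hc1N : 1 < c1 * N%:R `^ gamma) :
  (is_CIFS closed_disk (sys_F d T) ->
   let J := limit_set closed_disk (sys_F d T) in
   let h := hausdorff_dim J in
   [/\ (h < (1 / gamma)%:E)%E -> hausdorff_measure (fine h) J = 0%E,
       ((1 / gamma)%:E < h)%E ->
         packing_dim J = hausdorff_dim J /\
         packing_measure (fine h) J = +oo%E &
       c2 `^ (2 / gamma) * (N%:R + 1) <= T%:R ->
         ((1 / gamma)%:E < hausdorff_dim J)%E])
  /\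
  (is_CIFS closed_disk (sys_G d T) ->
   let J := limit_set closed_disk (sys_G d T) in
   let h := hausdorff_dim J in
   [/\ (h < (1 / gamma)%:E)%E -> hausdorff_measure (fine h) J = 0%E,
       ((1 / gamma)%:E < h)%E ->
         packing_dim J = hausdorff_dim J /\
         packing_measure (fine h) J = +oo%E &
       c2 `^ (2 / gamma) * (N%:R + 1) <= T%:R ->
         ((1 / gamma)%:E < hausdorff_dim J)%E]).
Proof.
split=> [] [ifs osc _ _].
- apply: (limit_set_conclusion hd hT hc1 hc12 hgamma hN hgrowth (sys_F_bilip hd osc)).
  + exact: ratio_F_letter_bounds.
  + exact: enorm_sys_F_bounds.
  + by move=> p x y _ _; exact: sys_F_lower.
(* The strict inequality makes the expansion rate [lam] of the denominators exceed 1. *)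
- have d12 := sys_G_IFS_gt2 hd hT ifs.
  apply: (limit_set_conclusion hd hT hc1 hc12 hgamma hN hgrowth (sys_G_bilip hd d12 osc)).
  + move=> p; rewrite ratio_G_letter // lexx /= -[leLHS]mul1r ler_pM2r ?ler1n //.
    by rewrite invr_gt0 exprn_gt0 // (lt_le_trans _ (calD_ge2 hd _)).
  + exact: enorm_sys_G_bounds.
  + exact: sys_G_lower.
Qed.
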